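(* Let $\Bbbk$ be an algebraically closed field and let $\Lambda$ be a symmetric special biserial $\Bbbk$-algebra. If $V$ is a band right $\Lambda$-module that lies in the mouth of its stable homogeneous tube of the stable Auslander-Reiten quiver of $\Lambda$ and $\underline{\mathrm{End}}_\Lambda(V)\cong\Bbbk$, then the versal deformation ring $R(\Lambda,V)$ is universal and isomorphic to $\Bbbk[\![t]\!]$.
   Context: Special biserial algebras: a finite dimensional algebra $\Lambda=\Bbbk Q/I$ ($Q$ a finite quiver, $I=\langle\rho\rangle$ an admissible ideal) is special biserial if every vertex of $Q$ is the start of at most two arrows and the end of at most two arrows, and for every arrow $\beta$ there is at most one arrow $\alpha$ with $\alpha\beta\notin I$ and at most one arrow $\gamma$ with $\beta\gamma\notin I$. It is symmetric if $\Lambda\cong\mathrm{Hom}_\Bbbk(\Lambda,\Bbbk)$ as $\Lambda$-$\Lambda$-bimodules. Paths are written left to right, and right $\Lambda$-modules are identified with representations of the bound quiver $(Q,\rho)$. Bands: for an arrow $\beta$, $\beta^{-1}$ denotes its formal inverse, starting where $\beta$ ends and ending where $\beta$ starts. A band is a cyclic word $b=\alpha_1\cdots\alpha_r$ ($r\ge1$), each $\alpha_k$ being an arrow or the formal inverse of an arrow, containing both arrows and inverse arrows, such that (indices modulo $r$) $\alpha_k$ ends where $\alpha_{k+1}$ starts, $\alpha_{k+1}\ne\alpha_k^{-1}$, $b$ is not a proper power of another word, and no subword (or inverse of a subword) of any power of $b$ is a path that lies in $I$ or that occurs as a summand of a minimal relation in $I$. Band modules: for $\lambda\in\Bbbk^\ast$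 and an integer $m\ge1$, the band module $V(b,\lambda,m)$ is the following representation. Let $v_k$ be the vertex where $\alpha_k$ starts. At each vertex $v$ of $Q$ the space has one copy of $\Bbbk^m$ for each position $k$ (modulo $r$) with $v_k=v$. For $1\le k\le r-1$, the arrow underlying $\alpha_k$ acts between the copies of $\Bbbk^m$ at the start and end positions of $\alpha_k$ (in the direction of the arrow) by the identity matrix; the arrow underlying $\alpha_r$ acts between the copies at the start and end positions of $\alpha_r$ (in the direction of the arrow) by the Jordan block $J_m(\lambda)$ if $\alpha_r$ is an arrow, and by $J_m(\lambda^{-1})$ if $\alpha_r$ is the formal inverse of an arrow. All other components of the arrow maps are zero. A band module is a module isomorphic to some $V(b,\lambda,m)$. Band modules lie in stable homogeneous tubes (known result). Stable homogeneous tube: a component of the stable Auslander-Reiten quiver (the Auslander-Reiten quiver with the projective-injective vertices removed) of the form $\mathbb{Z}\mathbb{A}_\infty/\langle\tau_\Lambda\rangle$, $\tau_\Lambda$ being the Auslander-Reiten translation. Its vertices are pairwise non-isomorphic indecomposables $V[1],V[2],\ldots$ with $\tau_\Lambda V[\ell]\cong V[\ell]$ and, for each $\ell\ge1$, one arrow $V[\ell]\to V[\ell+1]$ and one arrow $V[\ell+1]\to V[\ell]$. Its mouth is the level consisting of $V[1]$. Stable endomorphism ring: $\underline{\mathrm{End}}_\Lambda(V)$ is the quotient of $\mathrm{End}_\Lambda(V)$ by the ideal of endomorphisms that factor through a projective module. Deformations: $\widehat{\mathcal{C}}$ is the category of complete local commutative Noetherian $\Bbbk$-algebras with residue field $\Bbbk$;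 morphisms are continuous $\Bbbk$-algebra homomorphisms inducing the identity on $\Bbbk$. For $R$ in $\widehat{\mathcal{C}}$ put $R\Lambda=R\otimes_\Bbbk\Lambda$. A lift $(M,\phi)$ of $V$ over $R$ is a finitely generated right $R\Lambda$-module $M$ that is free over $R$, together with an isomorphism of $\Lambda$-modules $\phi:\Bbbk\otimes_R M\to V$. Two lifts $(M,\phi),(M',\phi')$ over $R$ are isomorphic if there is an $R\Lambda$-module isomorphism $f:M\to M'$ with $\phi'\circ(\mathrm{id}_\Bbbk\otimes_R f)=\phi$. An isomorphism class $[M,\phi]$ of lifts is a deformation of $V$ over $R$. The functor $\widehat{F}_V:\widehat{\mathcal{C}}\to\mathrm{Sets}$ sends $R$ to the set of deformations of $V$ over $R$, and sends $\theta:R\to R'$ to the map $[M,\phi]\mapsto[R'\otimes_{R,\theta}M,\phi_\theta]$, where $\phi_\theta$ is the composition $\Bbbk\otimes_{R'}(R'\otimes_{R,\theta}M)\cong\Bbbk\otimes_R M\xrightarrow{\phi}V$. An object $R(\Lambda,V)$ of $\widehat{\mathcal{C}}$ is the versal deformation ring of $V$ if there is a deformation $[U,\phi_U]$ of $V$ over $R(\Lambda,V)$ such that for every $R$ in $\widehat{\mathcal{C}}$ and every deformation $[M,\phi]$ of $V$ over $R$ there is a morphism $\psi:R(\Lambda,V)\to R$ in $\widehat{\mathcal{C}}$ with $\widehat{F}_V(\psi)[U,\phi_U]=[M,\phi]$, and $\psi$ is unique when $R=\Bbbk[\epsilon]$ with $\epsilon^2=0$. It is universal if $\psi$ is unique for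 all $R$ and all $[M,\phi]$, i.e. $R(\Lambda,V)$ represents $\widehat{F}_V$. Every finite dimensional module has a versal deformation ring (known result), well defined up to isomorphism. *)

(* Defs.v *)
From HB Require Import structures.
From mathcomp Require Import all_boot all_order all_algebra all_field.
From mathcomp Require Import finmap boolp.

Set Implicit Arguments.
Unset Strict Implicit.
Unset Printing Implicit Defensive.

Import GRing.Theory.
Local Open Scope ring_scope.

Record quiver := Quiver {
  vert : finType;
  arr : finType;
  src : arr -> vert;
  tgt : arr -> vert
}.

(* Paths are written left to right: the sequence [:: a1; ...; an] starting at
   v is a path when a1 starts at v and each arrow ends where the next starts. *)
Fixpoint composable (Q : quiver) (v : vert Q) (s : seq (arr Q)) : bool :=
  if s is a :: s' then (src a == v) && composable (tgt a) s' else true.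

Definition qpath (Q : quiver) :=
  {p : vert Q * seq (arr Q) | composable p.1 p.2}.

Definition qarrows (Q : quiver) (p : qpath Q) : seq (arr Q) := (val p).2.
Definition qlen (Q : quiver) (p : qpath Q) : nat := size (qarrows p).
Definition qsrc (Q : quiver) (p : qpath Q) : vert Q := (val p).1.
Definition qtgt (Q : quiver) (p : qpath Q) : vert Q :=
  last (qsrc p) [seq tgt a | a <- qarrows p].

(* The underlying vector space of the path algebra kQ. *)
Definition path_comb (k : fieldType) (Q : quiver) := {fsfun qpath Q -> k with 0}.

(* A homomorphism of algebras kQ -> L, given by the images of the vertices and
   of the arrows. *)
Record quiver_map (k : fieldType) (L : falgType k) (Q : quiver) := QuiverMap {
  im_vert : vert Q -> L;
  im_arr : arr Q -> L;
  im_vertM : forall v w,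
    im_vert v * im_vert w = if v == w then im_vert v else 0;
  im_vert_sum : \sum_v im_vert v = 1;
  im_arr_corner : forall a,
    im_vert (src a) * im_arr a * im_vert (tgt a) = im_arr a
}.

Definition im_path (k : fieldType) (L : falgType k) (Q : quiver)
    (pi : quiver_map L Q) (p : qpath Q) : L :=
  im_vert pi (qsrc p) * \prod_(a <- qarrows p) im_arr pi a.

Definition im_comb (k : fieldType) (L : falgType k) (Q : quiver)
    (pi : quiver_map L Q) (x : path_comb k Q) : L :=
  \sum_(p <- finsupp x) x p *: im_path pi p.

(* L = kQ/I, where I is the kernel of kQ -> L, the latter is onto, and I is
   admissible: J^N <= I <= J^2 for some N >= 2, with J the arrow ideal. *)
Record bound_quiver_algebra (k : fieldType) (L : falgType k) (Q : quiver) :=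
  BoundQuiverAlgebra {
  bq_map :> quiver_map L Q;
  bq_onto : forall y : L, exists x : path_comb k Q, im_comb bq_map x = y;
  bq_nilp : exists2 N, (2 <= N)%N &
    forall p : qpath Q, (N <= qlen p)%N -> im_path bq_map p = 0;
  bq_adm : forall x : path_comb k Q, im_comb bq_map x = 0 ->
    forall p, p \in finsupp x -> (2 <= qlen p)%N
}.

Definition in_I (k : fieldType) (L : falgType k) (Q : quiver)
    (pi : quiver_map L Q) (x : path_comb k Q) : Prop := im_comb pi x = 0.

Definition path_in_I (k : fieldType) (L : falgType k) (Q : quiver)
    (pi : quiver_map L Q) (p : qpath Q) : Prop := im_path pi p = 0.

(* A nonzero element of I, all of whose paths are parallel, such that no sum
   over a nonempty proper subset of its terms lies in I. *)
Definition minimal_relation (k : fieldType) (L : falgType k) (Q : quiver)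
    (pi : quiver_map L Q) (x : path_comb k Q) : Prop :=
  [/\ in_I pi x,
      finsupp x != fset0,
      forall p q, p \in finsupp x -> q \in finsupp x ->
        qsrc p = qsrc q /\ qtgt p = qtgt q
    & forall S : {fset qpath Q}, (S `<` finsupp x)%fset -> S != fset0 ->
        \sum_(p <- S) x p *: im_path pi p <> 0].

(* The product of the images of two arrows a, b is 0 unless ab is a path, and
   it is the image of ab if ab is a path. *)
Definition special_biserial (k : fieldType) (L : falgType k) (Q : quiver)
    (pi : bound_quiver_algebra L Q) : Prop :=
  [/\ forall v, (#|[set a : arr Q | src a == v]| <= 2)%N,
      forall v, (#|[set a : arr Q | tgt a == v]| <= 2)%N,
      forall b : arr Q,
        (#|[set a : arr Q | (im_arr pi a * im_arr pi b != 0)%R]| <= 1)%N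
    & forall b : arr Q,
        (#|[set c : arr Q | (im_arr pi b * im_arr pi c != 0)%R]| <= 1)%N].

(* The bimodule structure on Hom_k(L, k) is (a f b)(y) = f(b y a). *)
Definition symmetric_algebra (k : fieldType) (L : falgType k) : Prop :=
  exists2 theta : {linear L -> 'Hom(L, k^o)}, bijective theta &
    forall a x b y : L, theta (a * x * b) y = theta x (b * y * a).

(* ract a is the map x |-> x a. *)
Record rmod (k : fieldType) (L : falgType k) := RMod {
  rcar :> vectType k;
  ract : {linear L -> 'End(rcar)};
  ract1 : ract 1 = \1%VF;
  ractM : forall a b, ract (a * b) = (ract b \o ract a)%VF
}.

Definition equivariant (k : fieldType) (L : falgType k) (M N : rmod L) :
    {pred 'Hom(M, N)} :=
  fun f => `[< forall a x, f (ract M a x) = ract N a (f x) >].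

Lemma equivariantP (k : fieldType) (L : falgType k) (M N : rmod L)
    (f : 'Hom(M, N)) :
  reflect (forall a x, f (ract M a x) = ract N a (f x))
          (f \in @equivariant k L M N).
Proof. exact: asboolP. Qed.

Fact equivariant_submod_closed (k : fieldType) (L : falgType k)
  (M N : rmod L) : GRing.submod_closed (@equivariant k L M N).
Proof.
split; first by apply/equivariantP => a x; rewrite !zero_lfunE linear0.
move=> c f g /equivariantP hf /equivariantP hg; apply/equivariantP => a x.
by rewrite !add_lfunE !scale_lfunE hf hg linearP.
Qed.

HB.instance Definition _ (k : fieldType) (L : falgType k) (M N : rmod L) :=
  GRing.isSubmodClosed.Build k 'Hom(M, N) (@equivariant k L M N)
    (@equivariant_submod_closed k L M N).

Record rhom (k : fieldType) (L : falgType k) (M N : rmod L) := RHom {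
  rhom_lfun :> 'Hom(M, N);
  rhomP : rhom_lfun \in @equivariant k L M N
}.

HB.instance Definition _ (k : fieldType) (L : falgType k) (M N : rmod L) :=
  [isSub for @rhom_lfun k L M N].
HB.instance Definition _ (k : fieldType) (L : falgType k) (M N : rmod L) :=
  [Choice of @rhom k L M N by <:].
HB.instance Definition _ (k : fieldType) (L : falgType k) (M N : rmod L) :=
  [SubChoice_isSubLmodule of @rhom k L M N by <:].

Fact rid_subproof (k : fieldType) (L : falgType k) (M : rmod L) :
  \1%VF \in @equivariant k L M M.
Proof. by apply/equivariantP => a x; rewrite !id_lfunE. Qed.

Definition rid (k : fieldType) (L : falgType k) (M : rmod L) : rhom M M :=
  RHom (rid_subproof M).

Fact rcomp_subproof (k : fieldType) (L : falgType k) (M N P : rmod L)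
  (g : rhom N P) (f : rhom M N) : (g \o f)%VF \in @equivariant k L M P.
Proof.
apply/equivariantP => a x; rewrite !comp_lfunE.
by rewrite (equivariantP _ (rhomP f)) (equivariantP _ (rhomP g)).
Qed.

Definition rcomp (k : fieldType) (L : falgType k) (M N P : rmod L)
    (g : rhom N P) (f : rhom M N) : rhom M P :=
  RHom (rcomp_subproof g f).

Definition riso (k : fieldType) (L : falgType k) (M N : rmod L) : Prop :=
  exists f : rhom M N, bijective f.

Definition submodule (k : fieldType) (L : falgType k) (M : rmod L)
    (U : {vspace M}) : Prop :=
  forall a x, x \in U -> ract M a x \in U.

Definition indecomposable (k : fieldType) (L : falgType k) (M : rmod L) : Prop :=
  dim M <> 0%N /\
  forall U W : {vspace M}, submodule U -> submodule W ->
    (U + W)%VS = fullv -> (U :&: W)%VS = 0%VS -> U = 0%VS \/ W = 0%VS.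

Definition projective (k : fieldType) (L : falgType k) (P : rmod L) : Prop :=
  forall (M N : rmod L) (g : rhom M N) (f : rhom P N), limg g = fullv ->
    exists h : rhom P M, rcomp g h = f.

Definition injective_mod (k : fieldType) (L : falgType k) (E : rmod L) : Prop :=
  forall (M N : rmod L) (g : rhom M N) (f : rhom M E), lker g = 0%VS ->
    exists h : rhom N E, rcomp h g = f.

Definition factors_through_projective (k : fieldType) (L : falgType k)
    (M N : rmod L) (f : rhom M N) : Prop :=
  exists (P : rmod L) (g : rhom M P) (h : rhom P N),
    projective P /\ f = rcomp h g.

(* An isomorphism of k-algebras from the stable endomorphism ring to k is a
   homomorphism of k-algebras End_L(V) -> k whose kernel is the ideal of
   endomorphisms factoring through a projective module. *)
Definition stable_End_iso_k (k : fieldType) (L : falgType k) (V : rmod L) : Prop :=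
  exists chi : {linear rhom V V -> k^o},
    [/\ chi (rid V) = 1,
        forall f g : rhom V V, chi (rcomp g f) = chi g * chi f
      & forall f : rhom V V, chi f = 0 <-> factors_through_projective f].

Fact regular_act1 (k : fieldType) (L : falgType k) :
  amulr (1 : L) = \1%VF.
Proof. by apply/lfunP => x; rewrite lfunE /= mulr1 id_lfunE. Qed.

Fact regular_actM (k : fieldType) (L : falgType k) (a b : L) :
  amulr (a * b) = (amulr b \o amulr a)%VF.
Proof. by apply/lfunP => x; rewrite comp_lfunE !lfunE /= mulrA. Qed.

Definition regular_rmod (k : fieldType) (L : falgType k) : rmod L :=
  @RMod k L L (@amulr k L) (@regular_act1 k L) (@regular_actM k L).

Fact lscale_subproof (k : fieldType) (L : falgType k) (M : rmod L) (a : L)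
    (f : rhom M (regular_rmod L)) :
  (amull a \o f)%VF \in @equivariant k L M (regular_rmod L).
Proof.
apply/equivariantP => b x; rewrite !comp_lfunE (equivariantP _ (rhomP f)).
by rewrite !lfunE /= mulrA.
Qed.

(* The left module structure on Hom_L(M, L): (a f)(x) = a f(x). *)
Definition lscale (k : fieldType) (L : falgType k) (M : rmod L) (a : L)
    (f : rhom M (regular_rmod L)) : rhom M (regular_rmod L) :=
  RHom (lscale_subproof a f).

Definition superfluous (k : fieldType) (L : falgType k) (M : rmod L)
    (K : {vspace M}) : Prop :=
  forall U : {vspace M}, submodule U -> (U + K)%VS = fullv -> U = fullv.

Definition minimal_projective_presentation (k : fieldType) (L : falgType k)
    (P1 P0 V : rmod L) (p1 : rhom P1 P0) (p0 : rhom P0 V) : Prop :=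
  [/\ projective P1 /\ projective P0,
      limg p0 = fullv,
      limg p1 = lker p0,
      superfluous (lker p0)
    & superfluous (lker p1)].

(* W is isomorphic to D Tr V. Here Tr V is the cokernel of
   Hom_L(P0, L) -> Hom_L(P1, L), g |-> g p1, and D = Hom_k(-, k), so that D Tr V
   consists of the linear forms on Hom_L(P1, L) which vanish on all g p1. *)
Definition is_AR_translate (k : fieldType) (L : falgType k) (W V : rmod L) : Prop :=
  exists (P1 P0 : rmod L) (p1 : rhom P1 P0) (p0 : rhom P0 V),
    minimal_projective_presentation p1 p0 /\
  exists Phi : W -> {linear rhom P1 (regular_rmod L) -> k^o},
    [/\ forall (c : k) (w w' : W) f,
          Phi (c *: w + w') f = c * Phi w f + Phi w' f,
        forall (a : L) (w : W) f, Phi (ract W a w) f = Phi w (lscale a f),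
        forall (w : W) (g : rhom P0 (regular_rmod L)), Phi w (rcomp g p1) = 0
      & forall xi : {linear rhom P1 (regular_rmod L) -> k^o},
          (forall g : rhom P0 (regular_rmod L), xi (rcomp g p1) = 0) ->
          exists! w : W, Phi w =1 xi].

Definition in_rad (k : fieldType) (L : falgType k) (X Y : rmod L)
    (f : rhom X Y) : Prop :=
  forall h : rhom Y X, bijective (rid X - rcomp h f).

Definition in_rad2 (k : fieldType) (L : falgType k) (X Y : rmod L)
    (f : rhom X Y) : Prop :=
  exists (Z : rmod L) (g : rhom X Z) (h : rhom Z Y),
    [/\ in_rad g, in_rad h & f = rcomp h g].

(* For indecomposable X and Y over an algebraically closed field, the number of
   arrows X -> Y in the Auslander-Reiten quiver is the dimension n of
   rad(X, Y) / rad^2(X, Y); B is a family in rad(X, Y) inducing a basis. *)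
Definition num_arrows (k : fieldType) (L : falgType k) (X Y : rmod L) (n : nat) :
    Prop :=
  exists2 B : 'I_n -> rhom X Y, (forall i, in_rad (B i)) &
    forall f : rhom X Y, in_rad f ->
      exists! c : {ffun 'I_n -> k}, in_rad2 (f - \sum_i c i *: B i).

Definition stable_vertex (k : fieldType) (L : falgType k) (X : rmod L) : Prop :=
  indecomposable X /\ ~ (projective X /\ injective_mod X).

(* T l is the module V[l.+1]: the indexing starts at 0. *)
Definition stable_homogeneous_tube (k : fieldType) (L : falgType k)
    (T : nat -> rmod L) : Prop :=
  [/\ forall i, stable_vertex (T i),
      forall i j, riso (T i) (T j) -> i = j,
      forall i, is_AR_translate (T i) (T i),
      forall i j, num_arrows (T i) (T j) ((i == j.+1) || (j == i.+1))
    & forall (X : rmod L) i, stable_vertex X ->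
        ~ num_arrows X (T i) 0 \/ ~ num_arrows (T i) X 0 ->
        exists j, riso X (T j)].

Definition in_mouth_of_homogeneous_tube (k : fieldType) (L : falgType k)
    (V : rmod L) : Prop :=
  exists2 T : nat -> rmod L, stable_homogeneous_tube T & riso V (T 0%N).

(* (a, true) is the arrow a and (a, false) is its formal inverse. *)
Notation letter Q := (arr Q * bool)%type.

Definition lstart (Q : quiver) (l : letter Q) : vert Q :=
  if l.2 then src l.1 else tgt l.1.
Definition lend (Q : quiver) (l : letter Q) : vert Q :=
  if l.2 then tgt l.1 else src l.1.
Definition linv (Q : quiver) (l : letter Q) : letter Q := (l.1, ~~ l.2).

Definition word_of_path (Q : quiver) (p : qpath Q) : seq (letter Q) :=
  [seq (a, true) | a <- qarrows p].
Definition word_inv (Q : quiver) (w : seq (letter Q)) : seq (letter Q) :=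
  rev [seq linv l | l <- w].
Definition word_pow (Q : quiver) (w : seq (letter Q)) (n : nat) :
    seq (letter Q) := flatten (nseq n w).

Definition subword_up_to_inverse (Q : quiver) (p : qpath Q)
    (w : seq (letter Q)) : Prop :=
  infix (word_of_path p) w \/ infix (word_inv (word_of_path p)) w.

(* Letters are indexed by 'I_r, and ordS is the successor modulo r. *)
Definition is_band (k : fieldType) (L : falgType k) (Q : quiver)
    (pi : bound_quiver_algebra L Q) (r : nat)
    (b : r.-tuple (letter Q)) : Prop :=
  [/\ has (fun l => l.2) b /\ has (fun l => ~~ l.2) b,
      forall i : 'I_r, lend (tnth b i) = lstart (tnth b (ordS i)),
      forall i : 'I_r, tnth b (ordS i) <> linv (tnth b i),
      forall w n, (1 < n)%N -> word_pow w n <> b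
    & forall (n : nat) (p : qpath Q), (0 < qlen p)%N ->
        subword_up_to_inverse p (word_pow b n) ->
        ~ path_in_I pi p /\
        ~ (exists2 x : path_comb k Q, minimal_relation pi x & p \in finsupp x)].

Definition jordan_block (k : fieldType) (m : nat) (lambda : k) : 'M[k]_m :=
  \matrix_(i, j) (lambda *+ (i == j) + (i.+1 == j :> nat)%:R).

(* The matrix by which the arrow underlying the i-th letter acts between the
   two copies of k^m at the ends of that letter. *)
Definition letter_mx (k : fieldType) (Q : quiver) (r : nat)
    (b : r.-tuple (letter Q)) (lambda : k) (m : nat) (i : 'I_r) : 'M[k]_m :=
  if i.+1 == r then
    jordan_block m (if (tnth b i).2 then lambda else lambda^-1)
  else 1%:M.

(* The total space of the representation V(b, lambda, m): the i-th component is
   the copy of k^m at the position where the i-th letter starts. The i-th letter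
   joins the positions i and ordS i. *)
Definition band_vert (k : fieldType) (Q : quiver) (r : nat)
    (b : r.-tuple (letter Q)) (m : nat) (v : vert Q)
    (x : {ffun 'I_r -> 'cV[k]_m}) : {ffun 'I_r -> 'cV[k]_m} :=
  [ffun j => if lstart (tnth b j) == v then x j else 0].

Definition band_arr (k : fieldType) (Q : quiver) (r : nat)
    (b : r.-tuple (letter Q)) (lambda : k) (m : nat) (a : arr Q)
    (x : {ffun 'I_r -> 'cV[k]_m}) : {ffun 'I_r -> 'cV[k]_m} :=
  [ffun j =>
     \sum_(i < r | (tnth b i == (a, true)) && (ordS i == j))
        letter_mx b lambda m i *m x i
   + \sum_(i < r | (tnth b i == (a, false)) && (i == j))
        letter_mx b lambda m i *m x (ordS i)].

(* A right module M corresponds to the representation with spaces M e_v, on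
   which the arrows act by right multiplication. *)
Definition band_module (k : fieldType) (L : falgType k) (Q : quiver)
    (pi : bound_quiver_algebra L Q) (V : rmod L) : Prop :=
  exists (r : nat) (b : r.-tuple (letter Q)) (lambda : k) (m : nat),
    [/\ is_band pi b, lambda != 0, (0 < m)%N
      & exists Phi : {linear V -> {ffun 'I_r -> 'cV[k]_m}},
        [/\ bijective Phi,
            forall v x, Phi (ract V (im_vert pi v) x) = band_vert b v (Phi x)
          & forall a x,
              Phi (ract V (im_arr pi a) x) = band_arr b lambda a (Phi x)]].

Definition is_ideal (R : nzRingType) (I : R -> Prop) : Prop :=
  [/\ I 0, forall x y, I x -> I y -> I (x + y) & forall a x, I x -> I (a * x)].

Definition noetherian (R : comNzRingType) : Prop :=
  forall I : R -> Prop, is_ideal I ->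
    exists n (g : 'I_n -> R),
      forall x, I x <-> exists c : 'I_n -> R, x = \sum_i c i * g i.

Fixpoint ideal_pow (R : nzRingType) (I : R -> Prop) (n : nat) : R -> Prop :=
  if n is n'.+1 then
    fun x => exists2 s : seq (R * R),
      (forall p, p \in s -> I p.1 /\ ideal_pow I n' p.2) &
      x = \sum_(p <- s) p.1 * p.2
  else fun _ => True.

(* R is the inverse limit of the R / I^n. *)
Definition adically_complete (R : nzRingType) (I : R -> Prop) : Prop :=
  (forall x, (forall n, ideal_pow I n x) -> x = 0) /\
  (forall u : nat -> R, (forall n, ideal_pow I n (u n.+1 - u n)) ->
     exists x, forall n, ideal_pow I n (x - u n)).

(* The residue map identifies the residue field with k. By chat_local every
   element outside its kernel is invertible, so that R is local and the kernel
   is the maximal ideal. *)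
Record chat (k : fieldType) := Chat {
  chat_sort :> comAlgType k;
  chat_res : {lrmorphism chat_sort -> k^o};
  chat_local : forall x, chat_res x != 0 -> exists y, x * y = 1;
  chat_noeth : noetherian chat_sort;
  chat_complete : adically_complete (fun x => chat_res x = 0)
}.

Definition maxideal (k : fieldType) (R : chat k) : R -> Prop :=
  fun x => chat_res R x = 0.

Record chat_hom (k : fieldType) (R S : chat k) := ChatHom {
  chat_fun :> {lrmorphism R -> S};
  chat_continuous : forall n, exists N, forall x,
    ideal_pow (@maxideal k R) N x -> ideal_pow (@maxideal k S) n (chat_fun x);
  chat_fun_res : forall x, chat_res S (chat_fun x) = chat_res R x
}.

(* R is k[epsilon] with epsilon^2 = 0. *)
Definition is_dual_numbers (k : fieldType) (R : comAlgType k) : Prop :=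
  exists2 eps : R, eps * eps = 0 &
    forall x : R, exists! c : k * k, x = c.1 *: 1 + c.2 *: eps.

Definition semilinear_along (R S : nzRingType) (theta : R -> S) (M : lmodType R)
    (N : lmodType S) (iota : M -> N) : Prop :=
  forall r x y, iota (r *: x + y) = theta r *: iota x + iota y.

(* N, with iota : x |-> 1 (x) x, is the extension of scalars of M along theta,
   that is, the tensor product of S and M over R. *)
Definition extension_of_scalars (R S : nzRingType) (theta : R -> S)
    (M : lmodType R) (N : lmodType S) (iota : M -> N) : Prop :=
  semilinear_along theta iota /\
  forall (P : lmodType S) (g : M -> P), semilinear_along theta g ->
    exists h : {linear N -> P}, (forall x, h (iota x) = g x) /\
      forall h' : {linear N -> P}, (forall x, h' (iota x) = g x) -> h' =1 h.

Definition free_of_finite_rank (R : nzRingType) (M : lmodType R) : Prop :=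
  exists n (e : 'I_n -> M),
    forall x, exists! c : {ffun 'I_n -> R}, x = \sum_i c i *: e i.

(* A lift of V over R. A right module over R (x) L is an R-module with a right
   action of L by R-linear maps on which the two actions of k agree. The
   isomorphism phi : k (x)_R M -> V is given by x |-> phi (1 (x) x). *)
Record mod_lift (k : fieldType) (L : falgType k) (V : rmod L) (R : chat k) := ModLift {
  lift_car :> lmodType R;
  lift_act : L -> {linear lift_car -> lift_car};
  lift_actP : forall (c : k) a b x,
    lift_act (c *: a + b) x = (c *: (1 : R)) *: lift_act a x + lift_act b x;
  lift_act1 : forall x, lift_act 1 x = x;
  lift_actM : forall a b x, lift_act (a * b) x = lift_act b (lift_act a x);
  lift_free : free_of_finite_rank lift_car;
  lift_phi : lift_car -> V;
  lift_phi_iso : extension_of_scalars (chat_res R : R -> k) lift_phi;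
  lift_phi_act : forall a x, lift_phi (lift_act a x) = ract V a (lift_phi x)
}.

Definition lift_iso (k : fieldType) (L : falgType k) (V : rmod L) (R : chat k)
    (M M' : mod_lift V R) : Prop :=
  exists f : {linear M -> M'},
    [/\ bijective f,
        forall a x, f (lift_act M a x) = lift_act M' a (f x)
      & forall x, lift_phi (f x) = lift_phi x].

(* N is the lift (S (x)_{R, theta} M, phi_theta). *)
Definition is_base_change (k : fieldType) (L : falgType k) (V : rmod L)
    (R S : chat k) (theta : chat_hom R S) (M : mod_lift V R) (N : mod_lift V S) : Prop :=
  exists iota : M -> N,
    [/\ extension_of_scalars theta iota,
        forall a x, iota (lift_act M a x) = lift_act N a (iota x)
      & forall x, lift_phi (iota x) = lift_phi x].

(* F_V(theta)[M, phi] = [M', phi'] *)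
Definition deformation_map (k : fieldType) (L : falgType k) (V : rmod L)
    (R S : chat k) (theta : chat_hom R S) (M : mod_lift V R) (M' : mod_lift V S) : Prop :=
  exists2 N : mod_lift V S, is_base_change theta M N & lift_iso N M'.

Definition versal (k : fieldType) (L : falgType k) (V : rmod L) (R : chat k)
    (U : mod_lift V R) : Prop :=
  (forall (S : chat k) (M : mod_lift V S),
     exists psi : chat_hom R S, deformation_map psi U M) /\
  (forall (S : chat k) (M : mod_lift V S) (psi psi' : chat_hom R S),
     is_dual_numbers S -> deformation_map psi U M ->
     deformation_map psi' U M -> psi =1 psi').

Definition universal (k : fieldType) (L : falgType k) (V : rmod L) (R : chat k)
    (U : mod_lift V R) : Prop :=
  forall (S : chat k) (M : mod_lift V S),
    exists psi : chat_hom R S, deformation_map psi U M /\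
      forall psi' : chat_hom R S, deformation_map psi' U M -> psi' =1 psi.

Definition powser (k : fieldType) : Type := nat -> k.

HB.instance Definition _ (k : fieldType) := gen_eqMixin (powser k).
HB.instance Definition _ (k : fieldType) := gen_choiceMixin (powser k).

Definition ps_zero (k : fieldType) : powser k := fun=> 0.
Definition ps_opp (k : fieldType) (f : powser k) : powser k := fun n => - f n.
Definition ps_add (k : fieldType) (f g : powser k) : powser k :=
  fun n => f n + g n.
Definition ps_one (k : fieldType) : powser k := fun n => (n == 0%N)%:R.
Definition ps_mul (k : fieldType) (f g : powser k) : powser k :=
  fun n => \sum_(i < n.+1) f i * g (n - i)%N.
Definition ps_scale (k : fieldType) (c : k) (f : powser k) : powser k :=
  fun n => c * f n.

Fact ps_addA (k : fieldType) : associative (@ps_add k).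
Proof. by move=> f g h; apply/funext => n; rewrite /ps_add addrA. Qed.
Fact ps_addC (k : fieldType) : commutative (@ps_add k).
Proof. by move=> f g; apply/funext => n; rewrite /ps_add addrC. Qed.
Fact ps_add0 (k : fieldType) : left_id (@ps_zero k) (@ps_add k).
Proof. by move=> f; apply/funext => n; rewrite /ps_add add0r. Qed.
Fact ps_addN (k : fieldType) : left_inverse (@ps_zero k) (@ps_opp k) (@ps_add k).
Proof. by move=> f; apply/funext => n; rewrite /ps_add addNr. Qed.

HB.instance Definition _ (k : fieldType) :=
  GRing.isZmodule.Build (powser k)
    (@ps_addA k) (@ps_addC k) (@ps_add0 k) (@ps_addN k).

Definition ps_trunc (k : fieldType) (n : nat) (f : powser k) : {poly k} :=
  \poly_(i < n.+1) f i.

Fact ps_mul_trunc (k : fieldType) (n j : nat) (f g : powser k) :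
  (j <= n)%N -> ps_mul f g j = (ps_trunc n f * ps_trunc n g)`_j.
Proof.
move=> jn; rewrite coefM; apply: eq_bigr => i _; rewrite !coef_poly !ltnS.
have ij : (i <= j)%N by rewrite -ltnS.
by rewrite (leq_trans ij jn) (leq_trans (leq_subr _ _) jn).
Qed.

Fact ps_mulC (k : fieldType) : commutative (@ps_mul k).
Proof.
by move=> f g; apply/funext => n; rewrite !(ps_mul_trunc _ _ (leqnn n)) mulrC.
Qed.

Fact ps_mulA (k : fieldType) : associative (@ps_mul k).
Proof.
have eL (f g h : powser k) n : ps_mul (ps_mul f g) h n =
    (ps_trunc n f * ps_trunc n g * ps_trunc n h)`_n.
  rewrite coefM /ps_mul; apply: eq_bigr => i _.
  have ni : (i <= n)%N by rewrite -ltnS.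
  by rewrite -/(ps_mul f g i) (ps_mul_trunc _ _ ni) [in RHS]coef_poly ltnS
    leq_subr.
move=> f g h; apply/funext => n.
by rewrite ps_mulC !eL mulrC mulrA.
Qed.

Fact ps_mul1 (k : fieldType) : left_id (@ps_one k) (@ps_mul k).
Proof.
move=> f; apply/funext => n; rewrite /ps_mul big_ord_recl /= mul1r subn0.
by rewrite big1 ?addr0 // => i _; rewrite /ps_one /= mul0r.
Qed.

Fact ps_mulDl (k : fieldType) : left_distributive (@ps_mul k) (@ps_add k).
Proof.
move=> f g h; apply/funext => n; rewrite /ps_add /ps_mul -big_split /=.
by apply: eq_bigr => i _; rewrite mulrDl.
Qed.

Fact ps_1neq0 (k : fieldType) : @ps_one k != 0.
Proof.
by apply/eqP => /(congr1 (fun f : powser k => f 0%N)) /eqP; rewrite oner_eq0.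
Qed.

HB.instance Definition _ (k : fieldType) :=
  GRing.Zmodule_isComNzRing.Build (powser k)
    (@ps_mulA k) (@ps_mulC k) (@ps_mul1 k) (@ps_mulDl k) (@ps_1neq0 k).

Fact ps_scaleA (k : fieldType) (a b : k) (f : powser k) :
  ps_scale a (ps_scale b f) = ps_scale (a * b) f.
Proof. by apply/funext => n; rewrite /ps_scale mulrA. Qed.
Fact ps_scale1 (k : fieldType) : left_id 1 (@ps_scale k).
Proof. by move=> f; apply/funext => n; rewrite /ps_scale mul1r. Qed.
Fact ps_scaleDr (k : fieldType) : right_distributive (@ps_scale k) +%R.
Proof. by move=> a f g; apply/funext => n; rewrite /ps_scale mulrDr. Qed.
Fact ps_scaleDl (k : fieldType) (f : powser k) :
  {morph (@ps_scale k)^~ f : a b / a + b}.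
Proof. by move=> a b; apply/funext => n; rewrite /ps_scale mulrDl. Qed.

HB.instance Definition _ (k : fieldType) :=
  GRing.Zmodule_isLmodule.Build k (powser k)
    (@ps_scaleA k) (@ps_scale1 k) (@ps_scaleDr k) (@ps_scaleDl k).

Fact ps_scaleAl (k : fieldType) (a : k) (f g : powser k) :
  a *: (f * g) = a *: f * g.
Proof.
apply/funext => n; rewrite /GRing.scale /GRing.mul /= /ps_scale /ps_mul.
by rewrite mulr_sumr; apply: eq_bigr => i _; rewrite mulrA.
Qed.

HB.instance Definition _ (k : fieldType) :=
  GRing.Lmodule_isLalgebra.Build k (powser k) (@ps_scaleAl k).
HB.instance Definition _ (k : fieldType) :=
  GRing.Lalgebra_isComAlgebra.Build k (powser k).

Definition alg_iso (k : fieldType) (A B : comAlgType k) : Prop :=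
  exists f : {lrmorphism A -> B}, bijective f.

(* Main.v *)
From HB Require Import structures.
Require Import Defs.
From mathcomp Require Import all_boot all_order all_algebra all_field.
From mathcomp Require Import perm finmap boolp.
From mathcomp Require Import ring zify.

Set Implicit Arguments.
Unset Strict Implicit.
Unset Printing Implicit Defensive.

Import GRing.Theory.
Local Open Scope ring_scope.

(** The theorem holds because [V] has a universal lift over the power series
    ring in one variable [t]: the band module with the matrix of the last letter
    of the band perturbed by [t]. A versal ring is then compared with this ring
    by elementary means.

    In a basis of [V] a lift over [R] is a representation [rho] of [L] by
    matrices over [R] which reduces to the matrices [D0] of [V], and isomorphisms
    of lifts are conjugations by matrices that reduce to [1]. Infinitesimally
    this is a matter of derivations [d], where
    [d (x * y) = d x * D0 y + D0 x * d y], modulo the inner ones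
    [D0 y * X - X * D0 y]. Three facts over [k] are needed.

    - Derivations modulo inner derivations have dimension at most one
      ([derivation_modulo_inner]). As [L] is symmetric, the Auslander-Reiten
      translate of [V] is the kernel of [p1] in a minimal projective
      presentation [P1 -> P0 -> V], so [V] being its own translate yields an
      exact sequence [0 -> V -> P1 -> P0 -> V -> 0]. A derivation has a class in
      the homomorphisms [P1 -> V] modulo those that factor through [p1]. The
      trace pairing identifies this quotient with the dual of the endomorphism
      algebra of [V], and on the classes of derivations only the stable
      endomorphisms matter, which are the scalars.
    - An endomorphism of [V] is a scalar plus an endomorphism factoring through
      a projective module. By Higman's criterion ([higman]) the latter is a
      trace [\sum_i D0 (a i) * G * D0 (b i)] for dual bases [a] and [b] of [L].
      Both kinds lift along every deformation.
    - The derivative at [t = 0] of the family over the power series ring is not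
      inner ([tangent_not_inner]). The family exists for any matrix in the last
      position of the band, since the paths occurring in minimal relations are
      never read along the band and act as zero. The derivative is not inner
      because going once around the band would express an elementary matrix as a
      commutator with a Jordan block, and its corner is chosen so that this is
      impossible.

    The first and the third fact let one match any lift over a complete local
    algebra with a member of the family, by successive approximation modulo
    powers of the maximal ideal ([family_versal]). The second and the third
    show that the parameter is unique ([family_universal]): an isomorphism
    between two members of the family that agree to some order is, to that
    order, the reduction of an automorphism, so that the members agree to the
    next order.

    Finally let [U] over [R] be any versal lift. It comes from the universal one
    along some [phi] from the power series ring to [R]. By uniqueness for the
    dual numbers the image of [t] spans the maximal ideal of [R] modulo its
    square ([maxideal_generated]), hence [phi] is onto. It has a left inverse
    because [U] in turn specializes to the universal lift. So [phi] is an
    isomorphism and universality is transported along it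
    ([versal_universal_powser]). *)
(** * Powers of the maximal ideal *)

Section MaxIdealPowers.
Variables (k : fieldType) (R : chat k).

Definition mpow (n : nat) (x : R) : Prop := ideal_pow (@maxideal k R) n x.

Lemma resM (x y : R) : chat_res R (x * y) = chat_res R x * chat_res R y.
Proof. exact: rmorphM. Qed.

Lemma res1 : chat_res R 1 = 1.
Proof. exact: rmorph1. Qed.

Lemma resZ (c : k) (x : R) : chat_res R (c *: x) = c * chat_res R x.
Proof. exact: linearZ. Qed.

Lemma resD (x y : R) : chat_res R (x + y) = chat_res R x + chat_res R y.
Proof. exact: raddfD. Qed.

Lemma resB (x y : R) : chat_res R (x - y) = chat_res R x - chat_res R y.
Proof. exact: raddfB. Qed.

Lemma resN (x : R) : chat_res R (- x) = - chat_res R x.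
Proof. exact: raddfN. Qed.

Lemma res_sum (I : Type) (s : seq I) (P : pred I) (F : I -> R) :
  chat_res R (\sum_(i <- s | P i) F i) = \sum_(i <- s | P i) chat_res R (F i).
Proof. exact: raddf_sum. Qed.

Lemma mpow0 x : mpow 0 x. Proof. by []. Qed.

Lemma mpow_zero n : mpow n 0.
Proof. by case: n => // n; exists [::]; rewrite ?big_nil. Qed.

Lemma mpowD n x y : mpow n x -> mpow n y -> mpow n (x + y).
Proof.
case: n => // n [s hs ->] [t ht ->]; exists (s ++ t); last by rewrite big_cat.
by move=> p; rewrite mem_cat => /orP[/hs|/ht].
Qed.

Lemma mpowMl n a x : mpow n x -> mpow n (a * x).
Proof.
elim: n a x => // n IHn a x [s hs ->].
exists [seq (p.1, a * p.2) | p <- s].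
  by move=> _ /mapP[p /hs[h1 h2] ->]; split=> //=; apply: IHn.
by rewrite big_map mulr_sumr; apply: eq_bigr => p _; rewrite mulrCA.
Qed.

Lemma mpowMr n a x : mpow n x -> mpow n (x * a).
Proof. by rewrite mulrC; apply: mpowMl. Qed.

Lemma mpowN n x : mpow n x -> mpow n (- x).
Proof. by rewrite -mulN1r; apply: mpowMl. Qed.

Lemma mpowB n x y : mpow n x -> mpow n y -> mpow n (x - y).
Proof. by move=> hx /mpowN; apply: mpowD. Qed.

Lemma mpowZ n (c : k) x : mpow n x -> mpow n (c *: x).
Proof. by rewrite -mulr_algl; apply: mpowMl. Qed.

Lemma mpow_sum n (I : Type) (s : seq I) (P : pred I) (F : I -> R) :
  (forall i, P i -> mpow n (F i)) -> mpow n (\sum_(i <- s | P i) F i).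
Proof.
move=> h; elim/big_ind: _ => //; [exact: mpow_zero | exact: mpowD].
Qed.

Lemma mpowS n x : mpow n.+1 x -> mpow n x.
Proof.
by case=> s hs ->; rewrite big_seq; apply: mpow_sum => p /hs[_]; apply: mpowMl.
Qed.

Lemma mpowW i j x : (i <= j)%N -> mpow j x -> mpow i x.
Proof.
move/subnK <-; elim: (j - i)%N => // n IHn; rewrite addSn => /mpowS; exact: IHn.
Qed.

Lemma mpow1P x : mpow 1 x <-> chat_res R x = 0.
Proof.
split=> [[s hs ->]|hx]; last first.
  exists [:: (x, 1)]; last by rewrite big_seq1 mulr1.
  by move=> p; rewrite inE => /eqP ->.
rewrite big_seq res_sum big1 // => p /hs[h _].
by rewrite resM h mul0r.
Qed.

Lemma mpowM i j x y : mpow i x -> mpow j y -> mpow (i + j) (x * y).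
Proof.
elim: i x => [|i IHi] x; first by move=> _ /mpowMl; apply.
case=> s hs -> hy; rewrite addSn mulr_suml; exists [seq (p.1, p.2 * y) | p <- s].
  by move=> _ /mapP[p /hs[h1 h2] ->]; split=> //=; apply: IHi.
by rewrite big_map; apply: eq_bigr => p _; rewrite mulrA.
Qed.

Lemma mpowX i x : mpow 1 x -> mpow i (x ^+ i).
Proof.
move=> hx; elim: i => [|i IHi]; first exact: mpow0.
by rewrite exprS -add1n; apply: mpowM.
Qed.

Lemma mpow_separated x : (forall n, mpow n x) -> x = 0.
Proof. by case: (chat_complete R) => h _; apply: h. Qed.

Lemma mpow_limit (u : nat -> R) : (forall n, mpow n (u n.+1 - u n)) ->
  exists x, forall n, mpow n (x - u n).
Proof. by case: (chat_complete R) => _; apply. Qed.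

Lemma mpow_residue x : mpow 1 (x - chat_res R x *: 1).
Proof. by apply/mpow1P; rewrite resB resZ res1 mulr1 subrr. Qed.

End MaxIdealPowers.


(** * Matrices over a complete local algebra *)

Section LocalMatrices.
Variables (k : fieldType) (R : chat k).

Definition mxpow (d p q : nat) (A : 'M[R]_(p, q)) : Prop :=
  forall i j, mpow d (A i j).

Definition res_mx (p q : nat) (A : 'M[R]_(p, q)) : 'M[k]_(p, q) :=
  \matrix_(i, j) chat_res R (A i j).

Definition base_mx (p q : nat) (B : 'M[k]_(p, q)) : 'M[R]_(p, q) :=
  \matrix_(i, j) (B i j)%:A.

Lemma mxpow_zero d p q : mxpow d (0 : 'M[R]_(p, q)).
Proof. by move=> i j; rewrite mxE; apply: mpow_zero. Qed.

Lemma mxpowD d p q (A B : 'M[R]_(p, q)) :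
  mxpow d A -> mxpow d B -> mxpow d (A + B).
Proof. by move=> hA hB i j; rewrite mxE; apply: mpowD. Qed.

Lemma mxpowN d p q (A : 'M[R]_(p, q)) : mxpow d A -> mxpow d (- A).
Proof. by move=> hA i j; rewrite mxE; apply: mpowN. Qed.

Lemma mxpowB d p q (A B : 'M[R]_(p, q)) :
  mxpow d A -> mxpow d B -> mxpow d (A - B).
Proof. by move=> hA /mxpowN; apply: mxpowD. Qed.

Lemma mxpow_sum d p q (I : Type) (s : seq I) (P : pred I)
    (F : I -> 'M[R]_(p, q)) :
  (forall i, P i -> mxpow d (F i)) -> mxpow d (\sum_(i <- s | P i) F i).
Proof.
move=> h; apply: (big_ind (@mxpow d p q)) => //; first exact: mxpow_zero.
by move=> A B; apply: mxpowD.
Qed.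

Lemma mxpowM d e p q r (A : 'M[R]_(p, q)) (B : 'M[R]_(q, r)) :
  mxpow d A -> mxpow e B -> mxpow (d + e) (A *m B).
Proof.
by move=> hA hB i j; rewrite mxE; apply: mpow_sum => l _; apply: mpowM.
Qed.

Lemma mxpowMl d p q r (A : 'M[R]_(p, q)) (B : 'M[R]_(q, r)) :
  mxpow d B -> mxpow d (A *m B).
Proof. by move=> hB; rewrite -[d]add0n; apply: mxpowM. Qed.

Lemma mxpowMr d p q r (A : 'M[R]_(p, q)) (B : 'M[R]_(q, r)) :
  mxpow d A -> mxpow d (A *m B).
Proof. by move=> hA; rewrite -[d]addn0; apply: mxpowM. Qed.

Lemma mxpowZ d e p q x (A : 'M[R]_(p, q)) :
  mpow d x -> mxpow e A -> mxpow (d + e) (x *: A).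
Proof. by move=> hx hA i j; rewrite mxE; apply: mpowM. Qed.

Lemma mxpowW d e p q (A : 'M[R]_(p, q)) : (d <= e)%N -> mxpow e A -> mxpow d A.
Proof. by move=> de hA i j; apply: mpowW de _. Qed.

Lemma mxpow_residue p q (A : 'M[R]_(p, q)) : mxpow 1 (A - base_mx (res_mx A)).
Proof. by move=> i j; rewrite !mxE; apply: mpow_residue. Qed.

Lemma mxpow_residueE p q (A : 'M[R]_(p, q)) B :
  res_mx A = B -> mxpow 1 (A - base_mx B).
Proof. by move=> <-; apply: mxpow_residue. Qed.

Lemma mxpow_limit p q (u : nat -> 'M[R]_(p, q)) :
    (forall d, mxpow d (u d.+1 - u d)) ->
  exists A, forall d, mxpow d (A - u d).
Proof.
move=> hu.
have lim i j : exists x, forall d, mpow d (x - u d i j).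
  by apply: mpow_limit => d; move: (hu d i j); rewrite !mxE.
exists (\matrix_(i, j) projT1 (cid (lim i j))) => d i j.
by rewrite !mxE; case: cid.
Qed.

Lemma mxpow_separated p q (A : 'M[R]_(p, q)) : (forall d, mxpow d A) -> A = 0.
Proof.
by move=> hA; apply/matrixP => i j; rewrite mxE; apply: mpow_separated => d; apply: hA.
Qed.

Fact base_mx_is_linear p q :
  forall c, {morph @base_mx p q : A B / c *: A + B >-> c%:A *: A + B}.
Proof.
by move=> c A B; apply/matrixP => i j; rewrite !mxE scalerDl -scalerA mulr_algl.
Qed.

Lemma base_mxD p q : {morph @base_mx p q : A B / A + B}.
Proof. by move=> A B; rewrite -[A]scale1r base_mx_is_linear !scale1r. Qed.

Lemma base_mx0 p q : base_mx (0 : 'M[k]_(p, q)) = 0.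
Proof. by apply/matrixP => i j; rewrite !mxE scale0r. Qed.

Lemma base_mxZ p q c (A : 'M[k]_(p, q)) : base_mx (c *: A) = c%:A *: base_mx A.
Proof. by rewrite -[c *: A]addr0 base_mx_is_linear base_mx0 addr0. Qed.

Lemma base_mxN p q : {morph @base_mx p q : A / - A}.
Proof. by move=> A; apply/matrixP => i j; rewrite !mxE scaleNr. Qed.

Lemma base_mx_sum p q (I : Type) (s : seq I) (P : pred I) (F : I -> 'M[k]_(p, q)) :
  base_mx (\sum_(i <- s | P i) F i) = \sum_(i <- s | P i) base_mx (F i).
Proof. exact: (big_morph _ (@base_mxD p q) (base_mx0 p q)). Qed.

Lemma base_mxM p q r (A : 'M[k]_(p, q)) (B : 'M[k]_(q, r)) :
  base_mx (A *m B) = base_mx A *m base_mx B.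
Proof.
apply/matrixP => i j; rewrite !mxE scaler_suml; apply: eq_bigr => l _.
by rewrite !mxE mulr_algl scalerA.
Qed.

Lemma base_mx1 p : base_mx (1%:M : 'M[k]_p) = 1%:M.
Proof. by apply/matrixP => i j; rewrite !mxE scaler_nat; case: eqP. Qed.

Lemma res_mxM p q r (A : 'M[R]_(p, q)) (B : 'M[R]_(q, r)) :
  res_mx (A *m B) = res_mx A *m res_mx B.
Proof.
apply/matrixP => i j; rewrite !mxE res_sum; apply: eq_bigr => l _.
by rewrite !mxE resM.
Qed.

Lemma res_delta_mx p q (i : 'I_p) (j : 'I_q) :
  res_mx (delta_mx i j : 'M[R]_(p, q)) = delta_mx i j.
Proof.
by apply/matrixP => a b; rewrite !mxE; case: (_ && _); rewrite ?res1 ?raddf0.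
Qed.

Lemma res_base_mx p q (B : 'M[k]_(p, q)) : res_mx (base_mx B) = B.
Proof. by apply/matrixP => a b; rewrite !mxE resZ res1 mulr1. Qed.

(** The determinant has residue [1], so it is a unit of the local ring, and the
    adjugate matrix provides an inverse. *)
Lemma res_mx_unit p (A : 'M[R]_p) : res_mx A = 1%:M ->
  exists B : 'M[R]_p, A *m B = 1%:M /\ B *m A = 1%:M.
Proof.
move=> hA.
have detA : chat_res R (\det A) = 1.
  rewrite -[RHS](@det1 k p) -hA res_sum; apply: eq_bigr => s _; rewrite resM.
  congr (_ * _).
    have sgn (e : bool) : chat_res R ((-1) ^+ e) = (-1) ^+ e.
      by case: e; rewrite ?expr0 ?expr1 ?resN res1.
    exact: sgn.
  have -> : chat_res R (\prod_i A i (s i)) = \prod_i chat_res R (A i (s i)).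
    exact: rmorph_prod.
  by apply: eq_bigr => i _; rewrite mxE.
have [|y hy] := @chat_local k R (\det A); first by rewrite detA oner_eq0.
exists (y *: \adj A); rewrite -scalemxAr -scalemxAl mul_mx_adj mul_adj_mx.
by rewrite scale_scalar_mx mulrC hy.
Qed.

End LocalMatrices.

Arguments base_mx {k} R {p q} B.

(** Finitely many vectors have a subfamily which is a basis of their span
    modulo a subspace [J]. It is used with [J] a power of the maximal ideal, to
    reduce a system of linear equations with coefficients in [k] and unknowns
    in a power of the maximal ideal to systems over [k]. *)
Lemma basis_modulo (k : fieldType) (W : lmodType k) (J : W -> Prop)
    (I : finType) (x : I -> W) :
    J 0 -> (forall c u v, J u -> J v -> J (c *: u + v)) ->
  exists (B : {set I}) (C : I -> I -> k),
    (forall c : I -> k, J (\sum_(b in B) c b *: x b) ->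
       forall b, b \in B -> c b = 0) /\
    (forall i, J (x i - \sum_(b in B) C i b *: x b)).
Proof.
move=> J0 JL.
pose indep (B : {set I}) := `[< forall c : I -> k,
  J (\sum_(b in B) c b *: x b) -> forall b, b \in B -> c b = 0 >].
have indep0 : indep set0 by apply/asboolP => c _ b; rewrite inE.
case: (@arg_maxnP _ set0 indep (fun B => #|B|) indep0) => B /asboolP hB maxB.
have gen i : exists C : I -> k, J (x i - \sum_(b in B) C b *: x b).
  case: (boolP (i \in B)) => iB.
    exists (fun b => (b == i)%:R).
    rewrite (bigD1 i iB) /= eqxx scale1r big1 ?addr0 ?subrr // => b /andP[_ bi].
    by rewrite (negbTE bi) scale0r.
  have : ~~ indep (i |: B).
    by apply/negP => /maxB; rewrite /= cardsU1 iB add1n ltnn.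
  move/asboolPn => /existsNP[c] /not_implyP[hJ].
  move=> /existsNP[b0] /not_implyP[b0B cb0]; move: hJ; rewrite big_setU1 //= => hJ.
  have ci : c i != 0.
    apply/eqP => ci; case: cb0; move: b0B; rewrite in_setU1 => /orP[/eqP -> //|].
    by apply: hB; move: hJ; rewrite ci scale0r add0r.
  exists (fun b => - (c i)^-1 * c b).
  have := JL (c i)^-1 _ _ hJ J0; rewrite addr0 scalerDr scalerA mulVf // scale1r.
  congr (J (_ + _)); rewrite scaler_sumr -sumrN; apply: eq_bigr => b _.
  by rewrite scalerA mulNr scaleNr opprK.
have [C hC] := choice gen.
by exists B, C.
Qed.


(** * Power series *)

Section PowerSeries.
Variable k : fieldType.
Implicit Types f g h : powser k.

Lemma ps_coefD f g n : (f + g) n = f n + g n. Proof. by []. Qed.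
Lemma ps_coefN f n : (- f) n = - f n. Proof. by []. Qed.
Lemma ps_coef1 n : (1 : powser k) n = (n == 0%N)%:R. Proof. by []. Qed.
Lemma ps_coefZ c f n : (c *: f) n = c * f n. Proof. by []. Qed.
Lemma ps_coefM f g n : (f * g) n = \sum_(i < n.+1) f i * g (n - i)%N.
Proof. by []. Qed.

Lemma ps_coef_sum (I : Type) (s : seq I) (P : pred I) (F : I -> powser k) n :
  (\sum_(i <- s | P i) F i) n = \sum_(i <- s | P i) F i n.
Proof. exact: (big_morph (fun f : powser k => f n)). Qed.

Lemma ps_coefM0 f g : (f * g) 0%N = f 0%N * g 0%N.
Proof. by rewrite ps_coefM big_ord1. Qed.

Definition ps_t : powser k := fun n => (n == 1%N)%:R.

Lemma ps_coef_tM f n : (ps_t * f) n = if n is n'.+1 then f n' else 0.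
Proof.
case: n => [|n]; first by rewrite ps_coefM0 mul0r.
rewrite ps_coefM big_ord_recl mul0r add0r big_ord_recl /= mul1r subn1 big1.
  by rewrite addr0.
by move=> i _; rewrite mul0r.
Qed.

Lemma ps_coef_tXM i f n :
  (ps_t ^+ i * f) n = if (n < i)%N then 0 else f (n - i)%N.
Proof.
elim: i n => [|i IHi] n; first by rewrite expr0 mul1r subn0.
by rewrite exprS -mulrA ps_coef_tM; case: n => [|n]; rewrite ?IHi.
Qed.

Lemma ps_coef_tX i n : (ps_t ^+ i) n = (n == i)%:R.
Proof.
rewrite -[_ ^+ _]mulr1 ps_coef_tXM ps_coef1 subn_eq0 [n == i]eqn_leq.
by case: ltnP => [ni|]; rewrite ?andbT // [(n <= i)%N]ltnW.
Qed.

Lemma ps_divX i f : (forall n, (n < i)%N -> f n = 0) ->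
  f = ps_t ^+ i * (fun n => f (n + i)%N).
Proof.
move=> hf; apply/funext => n; rewrite ps_coef_tXM.
by case: ltnP => [/hf //|ni]; rewrite subnK.
Qed.

(** The inverse is given by the geometric series. *)
Lemma ps_unit f : f 0%N != 0 -> exists g, f * g = 1.
Proof.
move=> f0; pose u := 1 - (f 0%N)^-1 *: f.
have u0 n : (n < 1)%N -> u n = 0.
  by case: n => // _; rewrite /u ps_coefD ps_coefN ps_coefZ mulVf // subrr.
pose s n : powser k := \sum_(i < n.+1) u ^+ i.
pose g : powser k := fun n => s n n.
have uX i n : (n < i)%N -> (u ^+ i) n = 0.
  by rewrite (ps_divX u0) exprMn -exprM mul1n ps_coef_tXM => ->.
have s_stable m n : (n <= m)%N -> s m n = s n n.
  elim: m => [|m IHm]; first by rewrite leqn0 => /eqP ->.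
  rewrite leq_eqVlt => /orP[/eqP -> //|nm].
  by rewrite /s big_ord_recr /= ps_coefD uX // addr0 -/(s m) IHm.
exists ((f 0%N)^-1 *: g).
rewrite -scalerAr scalerAl.
have -> : (f 0%N)^-1 *: f = 1 - u by rewrite subKr.
apply/funext => n.
have -> : ((1 - u) * g) n = ((1 - u) * s n) n.
  rewrite !ps_coefM; apply: eq_bigr => i _; congr (_ * _).
  by rewrite /g [RHS]s_stable // leq_subr.
rewrite /s -opprB mulNr -subrX1 opprB ps_coefD ps_coefN (uX n.+1) //.
by rewrite subr0.
Qed.

(** A nonzero ideal is generated by [ps_t ^+ v] for the least order [v] of its
    elements, by [ps_unit]. *)
Lemma ps_noetherian : noetherian (powser k).
Proof.
move=> I [I0 ID IM].
case: (pselect (exists v f, I f /\ f v != 0)) => [exv|nov]; last first.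
  exists 0%N, (fun=> 0) => x; split=> [Ix|[c ->]]; last by rewrite big_ord0.
  exists (fun=> 0); rewrite big_ord0; apply/funext => v; apply/eqP.
  by apply/negPn/negP => xv; case: nov; exists v, x.
have exb : exists v, `[< exists f, I f /\ f v != 0 >].
  by case: exv => v hv; exists v; apply/asboolP.
case: (ex_minnP exb) => v /asboolP[f [If fv]] minv.
have ord g n : I g -> (n < v)%N -> g n = 0.
  move=> Ig nv; apply/eqP/negPn/negP => gn; move: nv; rewrite ltnNge => /negP.
  by case; apply: minv; apply/asboolP; exists g.
have Iv : I (ps_t ^+ v).
  have [|h hE] := @ps_unit (fun n => f (n + v)%N); first by rewrite add0n.
  have -> : ps_t ^+ v = h * f.
    rewrite [f](@ps_divX v) => [|n]; last exact: ord.
    by rewrite mulrCA [h * _]mulrC hE mulr1.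
  exact: IM.
exists 1%N, (fun=> ps_t ^+ v) => x; split=> [Ix|[c ->]].
  exists (fun _ n => x (n + v)%N); rewrite big_ord1 mulrC.
  by apply: ps_divX => n; apply: ord.
by rewrite big_ord1; apply: IM.
Qed.

Fact ps_res_is_linear : linear ((fun f => f 0%N) : powser k -> k^o).
Proof. by []. Qed.

Fact ps_res_is_multiplicative :
  monoid_morphism ((fun f => f 0%N) : powser k -> k^o).
Proof. by split=> // f g; rewrite ps_coefM0. Qed.

Definition ps_res (f : powser k) : k^o := f 0%N.

HB.instance Definition _ := GRing.isLinear.Build k (powser k) k^o *:%R ps_res
  ps_res_is_linear.
HB.instance Definition _ := GRing.isMonoidMorphism.Build (powser k) k^o ps_res
  ps_res_is_multiplicative.

Lemma ps_ideal_powP n f :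
  ideal_pow (fun g => ps_res g = 0) n f <-> forall i, (i < n)%N -> f i = 0.
Proof.
elim: n f => [|n IHn] f; first by split.
split=> [[s hs ->] i ni|hf]; last first.
  exists [:: (ps_t, fun i => f (i + 1)%N)].
    move=> p; rewrite inE => /eqP -> /=; split=> //; apply/IHn => i ni.
    by apply: hf; rewrite addn1.
  rewrite big_seq1 /= -[ps_t]expr1; apply: ps_divX => i i1.
  by apply: hf; apply: leq_trans i1 _.
rewrite ps_coef_sum big_seq big1 // => p /hs[h1 /IHn h2].
rewrite ps_coefM big1 // => -[[|j] ji] _ /=.
  by rewrite (h1 : p.1 0%N = 0) mul0r.
rewrite h2 ?mulr0 // -(ltn_add2l j.+1) subnKC // addSn ltnS.
by apply: leq_trans (leq_addl _ _); rewrite -ltnS.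
Qed.

Lemma ps_complete : adically_complete (fun g : powser k => ps_res g = 0).
Proof.
split=> [x hx|u hu].
  by apply/funext => n; have /ps_ideal_powP := hx n.+1; apply.
exists (fun n => u n.+1 n) => n; apply/ps_ideal_powP => i ni.
rewrite ps_coefD ps_coefN; apply/eqP; rewrite subr_eq0; apply/eqP.
elim: n ni => // n IHn; rewrite ltnS leq_eqVlt => /orP[/eqP -> //|ni].
have /ps_ideal_powP/(_ i ni) := hu n; rewrite ps_coefD ps_coefN => /eqP.
by rewrite subr_eq0 IHn // => /eqP.
Qed.

Lemma ps_local f : ps_res f != 0 -> exists g, f * g = 1.
Proof. exact: ps_unit. Qed.

Definition ps_chat : chat k := @Chat k (powser k) ps_res ps_local
  ps_noetherian ps_complete.

Lemma ps_mpowP n (f : ps_chat) : mpow n f <-> forall i, (i < n)%N -> f i = 0.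
Proof. exact: ps_ideal_powP. Qed.

Lemma mpow_ps_t : mpow 1 (ps_t : ps_chat).
Proof. by apply/ps_mpowP => -[]. Qed.

End PowerSeries.

(** * Local homomorphisms *)

Section LocalHomomorphisms.
Variables (k : fieldType) (R S : chat k).

Lemma mpow_lrmorphism (f : {lrmorphism R -> S}) :
    (forall x, chat_res S (f x) = chat_res R x) ->
  forall n x, mpow n x -> mpow n (f x).
Proof.
move=> f_res; elim=> // n IHn x [s hs ->]; rewrite rmorph_sum big_seq.
apply: mpow_sum => p /hs[h1 h2]; rewrite rmorphM -add1n.
by apply: mpowM; [apply/mpow1P; rewrite f_res | apply: IHn].
Qed.

(** Preserving residues implies continuity, since it makes the powers of the
    maximal ideal map into each other. *)
Lemma chat_hom_of_lrmorphism (f : {lrmorphism R -> S}) :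
    (forall x, chat_res S (f x) = chat_res R x) ->
  exists F : chat_hom R S, F =1 f.
Proof.
move=> f_res.
suff f_cont n : exists N, forall x, ideal_pow (@maxideal k R) N x ->
    ideal_pow (@maxideal k S) n (f x) by exists (ChatHom f_cont f_res).
by exists n; apply: mpow_lrmorphism.
Qed.

Lemma mpow_hom (f : chat_hom R S) n x : mpow n x -> mpow n (f x).
Proof. by apply: mpow_lrmorphism; apply: chat_fun_res. Qed.

Implicit Type f : chat_hom R S.

Lemma homD f x y : f (x + y) = f x + f y. Proof. exact: raddfD. Qed.
Lemma homN f x : f (- x) = - f x. Proof. exact: raddfN. Qed.
Lemma homB f x y : f (x - y) = f x - f y. Proof. exact: raddfB. Qed.
Lemma homM f x y : f (x * y) = f x * f y. Proof. exact: rmorphM. Qed.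
Lemma hom1 f : f 1 = 1. Proof. exact: rmorph1. Qed.
Lemma hom0 f : f 0 = 0. Proof. exact: raddf0. Qed.
Lemma homZ f (c : k) x : f (c *: x) = c *: f x. Proof. exact: linearZ. Qed.
Lemma homX f x n : f (x ^+ n) = f x ^+ n. Proof. exact: rmorphXn. Qed.
Lemma hom_sum f (I : Type) (s : seq I) (P : pred I) (F : I -> R) :
  f (\sum_(i <- s | P i) F i) = \sum_(i <- s | P i) f (F i).
Proof. exact: raddf_sum. Qed.

End LocalHomomorphisms.


(** * Substitution in power series *)

Section Substitution.
Variables (k : fieldType) (S : chat k).

Definition ps_partial (r : S) (f : powser k) (n : nat) : S :=
  \sum_(i < n) f i *: r ^+ i.

Lemma mpow_geometric (r : S) n i : mpow 1 r -> (n <= i)%N -> mpow n (r ^+ i).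
Proof. by move=> hr /mpowW; apply; apply: mpowX. Qed.

Lemma ps_partialE r f n :
  ps_partial r f n = horner_alg r (\poly_(i < n) f i).
Proof.
rewrite poly_def raddf_sum; apply: eq_bigr => i _.
by rewrite -[RHS]/(horner_alg r _) linearZ rmorphXn /= horner_algX mulr_algl.
Qed.

Lemma mpow_horner_alg (r : S) n (p : {poly k}) : mpow 1 r ->
  (forall i, (i < n)%N -> p`_i = 0) -> mpow n (horner_alg r p : S).
Proof.
move=> hr hp; rewrite -[p]coefK -(ps_partialE r (fun i => p`_i)).
apply: mpow_sum => i _.
case: (ltnP i n) => [/hp ->|ni]; first by rewrite scale0r; apply: mpow_zero.
exact/mpowZ/mpow_geometric.
Qed.

Variables (r : S) (hr : mpow 1 r).

Fact ps_subst_ex (f : powser k) :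
  exists x : S, forall n, mpow n (x - ps_partial r f n).
Proof.
apply: mpow_limit => n; rewrite /ps_partial big_ord_recr /= addrAC subrr add0r.
exact/mpowZ/mpow_geometric.
Qed.

Definition ps_subst (f : powser k) : S := projT1 (cid (ps_subst_ex f)).

Lemma ps_substP f n : mpow n (ps_subst f - ps_partial r f n).
Proof. by rewrite /ps_subst; case: cid. Qed.

Lemma ps_substE f (x : S) : (forall n, mpow n (x - ps_partial r f n)) ->
  x = ps_subst f.
Proof.
move=> hx; apply/eqP; rewrite -subr_eq0; apply/eqP/mpow_separated => n.
by rewrite -(subrKA (ps_partial r f n)); apply: mpowD => //;
  rewrite -opprB; apply/mpowN/ps_substP.
Qed.

Fact ps_subst_is_linear : linear ps_subst.
Proof.
move=> c f g; apply/esym/ps_substE => n.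
have -> : ps_partial r (c *: f + g) n =
    c *: ps_partial r f n + ps_partial r g n.
  rewrite /ps_partial scaler_sumr -big_split; apply: eq_bigr => i _ /=.
  by rewrite ps_coefD ps_coefZ scalerDl scalerA.
rewrite opprD addrACA -scalerBr.
by apply: mpowD; [apply: mpowZ|]; apply: ps_substP.
Qed.

Fact ps_subst_is_multiplicative : monoid_morphism ps_subst.
Proof.
split.
  apply/esym/ps_substE => -[|n]; first exact: mpow0.
  rewrite /ps_partial big_ord_recl expr0 scale1r big1 ?addr0 ?subrr.
    exact: mpow_zero.
  by move=> i _; rewrite scale0r.
move=> f g; apply/esym/ps_substE => n.
set a := ps_partial r f n; set b := ps_partial r g n.
have -> : ps_subst f * ps_subst g - ps_partial r (f * g) n =
    (ps_subst f - a) * ps_subst g + a * (ps_subst g - b)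
    + (a * b - ps_partial r (f * g) n).
  by rewrite mulrBl mulrBr !addrA subrK subrK.
apply: mpowD.
  by apply: mpowD; [apply: mpowMr | apply: mpowMl]; apply: ps_substP.
rewrite /a /b !ps_partialE -rmorphM -rmorphB.
apply: (mpow_horner_alg hr) => i ni; rewrite coefB coef_poly ni coefM ps_coefM.
apply/eqP; rewrite subr_eq0; apply/eqP/eq_bigr => j _.
rewrite !coef_poly (leq_ltn_trans _ ni) ?(leq_ltn_trans _ ni) ?leq_subr //.
by rewrite -ltnS.
Qed.

HB.instance Definition _ := GRing.isLinear.Build k (powser k) S *:%R ps_subst
  ps_subst_is_linear.
HB.instance Definition _ := GRing.isMonoidMorphism.Build (powser k) S ps_subst
  ps_subst_is_multiplicative.

Lemma ps_subst_t : ps_subst (@ps_t k) = r.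
Proof.
apply/esym/ps_substE => -[|[|n]]; first exact: mpow0.
  by rewrite /ps_partial big_ord1 scale0r subr0.
rewrite /ps_partial 2!big_ord_recl scale0r add0r scale1r expr1 big1 ?addr0.
  by rewrite subrr; apply: mpow_zero.
by move=> i _; rewrite scale0r.
Qed.

Lemma ps_subst_res f : chat_res S (ps_subst f) = chat_res (ps_chat k) f.
Proof.
have /mpow1P := ps_substP f 1; rewrite /ps_partial big_ord1 expr0 resB resZ res1.
by rewrite mulr1 => /eqP; rewrite subr_eq0 => /eqP.
Qed.

Lemma ps_subst_hom : exists psi : chat_hom (ps_chat k) S, psi (@ps_t k) = r.
Proof.
have [psi psiE] := @chat_hom_of_lrmorphism k (ps_chat k) S ps_subst ps_subst_res.
by exists psi; apply: etrans (psiE _) ps_subst_t.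
Qed.

End Substitution.

Section HomsFromPowerSeries.
Variables (k : fieldType) (S : chat k).
Implicit Types psi : chat_hom (ps_chat k) S.

Lemma mpow_hom_t psi : mpow 1 (psi (@ps_t k)).
Proof. exact/mpow_hom/mpow_ps_t. Qed.

Lemma ps_homP psi f n : mpow n (psi f - ps_partial (psi (@ps_t k)) f n).
Proof.
have -> : ps_partial (psi (@ps_t k)) f n =
    psi (\sum_(i < n) f i *: (ps_t k) ^+ i).
  by rewrite hom_sum; apply: eq_bigr => i _; rewrite homZ homX.
rewrite -homB; apply/mpow_hom/ps_mpowP => i ni.
rewrite ps_coefD ps_coefN ps_coef_sum (bigD1 (Ordinal ni)) //= ps_coefZ.
rewrite ps_coef_tX eqxx mulr1 big1 ?addr0 ?subrr // => j /negP ji.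
rewrite ps_coefZ ps_coef_tX; case: eqP => [ij|]; rewrite ?mulr0 //.
by case: ji; apply/eqP/val_inj.
Qed.

Lemma ps_hom_eq psi psi' : psi (@ps_t k) = psi' (@ps_t k) -> psi =1 psi'.
Proof.
move=> hr f; apply/eqP; rewrite -subr_eq0; apply/eqP/mpow_separated => n.
rewrite -(subrKA (ps_partial (psi (@ps_t k)) f n)); apply: mpowD.
  exact: ps_homP.
by rewrite -opprB hr; apply/mpowN/ps_homP.
Qed.

(** The effect of a small change of the parameter is given by the derivative
    at [0], because the higher terms gain a factor in the maximal ideal. *)
Lemma ps_hom_taylor psi psi' n f : (0 < n)%N ->
  mpow n (psi' (@ps_t k) - psi (@ps_t k)) ->
  mpow n.+1 (psi' f - psi f - f 1%N *: (psi' (@ps_t k) - psi (@ps_t k))).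
Proof.
set r := psi _; set r' := psi' _ => n0 hr.
have r1 : mpow 1 r := mpow_hom_t psi.
have r'1 : mpow 1 r' := mpow_hom_t psi'.
pose a := ps_partial r f n.+1; pose a' := ps_partial r' f n.+1.
have -> : psi' f - psi f - f 1%N *: (r' - r) =
    (psi' f - a') - (psi f - a) + (a' - a - f 1%N *: (r' - r)).
  rewrite addrA; congr (_ - _).
  have -> : psi' f - a' - (psi f - a) = psi' f - psi f - (a' - a).
    by rewrite !opprD !opprK addrACA.
  by rewrite subrK.
apply: mpowD; first by apply: mpowB; apply: ps_homP.
have -> : a' - a - f 1%N *: (r' - r) =
    \sum_(i < n.+1) f i *: (r' ^+ i - r ^+ i - (i == 1%N :> nat)%:R *: (r' - r)).
  have i1 : (1 < n.+1)%N by [].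
  rewrite (bigD1 (Ordinal i1)) //= scale1r !expr1 subrr scaler0 add0r.
  rewrite /a' /a /ps_partial -sumrB (bigD1 (Ordinal i1)) //= !expr1 -scalerBr.
  rewrite addrAC subrr add0r; apply: eq_bigr => i /negP ii; rewrite -scalerBr.
  case: eqP => [ei|]; last by rewrite scale0r subr0.
  by case: ii; apply/eqP/val_inj.
apply: mpow_sum => -[i /= _] _; apply: mpowZ.
case: i => [|[|i]]; rewrite ?expr0 ?expr1 ?scale0r ?scale1r ?subrr ?subr0.
- exact: mpow_zero.
- exact: mpow_zero.
rewrite subrXX -addn1; apply: mpowM => //; apply: mpow_sum => -[j /= ji] _.
case: (posnP j) => [->|j0]; last exact/mpowMl/(mpow_geometric r1).
by rewrite subn0; apply/mpowMr/mpow_geometric.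
Qed.

End HomsFromPowerSeries.

(** * Lifts in coordinates *)

Section Coordinates.
Variables (k : fieldType) (L : falgType k) (V : rmod L) (n : nat).
Variable v : n.-tuple V.
Hypothesis basis_v : basis_of fullv v.

Definition of_row (x : 'rV[k]_n) : V := \sum_i x 0 i *: v`_i.

Definition to_row (w : V) : 'rV[k]_n := \row_i coord v i w.

Lemma of_rowK : cancel of_row to_row.
Proof.
move=> x; apply/rowP => i; rewrite mxE /of_row.
by rewrite coord_sum_free // (basis_free basis_v).
Qed.

Lemma to_rowK : cancel to_row of_row.
Proof.
move=> w; rewrite [RHS](coord_basis basis_v (memvf w)); apply: eq_bigr => i _.
by rewrite mxE.
Qed.

Fact of_row_is_linear : linear of_row.
Proof.
move=> c x y; rewrite /of_row scaler_sumr -big_split; apply: eq_bigr => i _ /=.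
by rewrite !mxE scalerDl scalerA.
Qed.

HB.instance Definition _ := GRing.isLinear.Build k 'rV[k]_n V *:%R of_row
  of_row_is_linear.

Lemma to_row_is_linear : linear to_row.
Proof. by move=> c x y; apply/rowP => i; rewrite !mxE linearP. Qed.

HB.instance Definition _ := GRing.isLinear.Build k V 'rV[k]_n *:%R to_row
  to_row_is_linear.

Definition rep_mx (a : L) : 'M[k]_n :=
  \matrix_i to_row (ract V a (of_row (delta_mx 0 i))).

Lemma mul_rep_mx (a : L) (x : 'rV[k]_n) :
  x *m rep_mx a = to_row (ract V a (of_row x)).
Proof.
rewrite [in RHS](row_sum_delta x) (linear_sum of_row) mulmx_sum_row.
rewrite (linear_sum (ract V a)) (linear_sum to_row); apply: eq_bigr => i _.
by rewrite rowK (linearZ_LR of_row) (linearZ_LR (ract V a)) (linearZ_LR to_row).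
Qed.

Section OverR.
Variable R : chat k.

(** The coordinates [c] on [M] come from a basis of [M] lifting [v], and [rho]
    is the action in these coordinates. *)
Definition presents (M : mod_lift V R) (c : M -> 'rV[R]_n)
    (rho : L -> 'M[R]_n) : Prop :=
  [/\ linear c, bijective c,
      forall a x, c (lift_act M a x) = c x *m rho a
    & forall x, lift_phi x = of_row (res_mx (c x))].

Definition mx_lift (rho : L -> 'M[R]_n) : Prop :=
  [/\ forall s a b, rho (s *: a + b) = s%:A *: rho a + rho b,
      rho 1 = 1%:M,
      forall a b, rho (a * b) = rho a *m rho b
    & forall a, res_mx (rho a) = rep_mx a].

Fact res_mx_is_semilinear p q (r : R) (A B : 'M[R]_(p, q)) :
  res_mx (r *: A + B) = chat_res R r *: res_mx A + res_mx B.
Proof. by apply/matrixP => i j; rewrite !mxE resD resM. Qed.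

Lemma row_mx_eq (A B : 'M[R]_n) : (forall x : 'rV_n, x *m A = x *m B) -> A = B.
Proof.
by move=> h; apply/row_matrixP => i; rewrite !rowE h.
Qed.

Lemma presents_mx_lift (M : mod_lift V R) (c : M -> 'rV[R]_n) rho :
  presents c rho -> mx_lift rho.
Proof.
case=> c_lin [c' cK c'K] c_act c_phi.
have actE a x : x *m rho a = c (lift_act M a (c' x)) by rewrite c_act c'K.
split=> [s a b||a b|a].
- apply: row_mx_eq => x; rewrite mulmxDr -scalemxAr !actE lift_actP.
  by rewrite c_lin.
- by apply: row_mx_eq => x; rewrite mulmx1 actE lift_act1 c'K.
- by apply: row_mx_eq => x; rewrite mulmxA !actE lift_actM cK.
apply/row_matrixP => i; rewrite !rowE.
apply: (can_inj of_rowK); rewrite mul_rep_mx to_rowK.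
rewrite -(res_delta_mx R) -res_mxM actE -c_phi lift_phi_act c_phi c'K.
by rewrite res_delta_mx.
Qed.

(** Coordinates with respect to any basis of [M] reduce to coordinates on [V]
    by the universal property of the extension of scalars, so that a change of
    basis over [k] gives the coordinates lifting those of [v]. *)
Lemma lift_presentation (M : mod_lift V R) : exists c rho, @presents M c rho.
Proof.
have [N [e he]] := lift_free M.
have [c0 c0E] := choice he.
have c0_eq x (y : 'I_N -> R) : x = \sum_i y i *: e i -> c0 x = [ffun i => y i].
  case: (c0E x) => _ uniq xE; apply: uniq; rewrite xE.
  by apply: eq_bigr => i _; rewrite ffunE.
pose d x : 'rV[R]_N := \row_i c0 x i.
have dE x : x = \sum_i d x 0 i *: e i.
  by rewrite {1}(c0E x).1; apply: eq_bigr => i _; rewrite mxE.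
have d_eq x (y : 'rV[R]_N) : x = \sum_i y 0 i *: e i -> d x = y.
  by move/c0_eq => xE; apply/rowP => i; rewrite mxE xE ffunE.
have d_lin : linear d.
  move=> r x y; apply: d_eq; rewrite [in LHS](dE x) [in LHS](dE y).
  rewrite scaler_sumr -big_split; apply: eq_bigr => i _ /=.
  by rewrite !mxE scalerDl scalerA.
have de i : d (e i) = delta_mx 0 i.
  apply: d_eq; rewrite (bigD1 i) //= mxE !eqxx scale1r big1 ?addr0 // => j ji.
  by rewrite mxE (negbTE ji) andbF scale0r.
have [phi_lin phi_univ] := lift_phi_iso M.
have phi0 : lift_phi (0 : M) = 0.
  by have := phi_lin (-1) 0 0; rewrite scaler0 addr0 resN res1 scaleN1r addNr.
have phiD : {morph @lift_phi _ _ _ _ M : x y / x + y}.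
  by move=> x y; have := phi_lin 1 x y; rewrite res1 !scale1r.
have phi_sum (y : 'I_N -> R) :
    lift_phi (\sum_i y i *: e i) = \sum_i chat_res R (y i) *: lift_phi (e i).
  rewrite (big_morph _ phiD phi0); apply: eq_bigr => i _.
  by have := phi_lin (y i) (e i) 0; rewrite phi0 !addr0.
have [h [hE _]] := phi_univ 'rV[k]_N (fun x => res_mx (d x))
  (fun r x y => etrans (congr1 _ (d_lin r x y)) (res_mx_is_semilinear _ _ _)).
pose T : 'M[k]_(N, n) := \matrix_i to_row (lift_phi (e i)).
pose T' : 'M[k]_(n, N) := \matrix_i h (of_row (delta_mx 0 i)).
have mulT y : of_row (y *m T) = \sum_i y 0 i *: lift_phi (e i).
  rewrite mulmx_sum_row linear_sum; apply: eq_bigr => i _.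
  by rewrite rowK linearZ /= to_rowK.
have mulT' x : x *m T' = h (of_row x).
  rewrite {2}(row_sum_delta x) (linear_sum of_row) linear_sum mulmx_sum_row.
  by apply: eq_bigr => i _; rewrite rowK (linearZ_LR of_row) linearZ_LR.
have phiT x : lift_phi x = of_row (res_mx (d x) *m T).
  rewrite mulT {1}(dE x) phi_sum; apply: eq_bigr => i _.
  by rewrite [in RHS]mxE.
have T'T : T' *m T = 1%:M.
  apply/row_matrixP => i; rewrite !rowE mulmxA mulT' mulmx1.
  pose F w := of_row (h w *m T).
  have F_lin : linear F.
    by move=> c x y; rewrite /F linearP mulmxDl -scalemxAl linearP.
  pose Fl : {linear V -> V} := HB.pack F (GRing.isLinear.Build _ _ _ _ F F_lin).
  have [id' [_ uniq]] := phi_univ V (@lift_phi _ _ _ _ M) phi_lin.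
  apply: (can_inj of_rowK); rewrite -[LHS]/(Fl _).
  rewrite uniq => [|x]; last by rewrite /= /F hE -phiT.
  by rewrite -(uniq idfun).
have TT' : T *m T' = 1%:M.
  apply/row_matrixP => i; rewrite !rowE mulmxA mulmx1 -rowE rowK mulT' to_rowK.
  by rewrite hE de res_delta_mx.
pose c x := d x *m base_mx R T.
pose c' (y : 'rV[R]_n) : M := \sum_i (y *m base_mx R T') 0 i *: e i.
have c'K : cancel c' c.
  by move=> y; rewrite /c (d_eq _ _ (erefl _)) -mulmxA -base_mxM T'T base_mx1 mulmx1.
have cK : cancel c c'.
  move=> x; rewrite /c' /c -mulmxA -base_mxM TT' base_mx1 mulmx1; exact/esym/dE.
have c_lin : linear c.
  by move=> r x y; rewrite /c d_lin mulmxDl -scalemxAl.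
have c_sum (I : finType) (y : I -> R) (f : I -> M) :
    c (\sum_i y i *: f i) = \sum_i y i *: c (f i).
  pose Cl : {linear M -> 'rV[R]_n} :=
    HB.pack c (GRing.isLinear.Build _ _ _ _ c c_lin).
  rewrite -[c]/(Cl : _ -> _) linear_sum.
  by apply: eq_bigr => i _; rewrite linearZ_LR.
exists c, (fun a => \matrix_i c (lift_act M a (c' (delta_mx 0 i)))).
split=> // [|a x|x]; first by exists c'.
  have {1}-> : x = \sum_i c x 0 i *: c' (delta_mx 0 i).
    apply: (can_inj cK); rewrite c_sum {1}[c x]row_sum_delta.
    by apply: eq_bigr => i _; rewrite c'K.
  rewrite (linear_sum (lift_act M a)) mulmx_sum_row.
  under eq_bigr do rewrite linearZ_LR /=.
  by rewrite c_sum; apply: eq_bigr => i _; rewrite rowK.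
by rewrite phiT /c res_mxM res_base_mx.
Qed.

End OverR.
End Coordinates.

(** * Morphisms of deformations in coordinates *)

Section HomMatrices.
Variables (k : fieldType) (R S : chat k) (psi : chat_hom R S).

Definition hom_mx (p q : nat) (A : 'M[R]_(p, q)) : 'M[S]_(p, q) :=
  \matrix_(i, j) psi (A i j).

Lemma hom_mxM p q r (A : 'M[R]_(p, q)) (B : 'M[R]_(q, r)) :
  hom_mx (A *m B) = hom_mx A *m hom_mx B.
Proof.
apply/matrixP => i j; rewrite !mxE hom_sum; apply: eq_bigr => l _.
by rewrite homM !mxE.
Qed.

Lemma hom_mx_delta p q (i : 'I_p) (j : 'I_q) :
  hom_mx (delta_mx i j) = delta_mx i j.
Proof.
by apply/matrixP => a b; rewrite !mxE; case: (_ && _); rewrite ?hom1 ?hom0.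
Qed.

Lemma hom_mx_linear p q r (A B : 'M[R]_(p, q)) :
  hom_mx (r *: A + B) = psi r *: hom_mx A + hom_mx B.
Proof. by apply/matrixP => a b; rewrite !mxE homD homM. Qed.

Lemma hom_mx1 p : hom_mx (1%:M : 'M[R]_p) = 1%:M.
Proof. by apply/matrixP => a b; rewrite !mxE; case: eqP; rewrite ?hom1 ?hom0. Qed.

Lemma res_hom_mx p q (A : 'M[R]_(p, q)) : res_mx (hom_mx A) = res_mx A.
Proof. by apply/matrixP => a b; rewrite !mxE chat_fun_res. Qed.

End HomMatrices.

Section DeformationMaps.
Variables (k : fieldType) (L : falgType k) (V : rmod L) (R S : chat k).
Variables (psi : chat_hom R S) (M : mod_lift V R) (M' : mod_lift V S).

(** A base change followed by an isomorphism of lifts amounts to a single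
    semilinear map, and such maps compose without any choices. *)
Definition lift_map (j : M -> M') : Prop :=
  [/\ semilinear_along psi j,
      forall a x, j (lift_act M a x) = lift_act M' a (j x)
    & forall x, lift_phi (j x) = lift_phi x].

Lemma deformation_map_lift_map :
  deformation_map psi M M' -> exists j, lift_map j.
Proof.
case=> N [iota [[iota_lin _] iota_act iota_phi]] [f [_ f_act f_phi]].
exists (fun x => f (iota x)); split=> [r x y|a x|x].
- by rewrite iota_lin linearP.
- by rewrite iota_act f_act.
by rewrite f_phi iota_phi.
Qed.

Variables (n : nat) (v : n.-tuple V).
Hypothesis basis_v : basis_of fullv v.
Variables (c : M -> 'rV[R]_n) (rho : L -> 'M[R]_n).
Variables (c' : M' -> 'rV[S]_n) (rho' : L -> 'M[S]_n).
Hypotheses (c_pres : presents v c rho) (c'_pres : presents v c' rho').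

Definition intertwines (g : 'M[S]_n) : Prop :=
  res_mx g = 1%:M /\ forall a, hom_mx psi (rho a) *m g = g *m rho' a.

Lemma lift_map_mx j : lift_map j -> exists g, intertwines g.
Proof.
case: c_pres c'_pres => [c_lin [d cK dK] c_act c_phi].
case=> [c'_lin [d' c'K d'K] c'_act c'_phi] [j_lin j_act j_phi].
have d_lin : linear d.
  by move=> r x y; apply: (can_inj cK); rewrite c_lin !dK.
pose F y := c' (j (d y)).
have F_lin r x y : F (r *: x + y) = psi r *: F x + F y.
  by rewrite /F d_lin j_lin c'_lin.
have F0 : F 0 = 0.
  by have := F_lin (-1) 0 0; rewrite scaler0 addr0 homN hom1 scaleN1r addNr.
pose g := \matrix_i F (delta_mx 0 i).
have gE y : hom_mx psi y *m g = F y.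
  have FD : {morph F : x z / x + z}.
    by move=> x z; have := F_lin 1 x z; rewrite hom1 !scale1r.
  rewrite {2}(row_sum_delta y) (big_morph _ FD F0) mulmx_sum_row.
  apply: eq_bigr => i _; rewrite rowK mxE.
  by have := F_lin (y 0 i) (delta_mx 0 i) 0; rewrite F0 !addr0.
exists g; split.
  apply/row_matrixP => i; rewrite !rowE mulmx1.
  rewrite -(res_delta_mx S) -res_mxM -(hom_mx_delta psi) gE.
  apply: (can_inj (of_rowK basis_v)); rewrite -c'_phi j_phi c_phi dK.
  by rewrite res_hom_mx.
move=> a; apply/row_matrixP => i; rewrite !rowE !mulmxA.
rewrite -(hom_mx_delta psi) -hom_mxM !gE.
by rewrite /F -c'_act -j_act; congr (c' (j _)); apply: (can_inj cK);
  rewrite c_act !dK.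
Qed.

(** The lift [M'] itself is then an extension of scalars of [M], as [g] is
    invertible. *)
Lemma intertwiner_deformation_map g :
  intertwines g -> deformation_map psi M M'.
Proof.
case: c_pres c'_pres => [c_lin [d cK dK] c_act c_phi].
case=> [c'_lin [d' c'K d'K] c'_act c'_phi] [g_res g_act].
have [g' [gg' g'g]] := res_mx_unit g_res.
have d_lin : linear d.
  by move=> r x y; apply: (can_inj cK); rewrite c_lin !dK.
have d'_lin : linear d'.
  by move=> r x y; apply: (can_inj c'K); rewrite c'_lin !d'K.
pose D' : {linear 'rV[S]_n -> M'} :=
  HB.pack d' (GRing.isLinear.Build _ _ _ _ d' d'_lin).
pose D : {linear 'rV[R]_n -> M} :=
  HB.pack d (GRing.isLinear.Build _ _ _ _ d d_lin).
pose j x := D' (hom_mx psi (c x) *m g).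
exists M'; last by exists idfun; split=> //; exists id.
exists j; split; last 2 first.
- move=> a x; rewrite /j; apply: (can_inj c'K).
  by rewrite c'_act !d'K c_act hom_mxM -!mulmxA g_act.
- move=> x; rewrite /j c'_phi d'K c_phi.
  by rewrite res_mxM g_res mulmx1 res_hom_mx.
have j_lin : semilinear_along psi j.
  move=> r x y; rewrite /j c_lin hom_mx_linear mulmxDl -scalemxAl.
  by rewrite linearP.
split=> // P h h_lin.
have h0 : h 0 = 0.
  by have := h_lin (-1) 0 0; rewrite scaler0 addr0 homN hom1 scaleN1r addNr.
have hD : {morph h : x y / x + y}.
  by move=> x y; have := h_lin 1 x y; rewrite hom1 !scale1r.
pose H w := \sum_i (c' w *m g') 0 i *: h (d (delta_mx 0 i)).
have H_lin : linear H.
  move=> r x y; rewrite /H scaler_sumr -big_split; apply: eq_bigr => i _ /=.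
  by rewrite c'_lin mulmxDl -scalemxAl !mxE scalerDl scalerA.
pose Hl : {linear M' -> P} := HB.pack H (GRing.isLinear.Build _ _ _ _ H H_lin).
exists Hl; split=> [x|H' H'E w].
  rewrite /= /H d'K -mulmxA gg' mulmx1.
  have {2}-> : x = D (c x) by rewrite /= cK.
  rewrite {2}(row_sum_delta (c x)) linear_sum (big_morph _ hD h0).
  apply: eq_bigr => i _; rewrite linearZ_LR mxE.
  by have := h_lin (c x 0 i) (d (delta_mx 0 i)) 0; rewrite h0 !addr0.
rewrite /= /H -[w in LHS]c'K -{1}[c' w]mulmx1 -g'g mulmxA.
set y := c' w *m g'; rewrite -[d' _]/(D' _).
rewrite {1}(row_sum_delta y) mulmx_suml !linear_sum; apply: eq_bigr => i _.
by rewrite -scalemxAl !linearZ_LR -H'E /j dK hom_mx_delta.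
Qed.

End DeformationMaps.

(** * Symmetric algebras and projective modules *)

Section LinearFunctions.
Variables (k : fieldType).

Definition mk_linear (U V : lmodType k) (f : U -> V) (h : linear f) :
    {linear U -> V} := HB.pack f (GRing.isLinear.Build k U V *:%R f h).

Lemma exists_lfun (U V : vectType k) (f : U -> V) : linear f ->
  exists F : 'Hom(U, V), F =1 f.
Proof.
move=> h; exists (linfun (mk_linear h)) => x.
exact: (lfunE (mk_linear h)).
Qed.

Lemma sub_lfunE (U V : vectType k) (f g : 'Hom(U, V)) x :
  (f - g) x = f x - g x.
Proof. by rewrite add_lfunE opp_lfunE. Qed.

(** The coordinates with respect to a basis modulo [J] are linear forms that
    vanish on [J], and they vanish together only on [J]. *)
Lemma separating_form (W : vectType k) (J : W -> Prop) (x : W) :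
    J 0 -> (forall c u v, J u -> J v -> J (c *: u + v)) ->
    (forall F : {linear W -> k^o}, (forall w, J w -> F w = 0) -> F x = 0) ->
  J x.
Proof.
move=> J0 JL hx; pose e := vbasis (fullv : {vspace W}).
have JD u w : J u -> J w -> J (u + w).
  by move=> hu hw; rewrite -[u]scale1r; apply: JL.
have JZ c u : J u -> J (c *: u).
  by move=> hu; rewrite -[_ *: _]addr0; apply: JL.
have [B [C [indep gen]]] := @basis_modulo k W J _ (fun i : 'I_(\dim {:W}) => e`_i) J0 JL.
pose F b (w : W) : k^o := \sum_i coord e i w * C i b.
have F_lin b : linear (F b).
  move=> c u w; rewrite /F scaler_sumr -big_split; apply: eq_bigr => i _ /=.
  by rewrite linearP mulrDl -mulrA.
have FP w : J (w - \sum_(b in B) F b w *: e`_b).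
  have -> : \sum_(b in B) F b w *: e`_b =
      \sum_i coord e i w *: (\sum_(b in B) C i b *: e`_b).
    under [RHS]eq_bigr do rewrite scaler_sumr.
    rewrite exchange_big; apply: eq_bigr => b _ /=; rewrite scaler_suml.
    by apply: eq_bigr => i _; rewrite scalerA.
  rewrite {1}(coord_basis (vbasisP _) (memvf w)) -sumrB.
  by apply: (big_ind J) => // i _; rewrite -scalerBr; apply: JZ.
have Fx b : b \in B -> F b x = 0.
  move=> bB; apply: (hx (mk_linear (F_lin b))) => w Jw /=.
  apply: (indep (fun b => F b w)) => //.
  by have := JL (-1) _ _ (FP w) Jw; rewrite scaleN1r opprB subrK.
by have := FP x; rewrite big1 ?subr0 // => b /Fx ->; rewrite scale0r.
Qed.

End LinearFunctions.

Section RmodTheory.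
Variables (k : fieldType) (L : falgType k).

Lemma rhom_act (M N : rmod L) (f : rhom M N) a x :
  f (ract M a x) = ract N a (f x).
Proof. exact: (equivariantP _ (rhomP f)). Qed.

Lemma rhom_ext (M N : rmod L) (f g : rhom M N) : f =1 g -> f = g.
Proof. by move=> fg; apply/val_inj/lfunP. Qed.

Lemma exists_rhom (M N : rmod L) (f : M -> N) : linear f ->
    (forall a x, f (ract M a x) = ract N a (f x)) ->
  exists F : rhom M N, F =1 f.
Proof.
move=> /exists_lfun[F FE] f_act.
have F_act : F \in @equivariant k L M N.
  by apply/equivariantP => a x; rewrite !FE.
by exists (RHom F_act).
Qed.

Lemma rhom_sumE (M N : rmod L) (I : finType) (F : I -> rhom M N) x :
  (\sum_i F i) x = \sum_i F i x.
Proof.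
apply: (big_morph (fun f : rhom M N => f x)) => [f g|] /=.
  by rewrite add_lfunE.
by rewrite zero_lfunE.
Qed.

Lemma rhom_linE (M N : rmod L) c (f g : rhom M N) x :
  (c *: f + g) x = c *: f x + g x.
Proof. by rewrite /= add_lfunE scale_lfunE. Qed.

Lemma ract_linear (M : rmod L) (x : M) : linear (fun a => ract M a x).
Proof. by move=> c a b; rewrite linearP add_lfunE scale_lfunE. Qed.

Lemma ract_mul (M : rmod L) a b (x : M) :
  ract M (a * b) x = ract M b (ract M a x).
Proof. by rewrite ractM comp_lfunE. Qed.

Lemma ract_one (M : rmod L) (x : M) : ract M 1 x = x.
Proof. by rewrite ract1 id_lfunE. Qed.

Lemma ract_sum (M : rmod L) (I : Type) (r : seq I) (P : pred I) (F : I -> L)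
    (x : M) :
  ract M (\sum_(i <- r | P i) F i) x = \sum_(i <- r | P i) ract M (F i) x.
Proof. exact: (raddf_sum (mk_linear (ract_linear x))). Qed.

Lemma ract_scale (M : rmod L) c a (x : M) : ract M (c *: a) x = c *: ract M a x.
Proof. by rewrite linearZ scale_lfunE. Qed.

Lemma ract_regular (a y : L) : ract (regular_rmod L) a y = y * a.
Proof. by rewrite lfunE. Qed.

End RmodTheory.

(** Dual bases for a symmetrizing form [s]. *)
Definition dual_bases (k : fieldType) (L : falgType k) (N : nat)
    (a b : 'I_N -> L) (s : {linear L -> k^o}) : Prop :=
  [/\ forall y, y = \sum_i s (b i * y) *: a i,
      forall y, y = \sum_i s (y * a i) *: b i
    & forall x y, s (x * y) = s (y * x)].

Lemma symmetric_dual_bases (k : fieldType) (L : falgType k) :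
  symmetric_algebra L -> exists N (a b : 'I_N -> L) s, dual_bases a b s.
Proof.
case=> theta [theta' thetaK theta'K] hth.
pose s0 (y : L) : k^o := theta 1 y.
have s_lin : linear s0 by move=> c x y; rewrite /s0 linearP.
pose s : {linear L -> k^o} := mk_linear s_lin.
have thl a y : theta a y = s (y * a).
  by have := hth a 1 1 y; rewrite !mulr1 mul1r.
have thr a y : theta a y = s (a * y).
  by have := hth 1 1 a y; rewrite !mulr1 mul1r.
pose e := vbasis (fullv : {vspace L}).
have ex_b i : exists b : L, forall y, s (b * y) = coord e i y.
  have c_lin : linear (coord e i : L -> k^o) by move=> c x y; rewrite linearD linearZ.
  have [F FE] := exists_lfun c_lin.
  by exists (theta' F) => y; rewrite -thr theta'K FE.
have [b bE] := choice ex_b.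
have aE y : y = \sum_i s (b i * y) *: e`_i.
  rewrite [LHS](coord_basis (vbasisP _) (memvf y)).
  by apply: eq_bigr => i _; rewrite bE.
exists _, (fun i => e`_i), b, s; split=> // [y|x y]; last by rewrite -thl thr.
apply: (can_inj thetaK); apply/lfunP => z; rewrite !thr {1}(aE z).
rewrite mulr_sumr mulr_suml !linear_sum; apply: eq_bigr => i _.
by rewrite -scalerAr -scalerAl !linearZ_LR; apply: mulrC.
Qed.

Section Symmetric.
Variables (k : fieldType) (L : falgType k) (N : nat) (a b : 'I_N -> L).
Variables (s : {linear L -> k^o}) (hs : dual_bases a b s).

(** The expansions of [y * a i] in [a] and of [b j * y] in [b] have the same
    coefficients. The scalars act on [W] through [iota], so as to cover matrices
    over a [k]-algebra. *)
Lemma casimir (R : nzRingType) (iota : k -> R) (W : lmodType R)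
    (beta : L -> L -> W) :
    iota 1 = 1 ->
    (forall c x y z, beta (c *: x + y) z = iota c *: beta x z + beta y z) ->
    (forall c x y z, beta z (c *: x + y) = iota c *: beta z x + beta z y) ->
  forall y, \sum_i beta (y * a i) (b i) = \sum_i beta (a i) (b i * y).
Proof.
case: hs => aE bE _ i1 betal betar y.
have sum_semilin (f : L -> W) :
    (forall c x y, f (c *: x + y) = iota c *: f x + f y) ->
    forall (c : 'I_N -> k) (x : 'I_N -> L),
      f (\sum_i c i *: x i) = \sum_i iota (c i) *: f (x i).
  move=> f_lin c x.
  have fD : {morph f : u v / u + v}.
    by move=> u v; have := f_lin 1 u v; rewrite i1 !scale1r.
  have f0 : f 0 = 0.
    by apply: (addIr (f 0)); rewrite -fD !add0r.
  rewrite (big_morph _ fD f0); apply: eq_bigr => i _.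
  by have := f_lin (c i) (x i) 0; rewrite f0 !addr0.
transitivity (\sum_i \sum_j iota (s (b j * (y * a i))) *: beta (a j) (b i)).
  apply: eq_bigr => i _; rewrite {1}(aE (y * a i)).
  by rewrite (sum_semilin (beta^~ (b i))) // => c u v; apply: betal.
rewrite exchange_big; apply: eq_bigr => j _ /=.
rewrite {1}(bE (b j * y)) (sum_semilin (beta (a j))) //.
by apply: eq_bigr => i _; rewrite mulrA.
Qed.

Lemma dual_bases_one : 1 = \sum_i s (a i) *: b i.
Proof.
by case: hs => _ /(_ 1) bE _; rewrite {1}bE; apply: eq_bigr => i _; rewrite mul1r.
Qed.

(** By [casimir] the formula defines a module homomorphism. Its composite with
    [s] is [F], so linear forms on [M] and homomorphisms from [M] to the regular
    module correspond to each other. *)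
Lemma form_lift (M : rmod L) (F : {linear M -> k^o}) :
  exists t : rhom M (regular_rmod L),
    forall x, t x = \sum_i F (ract M (a i) x) *: b i.
Proof.
pose f x : L := \sum_i F (ract M (a i) x) *: b i.
have [||t tE] := @exists_rhom k L M (regular_rmod L) f; last by exists t.
  move=> c x y; rewrite /f scaler_sumr -big_split; apply: eq_bigr => i _ /=.
  by rewrite !linearP scalerDl scalerA.
move=> y x; rewrite ract_regular /f mulr_suml.
under eq_bigr do rewrite -ract_mul.
rewrite (@casimir _ idfun _ (fun u v => F (ract M u x) *: v)) //.
- by apply: eq_bigr => i _; rewrite scalerAl.
- move=> c u v z; rewrite ract_linear linearP scalerDl scalerA //.
by move=> c u v z; rewrite scalerDr !scalerA mulrC.
Qed.

Lemma rhom_regularE (M : rmod L) (t : rhom M (regular_rmod L)) x :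
  t x = \sum_i s (t (ract M (a i) x)) *: b i.
Proof.
case: hs => _ bE _; rewrite [LHS]bE; apply: eq_bigr => i _.
by rewrite rhom_act ract_regular.
Qed.

(** The regular module is injective: extend the linear form [s \o t]. *)
Lemma regular_extension (P1 P0 : rmod L) (p : rhom P1 P0)
    (t : rhom P1 (regular_rmod L)) :
    (forall x, p x = 0 -> t x = 0) ->
  exists g : rhom P0 (regular_rmod L), t = rcomp g p.
Proof.
move=> tp; pose F y : k^o := s (t ((p^-1)%VF y)).
have F_lin : linear F by move=> c x y; rewrite /F !linearP.
have [g gE] := form_lift (mk_linear F_lin).
exists g; apply: rhom_ext => x; rewrite comp_lfunE gE rhom_regularE.
apply: eq_bigr => i _; congr (s _ *: _); rewrite -rhom_act.
apply/eqP; rewrite -subr_eq0 -linearB; apply/eqP/tp.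
by rewrite linearB /= limg_lfunVK ?memv_img ?memvf // subrr.
Qed.

(** The module of linear maps from [L] to [P] is free, and [phi] maps to
    [\sum_i phi (a i) (b i)] under a surjection onto [P]; a section of the
    latter gives [gamma]. *)
Lemma higman (P : rmod L) : projective P ->
  exists gamma : 'End(P),
    forall x, x = \sum_i ract P (b i) (gamma (ract P (a i) x)).
Proof.
move=> projP; pose H := 'Hom(L, P).
have act_ex (y : L) : exists F : 'End(H), forall phi : H, F phi = (phi \o amull y)%VF.
  have h : linear (fun phi : H => (phi \o amull y)%VF : H).
    by move=> c f g; rewrite comp_lfunDl comp_lfunZl.
  by have [F FE] := exists_lfun h; exists F.
have [act actE] := choice act_ex.
have act_lin : linear act.
  move=> c y z; apply/lfunP => phi; apply/lfunP => x.
  rewrite add_lfunE scale_lfunE !actE add_lfunE scale_lfunE !comp_lfunE.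
  by rewrite !lfunE /= mulrDl -scalerAl linearP.
pose actL := mk_linear act_lin.
have act1 : actL 1 = \1%VF.
  apply/lfunP => phi; apply/lfunP => x; rewrite /= actE comp_lfunE id_lfunE.
  by rewrite lfunE /= mul1r.
have actM y z : actL (y * z) = (actL z \o actL y)%VF.
  apply/lfunP => phi; apply/lfunP => x; rewrite comp_lfunE /= !actE !comp_lfunE.
  by rewrite !lfunE /= mulrA.
pose HM : rmod L := @RMod k L H actL act1 actM.
have HE y (phi : HM) x : (ract HM y phi : H) x = (phi : H) (y * x).
  by rewrite /= actE comp_lfunE lfunE.
pose f (phi : HM) : P := \sum_i ract P (b i) ((phi : H) (a i)).
have [||g gE] := @exists_rhom k L HM P f.
- move=> c u v; rewrite /f scaler_sumr -big_split; apply: eq_bigr => i _ /=.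
  by rewrite add_lfunE scale_lfunE linearP.
- move=> y phi; rewrite /f linear_sum.
  under eq_bigr do rewrite HE.
  rewrite (@casimir _ idfun _ (fun u v => ract P v ((phi : H) u))) //.
  + by apply: eq_bigr => i _; rewrite ract_mul.
  + by move=> c u v z; rewrite linearP linearP.
  by move=> c u v z; rewrite ract_linear.
have gT : limg g = fullv.
  apply/eqP; rewrite eqEsubv subvf; apply/subvP => x _.
  have h : linear (fun y => s y *: x : P).
    by move=> c u v; rewrite linearP scalerDl scalerA.
  have [phi phiE] := exists_lfun h.
  apply/memv_imgP; exists (phi : HM); first exact: memvf.
  rewrite gE /f -[LHS]ract_one {1}dual_bases_one ract_sum.
  by apply: eq_bigr => i _; rewrite ract_scale phiE linearZ.
have [h hE] := projP HM P g (rid P) gT.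
have gam_lin : linear (fun x : P => (h x : H) 1).
  by move=> c x y; rewrite linearP add_lfunE scale_lfunE.
have [gamma gammaE] := exists_lfun gam_lin; exists gamma => x.
have {1}-> : x = g (h x).
  by rewrite -[g _]comp_lfunE -[(g \o h)%VF]/(rhom_lfun (rcomp g h)) hE id_lfunE.
rewrite gE; apply: eq_bigr => i _.
by rewrite gammaE rhom_act HE mulr1.
Qed.

End Symmetric.

(** * Self-extensions of a module fixed by the Auslander-Reiten translation *)

Section SelfExtensions.
Variables (k : fieldType) (L : falgType k) (N : nat) (a b : 'I_N -> L).
Variables (s : {linear L -> k^o}) (hs : dual_bases a b s).
Variable V : rmod L.

(** These describe self-extensions of [V]: the action of [y] on the sum of two
    copies of [V] has the off-diagonal part [d y]. *)
Definition derivation (d : L -> 'End(V)) : Prop :=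
  linear d /\
  forall x y v, d (x * y) v = d y (ract V x v) + ract V y (d x v).

Definition inner (d : L -> 'End(V)) : Prop :=
  exists X : 'End(V), forall y v, d y v = X (ract V y v) - ract V y (X v).

Variables (P1 P0 : rmod L) (p1 : rhom P1 P0) (p0 : rhom P0 V).
Hypotheses (projP1 : projective P1) (projP0 : projective P0).
Hypotheses (p0_onto : limg p0 = fullv) (p10_exact : limg p1 = lker p0).
Variable Phi : V -> {linear rhom P1 (regular_rmod L) -> k^o}.
Hypothesis Phi_lin : forall c w w' f, Phi (c *: w + w') f = c * Phi w f + Phi w' f.
Hypothesis Phi_act : forall y w f, Phi (ract V y w) f = Phi w (lscale y f).
Hypothesis Phi_p1 : forall w (g : rhom P0 (regular_rmod L)),
  Phi w (rcomp g p1) = 0.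
Hypothesis Phi_univ : forall xi : {linear rhom P1 (regular_rmod L) -> k^o},
  (forall g : rhom P0 (regular_rmod L), xi (rcomp g p1) = 0) ->
  exists! w : V, Phi w =1 xi.
Variable chi : {linear rhom V V -> k^o}.
Hypothesis chi1 : chi (rid V) = 1.
Hypothesis chi0 : forall f : rhom V V, chi f = 0 -> factors_through_projective f.

Lemma p0p1 x : p0 (p1 x) = 0.
Proof.
by apply/eqP; rewrite -memv_ker -p10_exact memv_img ?memvf.
Qed.

Lemma Phi_sum (I : finType) (w : I -> V) f :
  Phi (\sum_i w i) f = \sum_i Phi (w i) f.
Proof.
have PhiD : {morph Phi^~ f : u v / u + v}.
  by move=> u v; have := Phi_lin 1 u v f; rewrite scale1r mul1r.
have Phi0 : Phi 0 f = 0.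
  by apply: (addIr (Phi 0 f)); rewrite -PhiD !add0r.
exact: (big_morph _ PhiD Phi0).
Qed.

(** The coordinates of the map [gamma] of [higman] are linear forms on [P1],
    which [form_lift] turns into homomorphisms to the regular module. *)
Lemma projective_dual_basis : exists (l : nat) (x : 'I_l -> P1)
    (q : 'I_l -> rhom P1 (regular_rmod L)),
  forall z, z = \sum_i ract P1 (q i z) (x i).
Proof.
have [gamma gammaE] := higman hs projP1.
pose e := vbasis (fullv : {vspace P1}).
have c_lin i : linear (fun z => coord e i (gamma z) : k^o).
  by move=> c u v; rewrite !linearP.
have q_ex i := form_lift hs (mk_linear (c_lin i)).
have [q qE] := choice q_ex.
exists _, (fun i => e`_i), q => z; rewrite [LHS]gammaE.
under [RHS]eq_bigr do rewrite qE ract_sum.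
rewrite exchange_big; apply: eq_bigr => i _ /=.
rewrite {1}(coord_basis (vbasisP _) (memvf (gamma _))) linear_sum.
by apply: eq_bigr => j _; rewrite linearZ ract_scale.
Qed.

Lemma exists_act_rhom (M : rmod L) (w : V) (q : rhom M (regular_rmod L)) :
  exists f : rhom M V, forall z, f z = ract V (q z) w.
Proof.
apply: exists_rhom => [c u v|y z]; first by rewrite linearP ract_linear.
by rewrite rhom_act ract_regular ract_mul.
Qed.

Section DualBasis.
Variables (l : nat) (x : 'I_l -> P1) (q : 'I_l -> rhom P1 (regular_rmod L)).
Hypothesis xq : forall z, z = \sum_i ract P1 (q i z) (x i).

(** The trace pairing of [f] with the embedding of [V] into [P1] that
    corresponds to [Phi]. *)
Definition ext_form (f : P1 -> V) : k := \sum_i Phi (f (x i)) (q i).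

Lemma ext_form_linear c (f g : P1 -> V) :
  ext_form (fun z => c *: f z + g z) = c * ext_form f + ext_form g.
Proof.
rewrite /ext_form mulr_sumr -big_split.
by apply: eq_bigr => i _; rewrite Phi_lin.
Qed.

(** Homomorphisms factoring through a projective module are traces, so they
    pair to zero with the homomorphisms vanishing on the kernel of [p1]. *)
Lemma ext_form_stable (f : rhom P1 V) (u : rhom V V) :
    (forall z, p1 z = 0 -> f z = 0) -> factors_through_projective u ->
  ext_form (fun z => u (f z)) = 0.
Proof.
move=> fp1 [P [g [h [projP uE]]]].
have [gamma gammaE] := higman hs projP.
pose e := vbasis (fullv : {vspace V}).
have c_lin m : linear (fun w => coord e m (h (gamma (g w))) : k^o).
  by move=> c w w'; rewrite !linearP.
have [t tE] := choice (fun m => form_lift hs (mk_linear (c_lin m))).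
have uS w : u w = \sum_m ract V (t m w) e`_m.
  rewrite uE comp_lfunE {1}(gammaE (g w)) linear_sum.
  under [RHS]eq_bigr do rewrite tE ract_sum.
  rewrite [RHS]exchange_big; apply: eq_bigr => i _ /=.
  rewrite (rhom_act h) -(rhom_act g).
  rewrite {1}(coord_basis (vbasisP _) (memvf (h _))) linear_sum.
  by apply: eq_bigr => m _; rewrite linearZ ract_scale.
rewrite /ext_form; under eq_bigr do rewrite uS Phi_sum.
rewrite exchange_big big1 // => m _ /=.
under eq_bigr do rewrite Phi_act.
rewrite -linear_sum.
have -> : \sum_i lscale (t m (f (x i))) (q i) = rcomp (t m) f.
  apply: rhom_ext => z; rewrite comp_lfunE {2}(xq z) rhom_sumE !linear_sum.
  apply: eq_bigr => i _; rewrite comp_lfunE lfunE /= (rhom_act f) (rhom_act (t m)).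
  by rewrite ract_regular.
have [|g' ->] := @regular_extension k L N a b s hs P1 P0 p1 (rcomp (t m) f).
  by move=> z /fp1 fz; rewrite comp_lfunE fz linear0.
exact: Phi_p1.
Qed.

(** The pairing is perfect: a linear form on the homomorphisms from [P1] to [V]
    that vanishes on those factoring through [p1] is the pairing with an
    endomorphism of [V], by the universal property of [Phi]. Stably this
    endomorphism is a scalar, so by [ext_form_stable] the form vanishes at [f],
    and [separating_form] applies. *)
Lemma ext_form_factor (f : rhom P1 V) :
    (forall z, p1 z = 0 -> f z = 0) -> ext_form f = 0 ->
  exists g : rhom P0 V, f = rcomp g p1.
Proof.
move=> fp1 f0.
pose J (w : 'Hom(P1, V)) := exists g : rhom P0 V, w = rcomp g p1.
suff [g gE] : J f by exists g; apply: rhom_ext => z; rewrite gE.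
apply: separating_form => [|c u v [g ->] [g' ->]|F FJ].
- by exists 0; apply/lfunP => z; rewrite comp_lfunE !lfunE.
- exists (c *: g + g'); apply/lfunP => z.
  by rewrite !add_lfunE !scale_lfunE !comp_lfunE /= add_lfunE scale_lfunE.
have [A AE] := choice (fun wq => exists_act_rhom wq.1 (wq.2 : rhom P1 _)).
pose xi0 w q' : k^o := F (A (w, q') : 'Hom(P1, V)).
have xi_lin w : linear (xi0 w).
  move=> c q1 q2; rewrite /xi0 -linearP; congr (F _); apply/lfunP => z.
  rewrite add_lfunE scale_lfunE !AE /= add_lfunE scale_lfunE.
  by rewrite ract_linear.
pose xi w := mk_linear (xi_lin w).
have xi_p1 w (g : rhom P0 (regular_rmod L)) : xi w (rcomp g p1) = 0.
  apply: FJ; have [h hE] := exists_act_rhom w g; exists h.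
  by apply/lfunP => z; rewrite AE /= !comp_lfunE hE.
have [u uE] := choice (fun w => Phi_univ (xi_p1 w)).
have Phi_eq w (w' : V) : Phi w =1 xi w' -> u w' = w by case: (uE w') => _; apply.
have Phiu w : Phi (u w) =1 xi w by case: (uE w).
have u_lin : linear u.
  move=> c w w'; apply: Phi_eq => q'; rewrite Phi_lin !Phiu /= /xi0.
  have -> : c * F (A (w, q') : 'Hom(P1, V)) =
    c *: (F (A (w, q') : 'Hom(P1, V)) : k^o) by [].
  rewrite -linearP; congr (F _); apply/lfunP => z.
  by rewrite add_lfunE scale_lfunE !AE /= linearP.
have u_act y w : u (ract V y w) = ract V y (u w).
  apply: Phi_eq => q'; rewrite Phi_act Phiu /= /xi0; congr (F _).
  by apply/lfunP => z; rewrite !AE /= comp_lfunE lfunE /= ract_mul.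
have [U UE] := exists_rhom u_lin u_act.
have Ff : F (f : 'Hom(P1, V)) = ext_form (fun z => U (f z)).
  rewrite /ext_form.
  have fE : (f : 'Hom(P1, V)) = \sum_i (A (f (x i), q i) : 'Hom(P1, V)).
    apply/lfunP => z; rewrite sum_lfunE {1}(xq z) linear_sum.
    by apply: eq_bigr => i _; rewrite AE /=; apply: rhom_act.
  by rewrite {1}fE linear_sum; apply: eq_bigr => i _; rewrite UE Phiu.
pose r : k := - chi U.
pose U' : rhom V V := r *: rid V + U.
have U'0 : factors_through_projective U'.
  apply: chi0; rewrite linearD linearZ_LR chi1.
  by rewrite [_ *: 1]mulr1 addNr.
have := ext_form_stable fp1 U'0.
have -> : ext_form (fun z => U' (f z)) = r * ext_form f + ext_form (fun z => U (f z)).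
  rewrite -ext_form_linear; apply: eq_bigr => i _; congr (Phi _ _).
  by rewrite rhom_linE id_lfunE.
by rewrite f0 mulr0 add0r Ff.
Qed.

End DualBasis.

(** The map [p0] lifts along the projection from the extension of [V] by
    itself defined by [d]; its second component [h] is given explicitly in
    terms of [gamma], and its restriction along [p1] is the class of [d]. *)
Lemma derivation_lift : exists h : (L -> 'End(V)) -> P0 -> V,
  [/\ forall d, derivation d -> linear (h d),
      forall d y z, derivation d ->
        h d (ract P0 y z) = ract V y (h d z) + d y (p0 z)
    & forall c d d' z, h (fun y => c *: d y + d' y) z = c *: h d z + h d' z].
Proof.
have [gamma gammaE] := higman hs projP0.
exists (fun d z => \sum_i d (b i) (p0 (gamma (ract P0 (a i) z)))); split.
- move=> d [d_lin _] c u v; rewrite scaler_sumr -big_split.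
  by apply: eq_bigr => i _ /=; rewrite !linearP.
- move=> d y z [d_lin d_mul].
  under eq_bigr do rewrite -ract_mul.
  rewrite (casimir hs (iota := idfun)
    (beta := fun u v => d v (p0 (gamma (ract P0 u z))))) //; last first.
  + by move=> c u v w; rewrite d_lin add_lfunE scale_lfunE.
  + by move=> c u v w; rewrite ract_linear !linearP.
  rewrite linear_sum {3}(gammaE z) !linear_sum -big_split.
  apply: eq_bigr => i _ /=; rewrite d_mul addrC; congr (_ + _).
  by rewrite (rhom_act p0).
move=> c d d' z; rewrite scaler_sumr -big_split; apply: eq_bigr => i _ /=.
by rewrite add_lfunE scale_lfunE.
Qed.

(** Where the pairing vanishes, the restriction of [h d] along [p1] extends to a
    homomorphism on [P0]. Its difference from [h d] factors through [p0], and
    the resulting endomorphism of the space [V] makes [d] inner. One scalar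
    suffices to make the pairing vanish. *)
Lemma derivation_modulo_inner (d d0 : L -> 'End(V)) :
  derivation d -> derivation d0 -> ~ inner d0 ->
  exists c, inner (fun y => d y - c *: d0 y).
Proof.
move=> der_d der_d0 ninn.
have [l [x [q xq]]] := projective_dual_basis.
have [h [h_lin h_act h_comb]] := derivation_lift.
have key d' : derivation d' -> ext_form x q (fun z => h d' (p1 z)) = 0 -> inner d'.
  move=> der_d' ext0.
  have f_lin : linear (fun z => h d' (p1 z)).
    by move=> c u v; rewrite linearP h_lin.
  have [|f fE] := @exists_rhom k L P1 V (fun z => h d' (p1 z)) f_lin.
    by move=> y z; rewrite (rhom_act p1) h_act // p0p1 linear0 addr0.
  have [||g gE] := ext_form_factor xq (f := f).
  - by move=> z p1z; rewrite fE p1z; have := h_lin d' der_d' (-1) 0 0;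
      rewrite scaler0 addr0 scaleN1r addNr.
  - by rewrite -ext0; apply: eq_bigr => i _; rewrite fE.
  have [H HE] := exists_lfun (h_lin d' der_d').
  exists ((H - g)%R \o p0^-1)%VF => y v.
  have Kp1 t : (H - g) (p1 t) = 0.
    rewrite sub_lfunE HE -fE gE /= comp_lfunE subrr //.
  have Kp0 z : (H - g) ((p0^-1)%VF (p0 z)) = h d' z - g z.
    rewrite -HE -sub_lfunE; apply/eqP; rewrite -subr_eq0 -linearB.
    have /memv_imgP[t _ ->] : (p0^-1)%VF (p0 z) - z \in limg p1.
      by rewrite p10_exact memv_ker linearB /= limg_lfunVK ?memv_img ?memvf ?subrr.
    exact/eqP/Kp1.
  have [z ->] : exists z, v = p0 z.
    by have /memv_imgP[z _ ->] : v \in limg p0; [rewrite p0_onto memvf | exists z].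
  rewrite !comp_lfunE -(rhom_act p0) !Kp0 h_act // (rhom_act g) linearB /=.
  by rewrite opprB addrA subrK addrAC subrr add0r.
pose c := ext_form x q (fun z => h d (p1 z)) / ext_form x q (fun z => h d0 (p1 z)).
have d0n0 : ext_form x q (fun z => h d0 (p1 z)) != 0.
  by apply/eqP => /(key _ der_d0).
have [[d_lin d_mul] [d0_lin d0_mul]] := (der_d, der_d0).
have dE y : d y - c *: d0 y = - c *: d0 y + d y by rewrite scaleNr addrC.
exists c; apply: key.
  split=> [e y z|y z v]; first by rewrite d_lin d0_lin scalerDr opprD addrACA
    scalerA mulrC -scalerA scalerBr.
  rewrite !sub_lfunE !scale_lfunE d_mul d0_mul scalerDr opprD addrACA.
  by rewrite (linearB (ract V z)) (linearZ_LR (ract V z)).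
have -> : (fun y => d y - c *: d0 y) = (fun y => - c *: d0 y + d y).
  exact/funext.
transitivity (ext_form x q (fun z => - c *: h d0 (p1 z) + h d (p1 z))).
  by apply: eq_bigr => i _; rewrite h_comb.
by rewrite ext_form_linear mulNr /c mulfVK // addNr.
Qed.

End SelfExtensions.

(** * First-order deformations in coordinates *)

Section MatrixForm.
Variables (k : fieldType) (L : falgType k) (N : nat) (a b : 'I_N -> L).
Variables (s : {linear L -> k^o}) (hs : dual_bases a b s).
Variables (V W : rmod L) (n : nat) (v : n.-tuple V).
Hypothesis basis_v : basis_of fullv v.
Hypotheses (iso_VW : riso V W) (ar_W : is_AR_translate W W).
Hypothesis stable_V : stable_End_iso_k V.

Local Notation D0 := (rep_mx v).

Definition derivation_mx (D : L -> 'M[k]_n) : Prop :=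
  (forall c x y, D (c *: x + y) = c *: D x + D y) /\
  forall x y, D (x * y) = D x *m D0 y + D0 x *m D y.

Definition inner_mx (D : L -> 'M[k]_n) : Prop :=
  exists X, forall y, D y = D0 y *m X - X *m D0 y.

Lemma exists_mx_of_linear (f : V -> V) : linear f ->
  exists X : 'M[k]_n, forall w, to_row v (f w) = to_row v w *m X.
Proof.
move=> f_lin; exists (\matrix_i to_row v (f (of_row v (delta_mx 0 i)))) => w.
rewrite mulmx_sum_row -{1}(to_rowK basis_v w) {1}(row_sum_delta (to_row v w)).
pose F := mk_linear f_lin.
rewrite -[f _]/(F _) (linear_sum (of_row v)) (linear_sum F).
rewrite (linear_sum (to_row v)); apply: eq_bigr => i _.
by rewrite rowK (linearZ_LR (of_row v)) (linearZ_LR F) (linearZ_LR (to_row v)).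
Qed.

Lemma exists_End_mx (X : 'M[k]_n) :
  exists F : 'End(V), forall w, F w = of_row v (to_row v w *m X).
Proof.
apply: exists_lfun => c x y.
by rewrite linearP mulmxDl -scalemxAl linearP.
Qed.

Lemma to_row_ract y w : to_row v (ract V y w) = to_row v w *m D0 y.
Proof. by rewrite mul_rep_mx to_rowK. Qed.

Lemma to_row_mx_eq (A B : 'M[k]_n) :
  (forall w, to_row v w *m A = to_row v w *m B) -> A = B.
Proof.
move=> h; apply/row_matrixP => i; rewrite !rowE.
by have := h (of_row v (delta_mx 0 i)); rewrite of_rowK.
Qed.

Lemma derivation_mx_modulo_inner D E :
    derivation_mx D -> derivation_mx E -> ~ inner_mx E ->
  exists c, inner_mx (fun y => D y - c *: E y).
Proof.
case: iso_VW => f [g fK gK].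
have g_lin : linear g.
  by move=> c x y; apply: (can_inj fK); rewrite gK linearP /= !gK.
have [|G GE] := exists_rhom g_lin.
  by move=> y x; apply: (can_inj fK); rewrite (rhom_act f) !gK.
case: ar_W => P1 [P0 [p1 [p0 [[[projP1 projP0] p0_onto p10 _ _]]]]].
case=> Phi [Phi_lin Phi_act Phi_p1 Phi_univ].
case: stable_V => chi [chi1 _ chi0].
have q0_onto : limg (rcomp G p0) = fullv.
  apply/eqP; rewrite eqEsubv subvf; apply/subvP => w _.
  have /memv_imgP[z _ zE] : f w \in limg p0 by rewrite p0_onto memvf.
  apply/memv_imgP; exists z; first exact: memvf.
  by rewrite comp_lfunE -zE GE fK.
have q0_ker : limg p1 = lker (rcomp G p0).
  rewrite p10; apply/vspaceP => z; rewrite !memv_ker comp_lfunE GE.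
  by apply/eqP/eqP => [->|/(congr1 f)]; rewrite ?gK -?GE linear0.
have key := derivation_modulo_inner hs projP1 projP0 q0_onto q0_ker
  (Phi := fun w => Phi (f w)).
have toEnd E' : derivation_mx E' -> exists2 d : L -> 'End(V), derivation d &
    forall y w, d y w = of_row v (to_row v w *m E' y).
  case=> E_lin E_mul; have [d dE] := choice (fun y => exists_End_mx (E' y)).
  exists d => //; split=> [c x y|x y w].
    apply/lfunP => w; rewrite add_lfunE scale_lfunE !dE E_lin mulmxDr.
    by rewrite -scalemxAr linearP.
  rewrite !dE E_mul mulmxDr linearD /= addrC !mulmxA -to_row_ract; congr (_ + _).
  by rewrite mul_rep_mx to_rowK.
move=> der_D der_E ninn.
have [d der_d dE] := toEnd _ der_D; have [e der_e eE] := toEnd _ der_E.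
have toMx (X : 'End(V)) : exists A : 'M[k]_n,
    forall w, to_row v (X w) = to_row v w *m A.
  by apply: exists_mx_of_linear => c x y; rewrite linearP.
have inn (h : L -> 'End(V)) H : (forall y w, h y w = of_row v (to_row v w *m H y)) ->
    inner h -> inner_mx H.
  move=> hH [X XE]; have [A AE] := toMx X; exists A => y.
  apply: to_row_mx_eq => w; rewrite mulmxBr !mulmxA -to_row_ract -!AE.
  by rewrite -to_row_ract -linearB /= -XE hH of_rowK.
have ninn_e : ~ inner e by apply: contra_not ninn; apply: inn.
have [||||c hc] := key _ _ _ _ chi chi1 (fun h => (chi0 h).1) d e der_d der_e ninn_e.
- by move=> c w w' h; rewrite linearP Phi_lin.
- by move=> y w h; rewrite (rhom_act f) Phi_act.
- by move=> w h; apply: Phi_p1.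
- move=> xi /Phi_univ[w [wE uw]]; exists (g w); split; first by rewrite gK.
  by move=> w' /uw ->; rewrite fK.
exists c; apply: inn hc => y w.
rewrite sub_lfunE scale_lfunE dE eE mulmxBr -scalemxAr.
by rewrite (linearB (of_row v)) (linearZ_LR (of_row v)).
Qed.

(** Subtracting the stable class leaves an endomorphism that factors through a
    projective module, to which [higman] applies. *)
Lemma endomorphism_scalar_plus_trace (X : 'M[k]_n) :
    (forall y, D0 y *m X = X *m D0 y) ->
  exists c (G : 'M[k]_n), X = c%:M + \sum_i D0 (a i) *m G *m D0 (b i).
Proof.
case: stable_V => chi [chi1 _ chi0] hX.
have [F FE] := exists_End_mx X.
have [||f fE] := @exists_rhom k L V V F.
- by move=> c x y; rewrite linearP.
- move=> y w; rewrite !FE to_row_ract -mulmxA hX mulmxA mul_rep_mx to_rowK //.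
pose r : k := - chi f.
have : chi (r *: rid V + f) = 0.
  by rewrite linearD linearZ_LR chi1 [_ *: 1]mulr1 addNr.
move=> /chi0[P [g [h [projP hE]]]].
have [gamma gammaE] := higman hs projP.
have [|G GE] := @exists_mx_of_linear (fun w => h (gamma (g w))).
  by move=> c x y; rewrite !linearP.
exists (chi f), G; apply: to_row_mx_eq => w.
have -> : to_row v w *m X = to_row v (f w) by rewrite fE FE of_rowK.
have -> : f w = chi f *: w + rcomp h g w.
  by rewrite -hE rhom_linE id_lfunE addrA -scalerDl subrr scale0r add0r.
rewrite linearP mulmxDr mul_mx_scalar comp_lfunE {1}(gammaE (g w)).
congr (_ + _); rewrite mulmx_sumr (linear_sum h) (linear_sum (to_row v)).
apply: eq_bigr => i _; rewrite /= (rhom_act h) to_row_ract -(rhom_act g) GE.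
by rewrite to_row_ract !mulmxA.
Qed.

End MatrixForm.

(** * Approximation modulo powers of the maximal ideal *)

Section Expansion.
Variables (k : fieldType) (S : chat k).

Lemma mxpow_scale_base_mx (d p q : nat) x (A : 'M[k]_(p, q)) :
  mpow d x -> mxpow d (x *: base_mx S A).
Proof. by move=> hx i j; rewrite mxE; apply: mpowMr. Qed.

(** This is [basis_modulo] for the entries of the matrices. Its first clause
    turns an equation between matrices over [S] modulo a power of the maximal
    ideal into equations between their coefficient matrices over [k]. *)
Lemma mxpow_expansion (d e p q : nat) (I : finType) (F : I -> 'M[S]_(p, q)) :
    (forall i, mxpow d (F i)) ->
  exists (T : finType) (B : {set T}) (x : T -> S) (C : T -> I -> 'M[k]_(p, q)),
    [/\ forall A : T -> 'M[k]_(p, q),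
          mxpow e (\sum_(t in B) x t *: base_mx S (A t)) ->
          forall t, t \in B -> A t = 0,
        forall i, mxpow e (F i - \sum_(t in B) x t *: base_mx S (C t i))
      & forall t, mpow d (x t)].
Proof.
move=> hF.
have J0 : @mpow k S e 0 by apply: mpow_zero.
have JL c (u v : S) : mpow e u -> mpow e v -> mpow e (c *: u + v).
  by move=> hu hv; apply: mpowD => //; apply: mpowZ.
have [B [C [indep gen]]] := @basis_modulo k S (@mpow k S e)
  (I * ('I_p * 'I_q))%type (fun t => F t.1 t.2.1 t.2.2) J0 JL.
pose x t := F t.1 t.2.1 t.2.2 : S.
have entry (A : _ -> 'M[k]_(p, q)) i j :
    (\sum_(t in B) x t *: base_mx S (A t)) i j = \sum_(t in B) A t i j *: x t.
  by rewrite summxE; apply: eq_bigr => t _; rewrite !mxE mulr_algr.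
exists (I * ('I_p * 'I_q))%type, B, x.
exists (fun t i => \matrix_(u, w) C (i, (u, w)) t); split=> [A hA t tB|i u w|t].
- apply/matrixP => i j; rewrite mxE; apply: (indep (fun t => A t i j)) tB.
  by rewrite -entry; apply: hA.
- rewrite !mxE entry; have := gen (i, (u, w)).
  by congr (mpow _ (_ - _)); apply: eq_bigr => t _; rewrite mxE.
exact: hF.
Qed.

End Expansion.

Section Deformation.
Variables (k : fieldType) (L : falgType k) (N : nat) (a b : 'I_N -> L).
Variables (s : {linear L -> k^o}) (hs : dual_bases a b s).
Variables (V : rmod L) (n : nat) (v : n.-tuple V).
Variable rho : L -> 'M[powser k]_n.
Hypothesis rho_lift : @mx_lift k L V n v (ps_chat k) rho.

Local Notation D0 := (rep_mx v).

Definition tangent (y : L) : 'M[k]_n := \matrix_(i, j) (rho y i j) 1%N.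

Hypothesis tangent_not_inner : ~ inner_mx v tangent.
Hypothesis derivation_tangent : forall D, derivation_mx v D ->
  exists c, inner_mx v (fun y => D y - c *: tangent y).
Hypothesis endomorphism_trace : forall X : 'M[k]_n,
  (forall y, D0 y *m X = X *m D0 y) ->
  exists c (G : 'M[k]_n), X = c%:M + \sum_i D0 (a i) *m G *m D0 (b i).

Variable S : chat k.
Local Notation D0S y := (base_mx S (D0 y)).
Local Notation d0S y := (base_mx S (tangent y)).

(** The next three lemmas solve linear equations for unknowns in a power of the
    maximal ideal, modulo the next one. The coefficients obtained from
    [mxpow_expansion] satisfy the corresponding equations over [k]. *)
Lemma derivation_transfer j (E : L -> 'M[S]_n) :
    (forall c x y, E (c *: x + y) = c%:A *: E x + E y) ->
    (forall y, mxpow j (E y)) ->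
    (forall x y, mxpow j.+1 (E (x * y) - (E x *m D0S y + D0S x *m E y))) ->
  exists c Y, [/\ mpow j c, mxpow j Y & forall y,
    mxpow j.+1 (E y - (c *: d0S y + (D0S y *m Y - Y *m D0S y)))].
Proof.
move=> E_lin Ej E_der; pose e := vbasis (fullv : {vspace L}).
have [T [B [x [C [indep expE xj]]]]] :=
  @mxpow_expansion k S j j.+1 n n _ (fun l : 'I_(\dim {: L}) => E e`_l)
    (fun l => Ej _).
pose D t y := \sum_l coord e l y *: C t l.
have D_lin t c y z : D t (c *: y + z) = c *: D t y + D t z.
  rewrite /D scaler_sumr -big_split; apply: eq_bigr => l _ /=.
  by rewrite linearP scalerDl scalerA.
have ED y : mxpow j.+1 (E y - \sum_(t in B) x t *: base_mx S (D t y)).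
  have -> : E y = \sum_l (coord e l y)%:A *: E e`_l.
    rewrite {1}(coord_basis (vbasisP _) (memvf y)) -/e.
    have ED : {morph E : y z / y + z}.
      by move=> u w; have := E_lin 1 u w; rewrite !scale1r.
    have E0 : E 0 = 0 by apply: (addIr (E 0)); rewrite -ED !add0r.
    rewrite (big_morph _ ED E0); apply: eq_bigr => l _.
    by have := E_lin (coord e l y) e`_l 0; rewrite E0 !addr0.
  have -> : \sum_(t in B) x t *: base_mx S (D t y) =
      \sum_l (coord e l y)%:A *: (\sum_(t in B) x t *: base_mx S (C t l)).
    under [RHS]eq_bigr do rewrite scaler_sumr.
    rewrite exchange_big; apply: eq_bigr => t _ /=.
    rewrite base_mx_sum scaler_sumr; apply: eq_bigr => l _.
    by rewrite base_mxZ !scalerA mulrC.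
  rewrite -sumrB; apply: mxpow_sum => l _; rewrite -scalerBr -[j.+1]add0n.
  by apply: mxpowZ => //; apply: mpow0.
have der_D t : t \in B -> derivation_mx v (D t).
  move=> tB; split=> // y z; apply/eqP; rewrite -subr_eq0; apply/eqP.
  apply: (indep (fun t => D t (y * z) - (D t y *m D0 z + D0 y *m D t z))) tB.
  have -> : \sum_(t in B) x t *: base_mx S (D t (y * z)
        - (D t y *m D0 z + D0 y *m D t z)) =
      \sum_(t in B) x t *: base_mx S (D t (y * z))
      - ((\sum_(t in B) x t *: base_mx S (D t y)) *m D0S z
         + D0S y *m (\sum_(t in B) x t *: base_mx S (D t z))).
    rewrite mulmx_suml mulmx_sumr -big_split -sumrB; apply: eq_bigr => u _ /=.
    by rewrite base_mxD base_mxN base_mxD !base_mxM scalerBr scalerDr -scalemxAl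
      -scalemxAr.
  set P := \sum_(t in B) x t *: base_mx S (D t (y * z)).
  set P1 := \sum_(t in B) x t *: base_mx S (D t y).
  set P2 := \sum_(t in B) x t *: base_mx S (D t z).
  have -> : P - (P1 *m D0S z + D0S y *m P2) =
      E (y * z) - (E y *m D0S z + D0S y *m E z) - (E (y * z) - P)
      + (E y - P1) *m D0S z + D0S y *m (E z - P2).
    rewrite mulmxBl mulmxBr.
    move: (P1 *m _) (D0S y *m P2) (E y *m _) (D0S y *m _) => A1 A2 A3 A4.
    by apply/matrixP => i l; rewrite !mxE; ring.
  by apply: mxpowD; [apply: mxpowD; [apply: mxpowB|apply: mxpowMr]
    | apply: mxpowMl].
have cX_ex t : exists cX : k * 'M[k]_n, t \in B -> forall y,
    D t y = cX.1 *: tangent y + (D0 y *m cX.2 - cX.2 *m D0 y).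
  case: (boolP (t \in B)) => tB; last by exists (0, 0).
  have [c [X hX]] := derivation_tangent (der_D t tB).
  by exists (c, X) => _ y /=; rewrite -hX addrC subrK.
have [cX hcX] := choice cX_ex.
exists (\sum_(t in B) (cX t).1 *: x t), (\sum_(t in B) x t *: base_mx S (cX t).2).
split=> [||y].
- by apply: mpow_sum => t _; apply: mpowZ.
- by apply: mxpow_sum => t _; apply: mxpow_scale_base_mx.
have := ED y; congr (mxpow _ (_ - _)).
rewrite mulmx_sumr mulmx_suml scaler_suml -sumrB -big_split.
apply: eq_bigr => t tB; rewrite hcX // base_mxD base_mxZ base_mxD base_mxN !base_mxM /=.
rewrite scalerDr scalerBr -scalemxAr -scalemxAl scalerA; congr (_ *: _ + _).
by rewrite mulr_algr.
Qed.

Lemma commutant_transfer j (X : 'M[S]_n) : mxpow j X ->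
    (forall y, mxpow j.+1 (D0S y *m X - X *m D0S y)) ->
  exists c G, [/\ mpow j c, mxpow j G
    & mxpow j.+1 (X - (c%:M + \sum_i D0S (a i) *m G *m D0S (b i)))].
Proof.
move=> Xj X_comm.
have [T [B [x [C [indep expX xj]]]]] :=
  @mxpow_expansion k S j j.+1 n n unit (fun=> X) (fun=> Xj).
have {expX} := expX tt; set P := \sum_(t in B) _ => expX.
have comm_C t : t \in B -> forall y, D0 y *m C t tt = C t tt *m D0 y.
  move=> tB y; apply/eqP; rewrite -subr_eq0; apply/eqP.
  apply: (indep (fun t => D0 y *m C t tt - C t tt *m D0 y)) tB.
  have -> : \sum_(t in B) x t *: base_mx S (D0 y *m C t tt - C t tt *m D0 y) =
      D0S y *m P - P *m D0S y.
    rewrite /P mulmx_suml mulmx_sumr -sumrB; apply: eq_bigr => u _.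
    by rewrite base_mxD base_mxN !base_mxM scalerBr -scalemxAl -scalemxAr.
  have -> : D0S y *m P - P *m D0S y =
      D0S y *m X - X *m D0S y - D0S y *m (X - P) + (X - P) *m D0S y.
    rewrite mulmxBl mulmxBr.
    move: (D0S y *m X) (D0S y *m P) (X *m _) (P *m _) => A1 A2 A3 A4.
    by apply/matrixP => i l; rewrite !mxE; ring.
  by apply: mxpowD; [apply: mxpowB => //; apply: mxpowMl | apply: mxpowMr].
have cG_ex t : exists cG : k * 'M[k]_n, t \in B ->
    C t tt = cG.1%:M + \sum_i D0 (a i) *m cG.2 *m D0 (b i).
  case: (boolP (t \in B)) => tB; last by exists (0, 0).
  by have [c [G hG]] := endomorphism_trace (comm_C t tB); exists (c, G).
have [cG hcG] := choice cG_ex.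
exists (\sum_(t in B) (cG t).1 *: x t), (\sum_(t in B) x t *: base_mx S (cG t).2).
split.
- by apply: mpow_sum => t _; apply: mpowZ.
- by apply: mxpow_sum => t _; apply: mxpow_scale_base_mx.
move: expX; congr (mxpow _ (_ - _)); rewrite /P.
under [X in _ = _ + X]eq_bigr do rewrite mulmx_sumr mulmx_suml.
rewrite exchange_big /= (raddf_sum (@scalar_mx _ n)) -big_split.
apply: eq_bigr => t tB /=; rewrite hcG // base_mxD base_mx_sum scalerDr.
congr (_ + _).
  by apply/matrixP => i l; rewrite !mxE mulr_algr scalerMnl.
rewrite scaler_sumr; apply: eq_bigr => i _.
by rewrite !base_mxM -scalemxAr -scalemxAl.
Qed.

Lemma tangent_transfer j c (Y : 'M[S]_n) : mpow j c -> mxpow j Y ->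
    (forall y, mxpow j.+1 (c *: d0S y - (D0S y *m Y - Y *m D0S y))) ->
  mpow j.+1 c.
Proof.
move=> cj Yj h.
have [i0 _] : exists i : 'I_n, True.
  case: (pselect (exists i : 'I_n, True)) => // no; case: tangent_not_inner.
  by exists 0 => y; apply/matrixP => i; case: no; exists i.
pose F (e : bool) := if e then c%:M else Y.
have Fj e : mxpow j (F e).
  case: e => // i l; rewrite mxE; case: eqP => _ //; exact: mpow_zero.
have [T [B [x [C [indep expF xj]]]]] := @mxpow_expansion k S j j.+1 n n _ F Fj.
have Yexp := expF false; have := expF true i0 i0.
move=> {expF}; rewrite !mxE eqxx mulr1n summxE => cexp.
pose ct t := C t true i0 i0.
have {cexp} cexp : mpow j.+1 (c - \sum_(t in B) ct t *: x t).
  move: cexp; congr (mpow _ (_ - _)); apply: eq_bigr => t _.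
  by rewrite !mxE mulr_algr.
rewrite -[c](subrK (\sum_(t in B) ct t *: x t)); apply: mpowD => //.
apply: mpow_sum => t tB.
suff -> : ct t = 0 by rewrite scale0r; apply: mpow_zero.
have hct y : ct t *: tangent y
    = D0 y *m C t false - C t false *m D0 y.
  apply/eqP; rewrite -subr_eq0; apply/eqP.
  apply: (indep (fun t => ct t *: tangent y
    - (D0 y *m C t false - C t false *m D0 y))) tB.
  move: Yexp; rewrite /F; set P := \sum_(t in B) _ => Yexp.
  have -> : \sum_(t in B) x t *: base_mx S (ct t *: tangent y
        - (D0 y *m C t false - C t false *m D0 y)) =
      (\sum_(t in B) ct t *: x t) *: d0S y - (D0S y *m P - P *m D0S y).
    rewrite /P mulmx_suml mulmx_sumr scaler_suml -!sumrB.
    apply: eq_bigr => u _.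
    rewrite base_mxD base_mxN base_mxZ base_mxD base_mxN !base_mxM scalerBr scalerBr.
    by rewrite scalerA mulr_algr -scalemxAl -scalemxAr.
  set c' := \sum_(t in B) _.
  have -> : c' *: d0S y - (D0S y *m P - P *m D0S y) =
      c *: d0S y - (D0S y *m Y - Y *m D0S y)
      - (c - c') *: d0S y + (D0S y *m (Y - P) - (Y - P) *m D0S y).
    rewrite mulmxBl mulmxBr.
    move: (D0S y *m Y) (D0S y *m P) (Y *m _) (P *m _) => A1 A2 A3 A4.
    by apply/matrixP => i l; rewrite !mxE; ring.
  apply: mxpowD.
    by apply: mxpowB => //; apply: mxpow_scale_base_mx.
  by apply: mxpowB; [apply: mxpowMl | apply: mxpowMr].
apply/eqP/negPn/negP => ct0; apply: tangent_not_inner.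
exists ((ct t)^-1 *: C t false) => y.
by rewrite -scalemxAr -scalemxAl -scalerBr -hct scalerA mulVf // scale1r.
Qed.

End Deformation.

(** * The family over the power series ring is universal *)

Section Universality.
Variables (k : fieldType) (L : falgType k) (N : nat) (a b : 'I_N -> L).
Variables (s : {linear L -> k^o}) (hs : dual_bases a b s).
Variables (V : rmod L) (n : nat) (v : n.-tuple V).
Variable rho : L -> 'M[powser k]_n.
Hypothesis rho_lift : @mx_lift k L V n v (ps_chat k) rho.

Local Notation D0 := (rep_mx v).

Hypothesis tangent_not_inner : ~ inner_mx v (tangent rho).
Hypothesis derivation_tangent : forall D, derivation_mx v D ->
  exists c, inner_mx v (fun y => D y - c *: tangent rho y).
Hypothesis endomorphism_trace : forall X : 'M[k]_n,
  (forall y, D0 y *m X = X *m D0 y) ->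
  exists c (G : 'M[k]_n), X = c%:M + \sum_i D0 (a i) *m G *m D0 (b i).

Variable S : chat k.
Implicit Types psi : chat_hom (ps_chat k) S.
Local Notation D0S y := (base_mx S (D0 y)).
Local Notation d0S y := (base_mx S (tangent rho y)).
Local Notation t := (@ps_t k : ps_chat k).
Local Notation family psi y := (@hom_mx k (ps_chat k) S psi n n (rho y)).

Lemma family_lift psi : mx_lift v (fun y => family psi y).
Proof.
case: rho_lift => r_lin r1 rM r_res; split=> [c x y||x y|y].
- by rewrite r_lin hom_mx_linear homZ hom1.
- by rewrite r1 hom_mx1.
- by rewrite rM hom_mxM.
by rewrite res_hom_mx r_res.
Qed.

Lemma mx_lift_residue (R : chat k) (rho' : L -> 'M[R]_n) y :
  mx_lift v rho' -> mxpow 1 (rho' y - base_mx R (D0 y)).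
Proof. by case=> _ _ _ r_res; apply: mxpow_residueE. Qed.

Lemma family_taylor psi psi' j y : (0 < j)%N -> mpow j (psi' t - psi t) ->
  mxpow j.+1 (family psi' y - family psi y - (psi' t - psi t) *: d0S y).
Proof.
move=> j0 hj i l; rewrite !mxE mulr_algr.
exact: ps_hom_taylor.
Qed.

Lemma family_close psi psi' j y : mpow j (psi' t - psi t) ->
  mxpow j (family psi' y - family psi y).
Proof.
case: (posnP j) => [-> //|j0] hj.
rewrite -(subrK ((psi' t - psi t) *: d0S y) (family psi' y - family psi y)).
apply: mxpowD; last exact: mxpow_scale_base_mx.
by apply: mxpowW (family_taylor _ j0 hj).
Qed.

Section Existence.
Variable rho' : L -> 'M[S]_n.
Hypothesis rho'_lift : mx_lift v rho'.

Definition approx (j : nat) (st : chat_hom (ps_chat k) S * 'M[S]_n) : Prop :=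
  res_mx st.2 = 1%:M /\
  forall y, mxpow j.+1 (family st.1 y *m st.2 - st.2 *m rho' y).

(** The failure of [g] to intertwine the lifts modulo the next power of the
    maximal ideal is a derivation, hence is removed by changing the parameter
    and [g]. *)
Lemma approx_step j st : approx j st -> exists st',
  [/\ approx j.+1 st', mpow j.+1 (st'.1 t - st.1 t)
    & mxpow j.+1 (st'.2 - st.2)].
Proof.
case: st => psi g [/= g_res hE].
have [f_lin _ f_mul _] := family_lift psi.
have [r_lin _ r_mul _] := rho'_lift.
pose E y := family psi y *m g - g *m rho' y.
have [||x y|c [Y [cj Yj hY]]] :=
    @derivation_transfer k L V n v rho derivation_tangent S j.+1 E.
- move=> c x y; rewrite /E f_lin r_lin mulmxDl mulmxDr -scalemxAl -scalemxAr.
  by rewrite opprD addrACA scalerBr.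
- exact: hE.
- have -> : E (x * y) - (E x *m D0S y + D0S x *m E y) =
      E x *m (rho' y - D0S y) + (family psi x - D0S x) *m E y.
    have -> : E (x * y) = family psi x *m E y + E x *m rho' y.
      rewrite /E f_mul r_mul mulmxBr mulmxBl !mulmxA.
      move: (family psi x *m family psi y *m g) (family psi x *m g *m rho' y)
        (g *m rho' x *m rho' y) => A1 A2 A3.
      by apply/matrixP => i l; rewrite !mxE; ring.
    move: (E x) (E y) => Ex Ey; rewrite mulmxBr mulmxBl.
    move: (family psi x *m Ey) (Ex *m rho' y) (Ex *m D0S y) (D0S x *m Ey).
    by move=> A1 A2 A3 A4; apply/matrixP => i l; rewrite !mxE; ring.
  apply: mxpowD.
    by rewrite -[j.+2]addn1; apply: mxpowM; [apply: hE | apply: mx_lift_residue].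
  rewrite -[j.+2]add1n; apply: mxpowM; last exact: hE.
  exact: (mx_lift_residue _ (family_lift psi)).
have psit1 : mpow 1 (psi t - c).
  by apply: mpowB; [apply: mpow_hom_t | apply: mpowW cj].
have [psi' psi't] := ps_subst_hom psit1.
have dt : psi' t - psi t = - c by rewrite psi't addrC addKr.
exists (psi', g - Y); split=> /=; last 2 first.
- by rewrite dt; apply: mpowN.
- by rewrite addrC addKr; apply: mxpowN.
split=> /= [|y].
  rewrite -[RHS]g_res; apply/matrixP => i l; rewrite !mxE resB.
  have /mpow1P -> : mpow 1 (Y i l) by apply: (@mpowW _ _ 1 j.+1) => //; apply: Yj.
  by rewrite subr0.
have -> : family psi' y *m (g - Y) - (g - Y) *m rho' y =
    (E y - (c *: d0S y + (D0S y *m Y - Y *m D0S y)))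
    + (family psi' y - family psi y + c *: d0S y) *m g
    - (c *: d0S y) *m (g - 1%:M) - (family psi' y - D0S y) *m Y
    + Y *m (rho' y - D0S y).
  rewrite /E !mulmxBl !mulmxBr mulmxDl mulmxBl mulmx1.
  move: (family psi' y *m g) (family psi y *m g) (g *m rho' y) (Y *m rho' y)
    (D0S y *m Y) (Y *m D0S y) (c *: d0S y *m g) (family psi' y *m Y).
  move=> A1 A2 A3 A4 A5 A6 A7 A8.
  by apply/matrixP => i l; rewrite !mxE; ring.
apply: mxpowD; last first.
  rewrite -[j.+2]addn1; apply: mxpowM => //; exact: mx_lift_residue.
apply: mxpowB; last first.
  rewrite -[j.+2]add1n; apply: mxpowM => //.
  exact: (mx_lift_residue _ (family_lift psi')).
apply: mxpowB; last first.
  rewrite -[j.+2]addn1; apply: mxpowM; first exact: mxpow_scale_base_mx.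
  by rewrite -(base_mx1 S); apply: mxpow_residueE.
apply: mxpowD => //; apply: mxpowMr.
rewrite -[c]opprK -dt scaleNr; apply: family_taylor => //.
by rewrite dt; apply: mpowN.
Qed.

(** The approximations converge because [S] is complete. *)
Lemma family_versal : exists psi g, intertwines psi rho rho' g.
Proof.
have [psi0 psi0t] := @ps_subst_hom k S 0 (mpow_zero _ _).
have st0 : approx 0 (psi0, 1%:M).
  split=> /= [|y]; first by rewrite -(base_mx1 S) res_base_mx.
  rewrite mulmx1 mul1mx -(subrKA (D0S y)); apply: mxpowD.
    exact: (mx_lift_residue _ (family_lift psi0)).
  by rewrite -opprB; apply/mxpowN/mx_lift_residue.
have step (jst : nat * (chat_hom (ps_chat k) S * 'M[S]_n)) :
    exists st', approx jst.1 jst.2 -> [/\ approx jst.1.+1 st',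
      mpow jst.1.+1 (st'.1 t - jst.2.1 t) & mxpow jst.1.+1 (st'.2 - jst.2.2)].
  case: (pselect (approx jst.1 jst.2)) => [/approx_step[st' h]|no].
    by exists st'.
  by exists jst.2 => /no.
have [next nextP] := choice step.
pose st := fix st j := if j is j'.+1 then next (j', st j') else (psi0, 1%:M).
have st_approx j : approx j (st j).
  by elim: j => // j IHj; have [] := nextP (j, st j) IHj.
have [r hr] : exists r, forall j, mpow j (r - (st j).1 t).
  apply: mpow_limit => j; have [_ h _] := nextP (j, st j) (st_approx j).
  exact: mpowS h.
have [g hg] : exists g, forall j, mxpow j (g - (st j).2).
  apply: mxpow_limit => j; have [_ _ h] := nextP (j, st j) (st_approx j).
  exact: mxpowW h.
have r1 : mpow 1 r.
  rewrite -[r](subrK ((st 1%N).1 t)); apply: mpowD => //.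
  exact: mpow_hom_t.
have [psi psit] := ps_subst_hom r1; exists psi, g; split.
  have [<- _] := st_approx 1%N; apply/matrixP => i l; rewrite !mxE.
  have /mpow1P/eqP := hg 1%N i l; rewrite !mxE resB subr_eq0.
  by move/eqP.
move=> y; apply/eqP; rewrite -subr_eq0; apply/eqP/mxpow_separated => j.
case E: (st j) => [psij gj]; have := st_approx j; rewrite E => -[_ /= happ].
have -> : family psi y *m g - g *m rho' y =
    (family psi y - family psij y) *m g + family psij y *m (g - gj)
    + (family psij y *m gj - gj *m rho' y) - (g - gj) *m rho' y.
  rewrite !mulmxBl mulmxBr.
  move: (family psi y *m g) (g *m rho' y) (family psij y *m g)
    (family psij y *m gj) (gj *m rho' y) => A1 A2 A3 A4 A5.
  by apply/matrixP => i l; rewrite !mxE; ring.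
have hgj : mxpow j (g - gj) by have := hg j; rewrite E.
apply: mxpowB; last exact: mxpowMr.
apply: mxpowD; last exact: mxpowW (happ y).
apply: mxpowD; last exact: mxpowMl.
by apply/mxpowMr/family_close; have := hr j; rewrite E psit.
Qed.

End Existence.

Section Uniqueness.
Variables (psi psi' : chat_hom (ps_chat k) S) (G : 'M[S]_n).
Hypothesis G_res : res_mx G = 1%:M.
Hypothesis G_comm : forall y, family psi' y *m G = G *m family psi y.

Definition trace_mx (X : 'M[S]_n) : 'M[S]_n :=
  \sum_i family psi (a i) *m X *m family psi (b i).

Lemma trace_mx_comm X y :
  family psi y *m trace_mx X = trace_mx X *m family psi y.
Proof.
have [f_lin _ f_mul _] := family_lift psi.
rewrite /trace_mx mulmx_sumr mulmx_suml.
under eq_bigr do rewrite !mulmxA -f_mul.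
under [RHS]eq_bigr do rewrite -mulmxA -f_mul.
apply: (casimir hs (iota := in_alg S)
  (beta := fun u w => family psi u *m X *m family psi w)).
- exact: rmorph1.
- by move=> c u w z; rewrite f_lin !mulmxDl -!scalemxAl.
by move=> c u w z; rewrite f_lin mulmxDr -scalemxAr.
Qed.

(** An intertwiner of two members of the family that agree to order [j] is, to
    order [j], an honest endomorphism of one of them: stably it is a scalar,
    and both scalars and traces lift. *)
Lemma intertwiner_approx j : mpow j (psi' t - psi t) ->
  forall i, (i <= j)%N -> exists c X, mxpow i (G - (c%:M + trace_mx X)).
Proof.
move=> hj; elim=> [|i IHi] ij; first by exists 0, 0.
have [c [X]] := IHi (ltnW ij); move YE : (G - _) => Y hY.
have Y_comm y : mxpow i.+1 (D0S y *m Y - Y *m D0S y).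
  have -> : D0S y *m Y - Y *m D0S y =
      (family psi y *m Y - Y *m family psi y)
      - (family psi y - D0S y) *m Y + Y *m (family psi y - D0S y).
    rewrite mulmxBl mulmxBr.
    move: (D0S y *m Y) (Y *m D0S y) (family psi y *m Y) (Y *m family psi y).
    by move=> A1 A2 A3 A4; apply/matrixP => u w; rewrite !mxE; ring.
  have f1 : mxpow 1 (family psi y - D0S y).
    exact: (mx_lift_residue _ (family_lift psi)).
  apply: mxpowD; last by rewrite -addn1; apply: mxpowM.
  apply: mxpowB; last by rewrite -add1n; apply: mxpowM.
  have -> : family psi y *m Y - Y *m family psi y =
      - ((family psi' y - family psi y) *m G).
    rewrite -YE mulmxBl mulmxBl mulmxBr mulmxDl mulmxDr trace_mx_comm G_comm.
    rewrite scalar_mxC; move: (c%:M *m _) (trace_mx X *m _).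
    move: (family psi y *m G) (G *m family psi y) => A1 A2 A3 A4.
    by apply/matrixP => u w; rewrite !mxE; ring.
  apply/mxpowN/mxpowMr; apply: mxpowW ij _.
  exact: family_close.
have [c' [X' [c'i X'i hX']]] := commutant_transfer endomorphism_trace hY Y_comm.
exists (c + c'), (X + X').
have trD : trace_mx (X + X') = trace_mx X + trace_mx X'.
  rewrite /trace_mx -big_split; apply: eq_bigr => l _ /=.
  by rewrite mulmxDr mulmxDl.
have -> : G - ((c + c')%:M + trace_mx (X + X')) =
    Y - (c'%:M + \sum_l D0S (a l) *m X' *m D0S (b l))
    - (trace_mx X' - \sum_l D0S (a l) *m X' *m D0S (b l)).
  rewrite trD raddfD /= -YE; move: (trace_mx X) (trace_mx X') (\sum_l _).
  by move=> A1 A2 A3; apply/matrixP => u w; rewrite !mxE; ring.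
apply: mxpowB => //; rewrite /trace_mx -sumrB; apply: mxpow_sum => l _.
have f1 z : mxpow 1 (family psi z - D0S z).
  exact: (mx_lift_residue _ (family_lift psi)).
have -> : family psi (a l) *m X' *m family psi (b l) - D0S (a l) *m X' *m D0S (b l)
    = (family psi (a l) - D0S (a l)) *m X' *m family psi (b l)
      + D0S (a l) *m X' *m (family psi (b l) - D0S (b l)).
  rewrite !mulmxBl mulmxBr; move: (family psi (a l) *m X' *m _) (D0S _ *m X' *m D0S _).
  move: (D0S (a l) *m X' *m _) => A1 A2 A3.
  by apply/matrixP => u w; rewrite !mxE; ring.
apply: mxpowD; first by apply: mxpowMr; rewrite -add1n; apply: mxpowM.
by rewrite -addn1; apply: mxpowM => //; apply: mxpowMl.
Qed.

(** If the parameters agree to order [j], then subtracting the approximating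
    endomorphism from [G] exhibits their difference times the tangent as inner,
    modulo the power [j.+1] of the maximal ideal. *)
Lemma family_parameter_unique : psi' t = psi t.
Proof.
apply/eqP; rewrite -subr_eq0; apply/eqP/mpow_separated.
elim=> [//|j IHj]; case: (posnP j) => [->|j0].
  by apply: mpowB; apply: mpow_hom_t.
have [c [X]] := intertwiner_approx IHj (leqnn j); move YE : (G - _) => Y hY.
apply: (tangent_transfer tangent_not_inner IHj (mxpowN hY)) => y.
have f1 : mxpow 1 (family psi y - D0S y).
  exact: (mx_lift_residue _ (family_lift psi)).
set e := psi' t - psi t in IHj *.
have -> : e *: d0S y - (D0S y *m (- Y) - (- Y) *m D0S y) =
    (family psi' y - family psi y) *m G
    + (family psi y *m Y - Y *m family psi y)
    - (family psi' y - family psi y - e *: d0S y) *m G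
    - (e *: d0S y) *m (G - 1%:M)
    - (family psi y - D0S y) *m Y + Y *m (family psi y - D0S y).
  rewrite !mulmxBl !mulmxBr !mulNmx !mulmxN mulmx1.
  move: (D0S y *m Y) (Y *m D0S y) (family psi y *m Y) (Y *m family psi y).
  move: (family psi' y *m G) (family psi y *m G) (e *: d0S y *m G).
  move=> A1 A2 A3 A4 A5 A6 A7.
  by apply/matrixP => u w; rewrite !mxE; ring.
have -> : family psi y *m Y - Y *m family psi y =
    - ((family psi' y - family psi y) *m G).
  rewrite -YE mulmxBl mulmxBl mulmxBr mulmxDl mulmxDr trace_mx_comm G_comm.
  rewrite scalar_mxC; move: (c%:M *m _) (trace_mx X *m _).
  move: (family psi y *m G) (G *m family psi y) => A1 A2 A3 A4.
  by apply/matrixP => u w; rewrite !mxE; ring.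
rewrite subrr add0r; apply: mxpowD; last by rewrite -addn1; apply: mxpowM.
apply: mxpowB; last by rewrite -add1n; apply: mxpowM.
apply: mxpowB; last first.
  rewrite -addn1; apply: mxpowM; first exact: mxpow_scale_base_mx.
  by rewrite -(base_mx1 S); apply: mxpow_residueE.
by apply/mxpowN/mxpowMr; apply: family_taylor.
Qed.

End Uniqueness.

Lemma family_universal rho' psi psi' g g' : mx_lift v rho' ->
  intertwines psi rho rho' g -> intertwines psi' rho rho' g' -> psi =1 psi'.
Proof.
move=> _ [g_res g_comm] [g'_res g'_comm].
have [h [gh hg]] := res_mx_unit g_res.
apply: ps_hom_eq; apply/esym/(@family_parameter_unique _ _ (g' *m h)).
  rewrite res_mxM g'_res mul1mx; move: (congr1 (@res_mx k S n n) gh).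
  by rewrite res_mxM g_res mul1mx => ->; rewrite -(base_mx1 S) res_base_mx.
move=> y; rewrite mulmxA g'_comm -!mulmxA; congr (_ *m _).
rewrite -[h *m family psi y]mulmx1 -gh.
rewrite -[h *m _ *m _]mulmxA [family psi y *m _]mulmxA g_comm.
by rewrite !mulmxA hg mul1mx.
Qed.

End Universality.

(** * Values of paths and minimal relations *)

Lemma exists_path_cat (Q : quiver) (p q : qpath Q) : qtgt p = qsrc q ->
  exists r : qpath Q, qsrc r = qsrc p /\ qarrows r = qarrows p ++ qarrows q.
Proof.
move=> pq; have rP : composable (qsrc p, qarrows p ++ qarrows q).1
                                (qsrc p, qarrows p ++ qarrows q).2.
  case: p q pq => -[u s] /= us [[w s'] /= ws'].
  rewrite /qtgt /qsrc /qarrows /= => uw; subst w.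
  elim: s u us ws' => [|a s IHs] u //=.
  by case/andP=> -> sa /= h; apply: IHs.
by exists (exist (fun z : vert Q * seq (arr Q) => composable z.1 z.2) _ rP).
Qed.

Section PathValues.
Variables (Q : quiver) (A : pzRingType) (E : vert Q -> A) (F : arr Q -> A).
Hypothesis EM : forall v w, E v * E w = if v == w then E v else 0.
Hypothesis FE : forall a, F a * E (tgt a) = F a.

Definition path_value (p : qpath Q) : A :=
  E (qsrc p) * \prod_(a <- qarrows p) F a.

Lemma path_value_src p : E (qsrc p) * path_value p = path_value p.
Proof. by rewrite /path_value mulrA EM eqxx. Qed.

Lemma path_value_tgt p : path_value p * E (qtgt p) = path_value p.
Proof.
case: p => -[u s] /= us; rewrite /path_value /qtgt /qsrc /qarrows /=.
elim: s u us => [|a s IHs] u /=; first by rewrite big_nil mulr1 EM eqxx.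
case/andP=> /eqP <- sa; rewrite big_cons -(FE a) -!mulrA.
by rewrite [E (tgt a) * (_ * _)]mulrA IHs.
Qed.

Lemma path_value_mul0 p q : qtgt p != qsrc q -> path_value p * path_value q = 0.
Proof.
move=> pq; rewrite -path_value_tgt -(path_value_src q) mulrA.
by rewrite -[_ * _ * E _]mulrA EM (negbTE pq) mulr0 mul0r.
Qed.

Lemma path_value_cat p q r : qsrc r = qsrc p ->
  qarrows r = qarrows p ++ qarrows q -> qtgt p = qsrc q ->
  path_value p * path_value q = path_value r.
Proof.
move=> rp rpq pq; rewrite {2}/path_value mulrA -pq path_value_tgt.
by rewrite /path_value rp rpq big_cat /= mulrA.
Qed.

End PathValues.

Section Relations.
Variables (k : fieldType) (L : falgType k) (Q : quiver).
Variable pi : bound_quiver_algebra L Q.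
Local Open Scope fset_scope.

Lemma im_path_value p : im_path pi p = path_value (im_vert pi) (im_arr pi) p.
Proof. by []. Qed.

Lemma im_vert_arr a : im_vert pi (src a) * im_arr pi a = im_arr pi a.
Proof.
by rewrite -(im_arr_corner pi a) -!mulrA mulrA im_vertM eqxx.
Qed.

Lemma im_arr_vert a : im_arr pi a * im_vert pi (tgt a) = im_arr pi a.
Proof.
by rewrite -(im_arr_corner pi a) -!mulrA im_vertM eqxx.
Qed.

(** The sum over a minimal set of parallel terms that contains [p] and has sum
    zero is a minimal relation: a vanishing proper partial sum or its
    complement would contain [p]. *)
Lemma minimal_relation_of_sum (c : path_comb k Q) (S : {fset qpath Q}) p :
    p \in S -> S `<=` finsupp c ->
    (forall q, q \in S -> qsrc q = qsrc p /\ qtgt q = qtgt p) ->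
    \sum_(q <- S) c q *: im_path pi q = 0 ->
  exists2 x : path_comb k Q, minimal_relation pi x & p \in finsupp x.
Proof.
have [m] := ubnP #|` S|; elim: m S => // m IHm S; rewrite ltnS => Sm pS Sc par S0.
case: (pselect (exists T : {fset qpath Q}, [/\ T `<` S, T != fset0
    & \sum_(q <- T) c q *: im_path pi q = 0])) => [[T [TS Tn0 T0]]|noT].
  have [U [US pU U0]] : exists U : {fset qpath Q}, [/\ U `<` S, p \in U &
      \sum_(q <- U) c q *: im_path pi q = 0].
    case: (boolP (p \in T)) => pT; first by exists T.
    exists (S `\` T); split; last 2 first.
    - by rewrite inE pT.
    - move: S0; rewrite (big_fsetID _ (mem T)) /=.
      have -> : [fset x in S | x \in T] = T.
        apply/fsetP => x; rewrite !inE; apply/andb_idl => xT.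
        exact: (fsubsetP (fproper_sub TS)).
      have -> : [fset x in S | x \notin T] = S `\` T.
        by apply/fsetP => x; rewrite !inE andbC.
      by rewrite T0 add0r.
    case/fset0Pn: Tn0 => q qT.
    rewrite fproperE fsubsetDl; apply/negP => /fsubsetP/(_ q).
    by rewrite inE qT (fsubsetP (fproper_sub TS)) // => /(_ isT).
  have sUS := fproper_sub US.
  apply: (IHm U) => //.
  - exact: leq_trans (fproper_ltn_card US) Sm.
  - exact: fsubset_trans sUS Sc.
  by move=> q /(fsubsetP sUS); apply: par.
pose x : path_comb k Q := [fsfun q in S => c q | 0].
have xE q : q \in S -> x q = c q by move=> qS; rewrite fsfunE qS.
have xS : finsupp x = S.
  apply/fsetP => q; rewrite mem_finsupp fsfunE; case: ifP => [qS|]; last first.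
    by rewrite eqxx.
  by rewrite -mem_finsupp (fsubsetP Sc).
exists x; last by rewrite xS.
split; rewrite ?xS.
- rewrite /in_I /im_comb xS -[RHS]S0; apply: eq_big_seq => q qS.
  by rewrite xE.
- by apply/fset0Pn; exists p.
- by move=> q q' /par[-> ->] /par[-> ->].
move=> T TS Tn0 T0; apply: noT; exists T; split=> //.
rewrite -[RHS]T0; apply: eq_big_seq => q qT.
by rewrite xE // (fsubsetP (fproper_sub TS)).
Qed.

(** An element of the ideal remains in it after restriction to the paths
    parallel to a given one. *)
Lemma minimal_relation_of_mem (c : path_comb k Q) p :
    im_comb pi c = 0 -> p \in finsupp c ->
  exists2 x : path_comb k Q, minimal_relation pi x & p \in finsupp x.
Proof.
move=> c0 pc.
pose par q := (qsrc q == qsrc p) && (qtgt q == qtgt p).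
pose S := [fset q in finsupp c | par q].
apply: (@minimal_relation_of_sum c S).
- by rewrite !inE pc /par !eqxx.
- by apply/fsubsetP => q; rewrite !inE => /andP[].
- by move=> q; rewrite !inE => /and3P[_ /eqP -> /eqP ->].
have := congr1 (fun y => im_vert pi (qsrc p) * y * im_vert pi (qtgt p)) c0.
rewrite /im_comb mulr0 mul0r mulr_sumr mulr_suml => h; rewrite -[RHS]h.
rewrite [RHS](big_fsetID _ par) /= [X in _ = (_ + X)%R]big_seq.
rewrite [X in _ = (_ + X)%R]big1 => [|q]; last first.
  rewrite !inE => /andP[_]; rewrite negb_and -scalerAr -scalerAl.
  rewrite im_path_value -(path_value_src _ (im_vertM pi)).
  rewrite -(path_value_tgt (im_vertM pi) im_arr_vert).
  case/orP=> /negbTE qp.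
    by rewrite !mulrA im_vertM eq_sym qp !mul0r scaler0.
  by rewrite -!mulrA im_vertM qp !mulr0 scaler0.
rewrite addr0 [LHS]big_seq [RHS]big_seq; apply: eq_bigr => q.
rewrite !inE => /and3P[_ /eqP <- /eqP <-].
rewrite -scalerAr -scalerAl im_path_value.
by rewrite (path_value_src _ (im_vertM pi))
  (path_value_tgt (im_vertM pi) im_arr_vert).
Qed.

End Relations.

(** * Reading paths along a band *)

Fact backward_position (i r l M t : nat) : (i < r)%N -> (t < l)%N -> (l <= M)%N ->
  [/\ (i + M - l + t < r + M)%N, (l - t.+1 < l)%N
    & (i + M - l + t + (l - t.+1).+1 = M + i)%N].
Proof. by move=> *; split; lia. Qed.

Section BandReading.
Variables (Q : quiver) (r : nat) (b : r.-tuple (letter Q)).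
Hypothesis reduced : forall i : 'I_r, tnth b (ordS i) <> linv (tnth b i).

Lemma ordS_inj : injective (@ordS r).
Proof. exact: can_inj (@ordSK r). Qed.

Lemma no_backtrack i j c : ordS i = j -> tnth b i = (c, true) ->
  tnth b j <> (c, false).
Proof. by move=> <- hi hj; case: (@reduced i); rewrite hi hj. Qed.

Lemma no_backtrack' i j c : ordS i = j -> tnth b i = (c, false) ->
  tnth b j <> (c, true).
Proof. by move=> <- hi hj; case: (@reduced i); rewrite hi hj. Qed.

Fixpoint reads_fwd (i : 'I_r) (s : seq (arr Q)) : Prop :=
  if s is c :: s' then tnth b i = (c, true) /\ reads_fwd (ordS i) s' else True.

Fixpoint reads_bwd (i : 'I_r) (s : seq (arr Q)) : Prop :=
  if s is c :: s' then
    exists j, [/\ ordS j = i, tnth b j = (c, false) & reads_bwd j s'] else True.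

Definition band_letter (l0 : letter Q) (e : nat) : letter Q := nth l0 b (e %% r).

Lemma nth_word_pow l0 N e : (e < N * r)%N ->
  nth l0 (word_pow b N) e = band_letter l0 e.
Proof.
rewrite /band_letter; elim: N e => [|N IHN] e; first by rewrite mul0n.
rewrite mulSn /word_pow /= nth_cat size_tuple => h.
case: ltnP => er; first by rewrite modn_small.
rewrite IHN; last by rewrite ltn_subLR.
by rewrite -{2}(subnK er) modnDr.
Qed.

Lemma size_word_pow N : size (word_pow b N) = (N * r)%N.
Proof. by elim: N => //= N IHN; rewrite size_cat size_tuple IHN mulSn. Qed.

Lemma band_letterE l0 e (i : 'I_r) : e = i %[mod r] ->
  band_letter l0 e = tnth b i.
Proof.
by move=> ei; rewrite /band_letter ei modn_small // (tnth_nth l0).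
Qed.

Lemma reads_fwdP l0 a0 i s : reads_fwd i s -> forall t e, (t < size s)%N ->
  e = (i + t)%N %[mod r] -> band_letter l0 e = (nth a0 s t, true).
Proof.
elim: s i => // c s IHs i [hi hs] [|t] e /= ts ei.
  by rewrite addn0 in ei; rewrite (band_letterE _ ei).
by apply: IHs hs _ _ ts _; rewrite ei /= modnDml addSn addnS.
Qed.

Lemma reads_bwdP l0 a0 i s : reads_bwd i s -> forall t e, (t < size s)%N ->
  (e + t.+1)%N = i %[mod r] -> band_letter l0 e = (nth a0 s t, false).
Proof.
elim: s i => // c s IHs i [j [ji hj hs]] t e /= ts.
rewrite -ji /= modn_mod -[j.+1]addn1 => ei.
case: t ts ei => [|t] ts /eqP; rewrite -?[t.+2]addn1 ?addnA eqn_modDr => /eqP ei.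
  by rewrite (band_letterE _ ei).
by apply: IHs hs _ _ ts ei.
Qed.

Lemma infix_of_nth (T : eqType) (x0 : T) (w u : seq T) e :
    (e + size u <= size w)%N ->
    (forall t, (t < size u)%N -> nth x0 w (e + t) = nth x0 u t) ->
  infix u w.
Proof.
move=> uw h; have -> : u = take (size u) (drop e w).
  apply: (@eq_from_nth _ x0) => [|t tu].
    by rewrite size_take size_drop; case: ltnP => //; lia.
  by rewrite nth_take // nth_drop h.
apply/infixP; exists (take e w), (drop (size u) (drop e w)).
by rewrite !cat_take_drop.
Qed.

Lemma reads_subword (p : qpath Q) i :
    reads_fwd i (qarrows p) \/ reads_bwd i (qarrows p) ->
  exists N, subword_up_to_inverse p (word_pow b N).
Proof.
have r0 : (0 < r)%N by apply: leq_ltn_trans (ltn_ord i).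
pose l0 := tnth b i; pose a0 := l0.1; set s := qarrows p.
have ls : (size s <= size s * r)%N by rewrite leq_pmulr.
case=> [/(reads_fwdP l0 a0) h|/(reads_bwdP l0 a0) h]; exists (size s).+1.
  left; apply: (@infix_of_nth _ l0 _ _ i).
    by rewrite size_word_pow size_map mulSn leq_add // ltnW.
  rewrite size_map => t ts; rewrite nth_word_pow.
    by rewrite (nth_map a0) // (h t).
  by rewrite mulSn -addSn leq_add // (leq_trans (ltnW ts)).
(* The inverse path is read at the positions just before [i], shifted by a
   multiple of [r] to make them nonnegative. *)
right; apply: (@infix_of_nth _ l0 _ _ (i + size s * r - size s)).
  rewrite size_word_pow size_rev !size_map mulSn subnK.
    by rewrite leq_add2r ltnW.
  exact: leq_trans ls (leq_addl _ _).
rewrite size_rev !size_map => t ts.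
have [pos1 pos2 pos3] := backward_position (ltn_ord i) ts ls.
rewrite nth_word_pow ?mulSn // nth_rev !size_map // (nth_map l0) ?size_map //.
by rewrite (nth_map a0) // (h (size s - t.+1)%N) // pos3 modnMDl.
Qed.

End BandReading.

(** * Band representations over a commutative ring *)

Section BandMatrices.
Variables (Q : quiver) (r : nat) (b : r.-tuple (letter Q)) (m : nat).

Definition band_index : finType := ('I_r * 'I_m)%type.
Notation n := #|band_index|.
Definition band_idx (i : 'I_r) (x : 'I_m) : 'I_n := enum_rank ((i, x) : band_index).
Definition band_pos (p : 'I_n) : 'I_r := (enum_val p).1.
Definition band_coord (p : 'I_n) : 'I_m := (enum_val p).2.

Lemma band_pos_idx i x : band_pos (band_idx i x) = i.
Proof. by rewrite /band_pos enum_rankK. Qed.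
Lemma band_coord_idx i x : band_coord (band_idx i x) = x.
Proof. by rewrite /band_coord enum_rankK. Qed.

Lemma band_idxK p : band_idx (band_pos p) (band_coord p) = p.
Proof. by rewrite /band_idx -surjective_pairing enum_valK. Qed.

Lemma sum_band_idx (R : nmodType) (F : 'I_n -> R) :
  \sum_p F p = \sum_i \sum_x F (band_idx i x).
Proof.
rewrite pair_big_dep /= (reindex (fun p : band_index => enum_rank p)) /=.
  by apply: eq_bigr => -[i x].
exact/onW_bij/enum_rank_bij.
Qed.

Lemma sum_block (R : nmodType) (F : 'I_n -> R) j :
  (forall i x, i != j -> F (band_idx i x) = 0) -> \sum_p F p = \sum_x F (band_idx j x).
Proof.
move=> h; rewrite sum_band_idx (bigD1 j) //= [X in _ + X]big1 ?addr0 // => i ij.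
by rewrite big1 // => x _; apply: h.
Qed.

Section OverRing.
Variables (R : comNzRingType) (M : 'I_r -> 'M[R]_m).

Definition band_vert_mx (w : vert Q) : 'M[R]_n :=
  \matrix_(p, q) ((p == q) && (lstart (tnth b (band_pos p)) == w))%:R.

Definition band_arr_mx (c : arr Q) : 'M[R]_n :=
  \matrix_(p, q)
    ((if (tnth b (band_pos p) == (c, true)) && (ordS (band_pos p) == band_pos q)
      then M (band_pos p) (band_coord q) (band_coord p) else 0)
   + (if (tnth b (band_pos q) == (c, false)) && (ordS (band_pos q) == band_pos p)
      then M (band_pos q) (band_coord q) (band_coord p) else 0)).

Lemma band_vert_mxM v w :
  band_vert_mx v * band_vert_mx w = if v == w then band_vert_mx v else 0.
Proof.
apply/matrixP => p q; rewrite mxE (bigD1 p) //= big1 => [|u up]; last first.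
  by rewrite !mxE eq_sym (negbTE up) mul0r.
rewrite addr0 !mxE eqxx /=; case: (eqVneq v w) => [->|vw]; rewrite mxE.
  by case: (_ == w); rewrite ?mul1r ?mul0r ?andbF.
case: eqP => [->|_]; last by rewrite mul0r.
by rewrite (negbTE vw) andbF mulr0.
Qed.

Lemma band_vert_mx_sum : \sum_w band_vert_mx w = 1.
Proof.
apply/matrixP => p q; rewrite summxE -[1]/(1%:M) [RHS]mxE.
rewrite (bigD1 (lstart (tnth b (band_pos p)))) //= mxE eqxx andbT.
rewrite big1 ?addr0 // => w wp; rewrite mxE [_ == w]eq_sym.
by rewrite (negbTE wp) andbF.
Qed.

Hypothesis walk : forall i : 'I_r, lend (tnth b i) = lstart (tnth b (ordS i)).

Lemma band_vert_arr c : band_vert_mx (src c) * band_arr_mx c = band_arr_mx c.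
Proof.
apply/matrixP => p q; rewrite mxE (bigD1 p) //= big1 => [|u up]; last first.
  by rewrite !mxE eq_sym (negbTE up) mul0r.
rewrite addr0 mxE eqxx /=; case: eqP => [_|st]; first by rewrite mul1r.
rewrite mul0r mxE; case: andP => [[/eqP h _]|_]; first by case: st; rewrite h.
case: andP => [[/eqP h /eqP hq]|_]; last by rewrite addr0.
by case: st; rewrite -hq -walk h.
Qed.

Lemma band_arr_vert c : band_arr_mx c * band_vert_mx (tgt c) = band_arr_mx c.
Proof.
apply/matrixP => p q; rewrite mxE (bigD1 q) //= big1 => [|u uq]; last first.
  by rewrite [band_vert_mx _ _ _]mxE (negbTE uq) mulr0.
rewrite addr0 [band_vert_mx _ _ _]mxE eqxx /=; case: eqP => [_|st].
  by rewrite mulr1.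
rewrite mulr0 mxE; case: andP => [[/eqP h /eqP hq]|_].
  by case: st; rewrite -hq -walk h.
case: andP => [[/eqP h _]|_]; last by rewrite addr0.
by case: st; rewrite h.
Qed.

(** A nonzero matrix entry of a path shows that the path can be read along the
    band. The direction of reading cannot change: the step after a turn would
    use the same letter of the band with the opposite orientation. *)
Lemma band_arr_reads (s : seq (arr Q)) p q :
    (\prod_(c <- s) band_arr_mx c) p q != 0 ->
  reads_fwd b (band_pos p) s \/ reads_bwd b (band_pos p) s.
Proof.
elim: s p => [|c s IHs] p; first by left.
rewrite big_cons mxE => pq0.
have [u] : exists u, band_arr_mx c p u * (\prod_(c <- s) band_arr_mx c) u q != 0.
  apply/existsP; apply: contraNT pq0; rewrite negb_exists => /forallP h.
  by rewrite big1 // => u _; apply/eqP; rewrite -[_ == _]negbK h.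
case: (eqVneq (band_arr_mx c p u) 0) => [->|pu0]; first by rewrite mul0r eqxx.
case: (eqVneq ((\prod_(c <- s) band_arr_mx c) u q) 0) => [->|/IHs IH _].
  by rewrite mulr0 eqxx.
move: pu0; rewrite mxE; case: andP => [[/eqP h1 /eqP h2] _|_].
  left; split=> //; rewrite h2; case: IH => //; case: (s) => //= d s' [j [jS hj _]].
  by move: hj; rewrite (ordS_inj (etrans jS (esym h2))) h1.
rewrite add0r; case: andP => [[/eqP h1 /eqP h2] _|]; last by rewrite eqxx.
right; exists (band_pos u); split=> //; case: IH => //.
by case: (s) => //= d s' []; rewrite h1.
Qed.

Hypothesis reduced : forall i : 'I_r, tnth b (ordS i) <> linv (tnth b i).

(** The rows and columns through which the [i]-th letter acts. No other letter
    contributes to them, because the band is reduced. *)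
Lemma band_arr_fwd i c x q : tnth b i = (c, true) ->
  band_arr_mx c (band_idx i x) q =
    if ordS i == band_pos q then M i (band_coord q) x else 0.
Proof.
move=> bi; rewrite mxE band_pos_idx band_coord_idx bi eqxx /=.
case: (eqVneq (tnth b (band_pos q)) (c, false)) => [h|_] /=; last by rewrite addr0.
case: (ordS (band_pos q) =P i) => [hq|_]; last by rewrite addr0.
by case: (no_backtrack' reduced hq h).
Qed.

Lemma band_arr_fwd' i c p z : tnth b i = (c, true) ->
  band_arr_mx c p (band_idx (ordS i) z) =
    if band_pos p == i then M i z (band_coord p) else 0.
Proof.
move=> bi; rewrite mxE band_pos_idx band_coord_idx (inj_eq (@ordS_inj r)).
have /eqP/negbTE -> := no_backtrack reduced (erefl _) bi.
rewrite addr0; case: (eqVneq (band_pos p) i) => [->|_]; last by rewrite andbF.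
by rewrite bi eqxx.
Qed.

Lemma band_arr_bwd i c x q : tnth b i = (c, false) ->
  band_arr_mx c (band_idx (ordS i) x) q =
    if band_pos q == i then M i (band_coord q) x else 0.
Proof.
move=> bi; rewrite mxE band_pos_idx band_coord_idx (inj_eq (@ordS_inj r)).
have /eqP/negbTE -> := no_backtrack' reduced (erefl _) bi.
rewrite add0r; case: (eqVneq (band_pos q) i) => [->|_]; last by rewrite andbF.
by rewrite bi eqxx.
Qed.

Lemma band_arr_bwd' i c p z : tnth b i = (c, false) ->
  band_arr_mx c p (band_idx i z) =
    if ordS i == band_pos p then M i z (band_coord p) else 0.
Proof.
move=> bi; rewrite mxE band_pos_idx band_coord_idx bi eqxx /=.
case: (eqVneq (tnth b (band_pos p)) (c, true)) => [h|_] /=; last by rewrite add0r.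
case: (ordS (band_pos p) =P i) => [hp|_]; last by rewrite add0r.
by case: (no_backtrack reduced hp h).
Qed.

End OverRing.
End BandMatrices.

(** * The family of band modules *)

Section RepMx.
Variables (k : fieldType) (L : falgType k) (V : rmod L) (n : nat).
Variable v : n.-tuple V.
Hypothesis basis_v : basis_of fullv v.

Lemma rep_mx_linear c x y : rep_mx v (c *: x + y) = c *: rep_mx v x + rep_mx v y.
Proof.
apply: (to_row_mx_eq basis_v) => w; rewrite mulmxDr -scalemxAr.
by rewrite -!(to_row_ract basis_v) ract_linear linearP.
Qed.

Lemma rep_mxM x y : rep_mx v (x * y) = rep_mx v x *m rep_mx v y.
Proof.
apply: (to_row_mx_eq basis_v) => w; rewrite mulmxA -!(to_row_ract basis_v).
by rewrite ract_mul.
Qed.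

Lemma rep_mx1 : rep_mx v 1 = 1%:M.
Proof.
apply: (to_row_mx_eq basis_v) => w; rewrite mulmx1 -(to_row_ract basis_v).
by rewrite ract_one.
Qed.

End RepMx.

Section BandFamily.
Variables (k : fieldType) (L : falgType k) (Q : quiver).
Variables (pi : bound_quiver_algebra L Q) (V : rmod L).
Variables (r : nat) (b : r.-tuple (letter Q)) (lambda : k) (m' : nat).
Notation m := m'.+1.
Hypothesis band_b : is_band pi b.
Variable Phi : {linear V -> {ffun 'I_r -> 'cV[k]_m}}.
Hypothesis Phi_bij : bijective Phi.
Hypothesis Phi_vert : forall w x,
  Phi (ract V (im_vert pi w) x) = band_vert b w (Phi x).
Hypothesis Phi_arr : forall c x,
  Phi (ract V (im_arr pi c) x) = band_arr b lambda c (Phi x).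

Local Notation n := #|band_index r m|.

Let walk (i : 'I_r) : lend (tnth b i) = lstart (tnth b (ordS i)).
Proof. by case: band_b. Qed.

Let reduced (i : 'I_r) : tnth b (ordS i) <> linv (tnth b i).
Proof. by case: band_b. Qed.

Definition band_delta (p : 'I_n) : {ffun 'I_r -> 'cV[k]_m} :=
  [ffun j => if j == band_pos p then delta_mx (band_coord p) 0 else 0].

Lemma band_delta_sum (z : {ffun 'I_r -> 'cV[k]_m}) :
  z = \sum_p z (band_pos p) (band_coord p) 0 *: band_delta p.
Proof.
apply/ffunP => j; rewrite sum_ffunE sum_band_idx (bigD1 j) //= [X in _ + X]big1 => [|i ij].
  rewrite addr0; apply/colP => y; rewrite summxE (bigD1 y) //= big1 => [|x xy].
    by rewrite !ffunE band_pos_idx band_coord_idx eqxx !mxE !eqxx mulr1 addr0.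
  rewrite !ffunE band_pos_idx band_coord_idx eqxx !mxE eq_sym (negbTE xy) mulr0 //.
rewrite big1 // => x _; rewrite !ffunE band_pos_idx eq_sym (negbTE ij).
by rewrite scaler0.
Qed.

Lemma exists_band_basis : exists2 v : n.-tuple V, basis_of fullv v
  & (forall p : 'I_n, Phi v`_p = band_delta p) /\
    forall w (p : 'I_n), to_row v w 0 p = Phi w (band_pos p) (band_coord p) 0.
Proof.
have [Psi PhiK PsiK] := Phi_bij.
pose v := [tuple Psi (band_delta p) | p < n].
have vE (p : 'I_n) : Phi v`_p = band_delta p by rewrite -tnth_nth tnth_mktuple PsiK.
have coef (c : 'I_n -> k) p : Phi (\sum_i c i *: v`_i) (band_pos p) (band_coord p) 0 = c p.
  rewrite linear_sum sum_ffunE summxE (bigD1 p) //= big1 => [|q qp].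
    rewrite linearZ_LR /= ffunE vE mxE ffunE eqxx mxE !eqxx mulr1.
    by rewrite addr0.
  rewrite linearZ_LR /= ffunE vE mxE ffunE; case: eqP => [pq|_].
    rewrite mxE eqxx andbT; case: eqP => [xq|_]; last by rewrite mulr0.
    by case/eqP: qp; rewrite -(band_idxK q) -(band_idxK p) pq xq.
  by rewrite mxE mulr0.
have sumE w : w = \sum_p Phi w (band_pos p) (band_coord p) 0 *: v`_p.
  apply: (can_inj PhiK); rewrite linear_sum {1}(band_delta_sum (Phi w)).
  by apply: eq_bigr => p _; rewrite linearZ_LR vE.
have basis_v : basis_of fullv v.
  rewrite /basis_of; apply/andP; split.
    rewrite eqEsubv subvf; apply/subvP => w _; rewrite (sumE w).
    apply: memv_suml => p _; apply/memvZ/memv_span/mem_nth.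
    by rewrite size_tuple.
  by apply/freeP => c c0 p; rewrite -(coef c p) c0 linear0 ffunE mxE.
exists v => //; split=> // w p; rewrite mxE.
by rewrite {1}(sumE w) coord_sum_free // (basis_free basis_v).
Qed.

Variable v : n.-tuple V.
Hypotheses (basis_v : basis_of fullv v) (vE : forall p : 'I_n, Phi v`_p = band_delta p).
Hypothesis rowE_v : forall w p, to_row v w 0 p = Phi w (band_pos p) (band_coord p) 0.

Lemma rep_mx_entry y p q :
  rep_mx v y p q = Phi (ract V y v`_p) (band_pos q) (band_coord q) 0.
Proof.
rewrite mxE rowE_v; congr (Phi (ract V y _) _ _ _).
rewrite /of_row (bigD1 p) //= mxE !eqxx scale1r big1 ?addr0 // => i ip.
by rewrite mxE (negbTE ip) andbF scale0r.
Qed.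

Lemma rep_mx_vert w : rep_mx v (im_vert pi w) = band_vert_mx b m k w.
Proof.
apply/matrixP => p q; rewrite rep_mx_entry Phi_vert vE !mxE !ffunE.
case: (eqVneq p q) => [->|pq] /=; rewrite ?eqxx.
  by case: ifP => _; rewrite mxE ?eqxx.
case: ifP => _; last by rewrite mxE.
case: eqP => [qp|_]; rewrite mxE // eqxx andbT; case: eqP => // xq.
by case/eqP: pq; rewrite -(band_idxK q) -(band_idxK p) qp xq.
Qed.

Lemma rep_mx_arr c :
  rep_mx v (im_arr pi c) = band_arr_mx b (letter_mx b lambda m) c.
Proof.
apply/matrixP => p q; rewrite rep_mx_entry Phi_arr vE !mxE !ffunE mxE.
have colE (A : 'M[k]_m) y x : (A *m (delta_mx x 0 : 'cV_m)) y 0 = A y x.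
  by rewrite -colE mxE.
congr (_ + _).
  rewrite summxE big_mkcond (bigD1 (band_pos p)) //= big1 => [|i ip]; last first.
    by case: ifP => // _; rewrite ffunE (negbTE ip) mulmx0 mxE.
  by rewrite addr0; case: ifP => // _; rewrite ffunE eqxx colE.
rewrite summxE big_mkcond (bigD1 (band_pos q)) //= big1 => [|i iq]; last first.
  by rewrite (negbTE iq) andbF.
rewrite eqxx andbT addr0 ffunE; case: eqP => //= _.
by case: eqP => [_|_]; rewrite ?colE // mulmx0 mxE.
Qed.

(** The last letter acts by the Jordan block plus [t] times the elementary
    matrix which completes its superdiagonal to a cycle; for [m = 1] this
    replaces its eigenvalue [c] by [c + t]. *)
Definition family_mx (i : 'I_r) : 'M[powser k]_m :=
  \matrix_(y, x) fun e => letter_mx b lambda m i y x *+ (e == 0%N)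
    + [&& e == 1%N, i.+1 == r, y == ord_max & x == ord0]%:R.

Definition path_mx (p : qpath Q) : 'M[powser k]_n :=
  path_value (band_vert_mx b m (powser k)) (band_arr_mx b family_mx) p.

(** Paths occurring in relations cannot be read along the band, hence act as
    zero. *)
Lemma path_mx_relation (c : path_comb k Q) p :
  im_comb pi c = 0 -> p \in finsupp c -> path_mx p = 0.
Proof.
move=> c0 pc; have p2 := bq_adm c0 pc.
have [x x_min px] := minimal_relation_of_mem c0 pc.
apply/matrixP => i j; rewrite [RHS]mxE; apply/eqP/negPn/negP => ij.
have {}ij : (\prod_(a <- qarrows p) band_arr_mx b family_mx a) i j != 0.
  apply: contraNneq ij => h; rewrite /path_mx /path_value mxE big1 // => l _.
  rewrite mxE; case: eqP => [<-|_]; last by rewrite mul0r.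
  by rewrite h mulr0.
have [N hN] := reads_subword (band_arr_reads ij).
have [_ _ _ _ /(_ N p (ltnW p2) hN)[_]] := band_b.
by case; exists x.
Qed.

(** The graph of the representation: [y] acts through any expression as a linear
    combination of paths. It is the graph of a map by [acts_as_functional], which
    rests on [path_mx_relation]. *)
Definition acts_as (y : L) (A : 'M[powser k]_n) : Prop :=
  exists s : seq (k * qpath Q),
    y = \sum_(c <- s) c.1 *: im_path pi c.2 /\
    A = \sum_(c <- s) (c.1%:A : powser k) *: path_mx c.2.

Lemma acts_as_lin c y A z B : acts_as y A -> acts_as z B ->
  acts_as (c *: y + z) ((c%:A : powser k) *: A + B).
Proof.
case=> s [-> ->] [s' [-> ->]]; exists ([seq (c * d.1, d.2) | d <- s] ++ s').
rewrite !big_cat !big_map !scaler_sumr /=; split; congr (_ + _).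
  by apply: eq_bigr => d _; rewrite scalerA.
by apply: eq_bigr => d _; rewrite !scalerA mulr_algl scalerA.
Qed.

Lemma acts_as0 : acts_as 0 0.
Proof. by exists [::]; rewrite !big_nil. Qed.

Lemma acts_as_sum (I : Type) (s : seq I) (y : I -> L) A :
  (forall i, acts_as (y i) (A i)) ->
  acts_as (\sum_(i <- s) y i) (\sum_(i <- s) A i).
Proof.
move=> h; elim: s => [|i s IHs]; first by rewrite !big_nil; apply: acts_as0.
by have := acts_as_lin 1 (h i) IHs; rewrite !big_cons !scale1r.
Qed.

Lemma acts_as_path p : acts_as (im_path pi p) (path_mx p).
Proof. by exists [:: (1, p)]; rewrite !big_seq1 !scale1r. Qed.

Lemma acts_asM y A z B : acts_as y A -> acts_as z B -> acts_as (y * z) (A * B).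
Proof.
case=> s [-> ->] [s' [-> ->]]; rewrite !mulr_suml.
apply: acts_as_sum => c; rewrite !mulr_sumr; apply: acts_as_sum => d.
rewrite -scalerAl -scalerAr.
rewrite -[X in acts_as _ X]/(_ *m _) -scalemxAl -scalemxAr !scalerA.
rewrite mulr_algl scalerA.
rewrite -[X in acts_as X _]addr0 -[X in acts_as _ X]addr0.
apply: acts_as_lin acts_as0; rewrite -[_ *m _]/(_ * _).
case: (eqVneq (qtgt c.2) (qsrc d.2)) => [cd|cd].
  have [q [q1 q2]] := exists_path_cat cd; rewrite !im_path_value.
  rewrite (path_value_cat (im_vertM pi) (im_arr_vert pi) q1 q2 cd).
  rewrite /path_mx (path_value_cat (band_vert_mxM _ _ _) (band_arr_vert _ walk)
    q1 q2 cd).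
  exact: acts_as_path.
rewrite !im_path_value (path_value_mul0 (im_vertM pi) (im_arr_vert pi) cd).
rewrite /path_mx (path_value_mul0 (band_vert_mxM _ _ _) (band_arr_vert _ walk) cd).
exact: acts_as0.
Qed.

Lemma acts_as_functional A : acts_as 0 A -> A = 0.
Proof.
case=> s [s0 ->]; pose P := [fset p in [seq c.2 | c <- s]]%fset.
pose cf p := \sum_(c <- s | c.2 == p) c.1.
have collect (W : zmodType) (f : k -> qpath Q -> W) :
    (forall p, {morph f^~ p : x y / x + y}) ->
    \sum_(c <- s) f c.1 c.2 = \sum_(p <- P) f (cf p) p.
  move=> fD; have f0 p : f 0 p = 0 by apply: (addIr (f 0 p)); rewrite -fD !add0r.
  under [RHS]eq_bigr do rewrite (big_morph (f^~ _) (fD _) (f0 _)) big_mkcond.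
  rewrite exchange_big /= big_seq [RHS]big_seq; apply: eq_bigr => c cs.
  have cP : c.2 \in P by rewrite !inE; apply: map_f.
  rewrite (bigD1_seq c.2) ?fset_uniq //= eqxx big1 ?addr0 // => p.
  by rewrite eq_sym => /negbTE ->.
pose x : path_comb k Q := [fsfun p in P => cf p | 0].
have xE p : p \in P -> x p = cf p by move=> pP; rewrite fsfunE pP.
have x0 : im_comb pi x = 0.
  rewrite s0 (collect _ (fun c p => c *: im_path pi p)) => [|p c d]; last first.
    by rewrite scalerDl.
  rewrite /im_comb (big_fset_incl _ (B := P)); last first.
  - by move=> p _ /fsfun_dflt ->; rewrite scale0r.
  - apply/fsubsetP => p; rewrite mem_finsupp fsfunE; case: ifP => //.
    by rewrite eqxx.
  by apply: eq_big_seq => p pP; rewrite xE.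
rewrite (collect _ (fun c p => (c%:A : powser k) *: path_mx p)) => [|p c d].
  rewrite big_seq big1 // => p pP; rewrite -xE //.
  case: finsuppP => [_|px]; first by rewrite scale0r scale0r.
  by rewrite (path_mx_relation x0 px) scaler0.
by rewrite !scalerDl.
Qed.

Lemma acts_as_total y : exists A, acts_as y A.
Proof.
have [x <-] := bq_onto pi y.
pose s := [seq (x p, p) | p <- finsupp x].
exists (\sum_(c <- s) (c.1%:A : powser k) *: path_mx c.2).
by exists s; split=> //; rewrite big_map.
Qed.

Definition family_rep (y : L) : 'M[powser k]_n := projT1 (cid (acts_as_total y)).

Lemma family_repE y A : acts_as y A -> family_rep y = A.
Proof.
move=> hA; rewrite /family_rep; case: cid => B hB /=.
apply/eqP; rewrite eq_sym -subr_eq0 addrC; apply/eqP/acts_as_functional.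
by have := acts_as_lin (-1) hB hA; rewrite !scaleN1r addNr.
Qed.

Lemma family_repP y : acts_as y (family_rep y).
Proof. by rewrite /family_rep; case: cid. Qed.

Lemma family_rep_vert w :
  family_rep (im_vert pi w) = band_vert_mx b m (powser k) w.
Proof.
pose p : qpath Q := exist (fun z : vert Q * seq (arr Q) => composable z.1 z.2)
  (w, [::]) isT.
have := family_repE (acts_as_path p).
by rewrite /im_path /path_mx /path_value !big_nil !mulr1.
Qed.

Lemma family_rep_arr c :
  family_rep (im_arr pi c) = band_arr_mx b family_mx c.
Proof.
have cP : composable (src c, [:: c]).1 (src c, [:: c]).2 by rewrite /= eqxx.
pose p : qpath Q := exist (fun z : vert Q * seq (arr Q) => composable z.1 z.2)
  (src c, [:: c]) cP.
have := family_repE (acts_as_path p).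
rewrite /im_path /path_mx /path_value !big_seq1 (im_vert_arr pi).
by rewrite (band_vert_arr _ walk).
Qed.

Lemma res_family_rep y : @res_mx k (ps_chat k) n n (family_rep y) = rep_mx v y.
Proof.
have res_vert w : @res_mx k (ps_chat k) n n (band_vert_mx b m (powser k) w) =
    rep_mx v (im_vert pi w).
  rewrite rep_mx_vert; apply/matrixP => p q; rewrite !mxE.
  by case: (_ && _); [exact: res1 | exact: raddf0].
have res_arr c : @res_mx k (ps_chat k) n n (band_arr_mx b family_mx c) =
    rep_mx v (im_arr pi c).
  rewrite rep_mx_arr; apply/matrixP => p q; rewrite !mxE.
  rewrite (resD (R := ps_chat k)); congr (_ + _); case: ifP => _ //.
    by rewrite /= /ps_res mulr1n addr0.
  by rewrite /= /ps_res mulr1n addr0.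
have res_path p : @res_mx k (ps_chat k) n n (path_mx p) = rep_mx v (im_path pi p).
  rewrite /path_mx /path_value /im_path (rep_mxM basis_v).
  rewrite -[X in res_mx X]/(_ *m _) (res_mxM (R := ps_chat k)) res_vert.
  congr (_ *m _); elim: (qarrows p) => [|c s IHs].
    by rewrite !big_nil (rep_mx1 basis_v) -[1]/(1%:M) -(base_mx1 (ps_chat k)) res_base_mx.
  rewrite !big_cons (rep_mxM basis_v) -IHs -res_arr.
  by rewrite -[X in res_mx X]/(_ *m _) (res_mxM (R := ps_chat k)).
have [s [-> ->]] := family_repP y.
elim: s => [|c s IHs].
  rewrite !big_nil; have := rep_mx_linear basis_v (-1) 0 0.
  rewrite scaler0 addr0 scaleN1r addNr => ->.
  by apply/matrixP => i j; rewrite !mxE.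
rewrite !big_cons (rep_mx_linear basis_v) -IHs -res_path.
rewrite (res_mx_is_semilinear (R := ps_chat k)); congr (_ *: _ + _).
by rewrite (resZ (R := ps_chat k)) res1 mulr1.
Qed.

Lemma family_rep_lift : @mx_lift k L V n v (ps_chat k) family_rep.
Proof.
have vertP w : acts_as (im_vert pi w) (band_vert_mx b m (powser k) w).
  by rewrite -family_rep_vert; apply: family_repP.
split=> [c x y||x y|y].
- by apply/family_repE/acts_as_lin; apply: family_repP.
- apply: family_repE; rewrite -(im_vert_sum pi) -[1%:M]/(1%R).
  by rewrite -(band_vert_mx_sum b m (powser k)); apply: acts_as_sum.
- by apply/family_repE/acts_asM; apply: family_repP.
exact: res_family_rep.
Qed.

Lemma tangent_arr c : tangent family_rep (im_arr pi c) =
  band_arr_mx b (fun i => if i.+1 == r then delta_mx ord_max ord0 else 0) c.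
Proof.
have entry i y x : (family_mx i y x : powser k) 1%N =
    (if i.+1 == r then delta_mx ord_max ord0 else 0 : 'M[k]_m) y x.
  rewrite mxE /= mulr0n add0r; case: eqP => _; rewrite !mxE //=.
apply/matrixP => p q; rewrite mxE family_rep_arr !mxE ps_coefD.
by congr (_ + _); case: ifP => _ //; rewrite -entry mxE.
Qed.

(** On the diagonal blocks [Y i] of a matrix making the tangent inner, the
    letters other than the last force all [Y i] to be equal, and the last
    letter makes the elementary matrix a commutator of its matrix [J] with
    [Y]. This contradicts the vanishing of the trace of a commutator with [J]
    times a matrix that commutes with [J]. *)
Lemma tangent_not_inner : ~ inner_mx v (tangent family_rep).
Proof.
case=> X hX.
pose Y i : 'M[k]_m := \matrix_(x, y) X (band_idx i x) (band_idx i y).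
pose MT i := (letter_mx b lambda m i)^T.
pose D : 'M[k]_m := delta_mx ord0 ord_max.
pose ET (i : 'I_r) : 'M[k]_m := if i.+1 == r then D else 0.
have block i : ET i = MT i *m Y (ordS i) - Y i *m MT i \/
               ET i = MT i *m Y i - Y (ordS i) *m MT i.
  case bi: (tnth b i) => [c []]; [left|right]; apply/matrixP => x z.
  - have := congr1 (fun A : 'M_n => A (band_idx i x) (band_idx (ordS i) z)) (hX (im_arr pi c)).
    rewrite /= tangent_arr rep_mx_arr (band_arr_fwd _ reduced _ _ bi).
    rewrite band_pos_idx band_coord_idx eqxx => h.
    have -> : ET i x z = (if i.+1 == r then delta_mx ord_max ord0 else 0 : 'M[k]_m) z x.
      by rewrite /ET; case: ifP => _; rewrite !mxE // andbC.
    rewrite h !mxE; congr (_ - _).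
      rewrite (sum_block (j := ordS i)) => [|j w ji].
        apply: eq_bigr => w _; rewrite (band_arr_fwd _ reduced _ _ bi).
        by rewrite band_pos_idx band_coord_idx eqxx !mxE.
      by rewrite (band_arr_fwd _ reduced _ _ bi) band_pos_idx eq_sym (negbTE ji) mul0r.
    rewrite (sum_block (j := i)) => [|j w ji].
      apply: eq_bigr => w _; rewrite (band_arr_fwd' _ reduced _ _ bi).
      by rewrite band_pos_idx band_coord_idx eqxx !mxE.
    by rewrite (band_arr_fwd' _ reduced _ _ bi) band_pos_idx (negbTE ji) mulr0.
  have := congr1 (fun A : 'M_n => A (band_idx (ordS i) x) (band_idx i z)) (hX (im_arr pi c)).
  rewrite /= tangent_arr rep_mx_arr (band_arr_bwd _ reduced _ _ bi).
  rewrite band_pos_idx band_coord_idx eqxx => h.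
  have -> : ET i x z = (if i.+1 == r then delta_mx ord_max ord0 else 0 : 'M[k]_m) z x.
    by rewrite /ET; case: ifP => _; rewrite !mxE // andbC.
  rewrite h !mxE; congr (_ - _).
    rewrite (sum_block (j := i)) => [|j w ji].
      apply: eq_bigr => w _; rewrite (band_arr_bwd _ reduced _ _ bi).
      by rewrite band_pos_idx band_coord_idx eqxx !mxE.
    by rewrite (band_arr_bwd _ reduced _ _ bi) band_pos_idx (negbTE ji) mul0r.
  rewrite (sum_block (j := ordS i)) => [|j w ji].
    apply: eq_bigr => w _; rewrite (band_arr_bwd' _ reduced _ _ bi).
    by rewrite band_pos_idx band_coord_idx eqxx !mxE.
  by rewrite (band_arr_bwd' _ reduced _ _ bi) band_pos_idx eq_sym (negbTE ji) mulr0.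
have r0 : (0 < r)%N.
  by case: band_b => -[/hasP[l lb _] _] _ _ _ _; rewrite -(size_tuple b); case: (tval b) lb.
pose i0 : 'I_r := Ordinal r0.
have Y0 e (er : (e < r)%N) : Y (Ordinal er) = Y i0.
  elim: e er => [|e IHe] er; first by congr Y; apply: val_inj.
  have er' : (e < r)%N := ltnW er.
  rewrite -(IHe er'); have -> : Ordinal er = ordS (Ordinal er').
    by apply: val_inj; rewrite /= modn_small.
  have := block (Ordinal er').
  rewrite /ET /MT /letter_mx /= (ltn_eqF er) trmx1 !mul1mx !mulmx1.
  by case=> /esym/eqP; rewrite subr_eq0 => /eqP ->.
have rl : (r.-1 < r)%N by rewrite prednK.
pose il : 'I_r := Ordinal rl.
have Sil : ordS il = i0 by apply: val_inj; rewrite /= prednK // modnn.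
have D_comm : D = MT il *m Y i0 - Y i0 *m MT il.
  by have := block il; rewrite Sil (Y0 _ rl) /ET /= prednK // eqxx => -[].
(* [D'] commutes with the transposed Jordan block and [D *m D'] has trace 1. *)
pose D' : 'M[k]_m := delta_mx ord_max ord0.
have [mu muE] : exists mu, MT il = (jordan_block m mu)^T.
  by rewrite /MT /letter_mx /= prednK // eqxx; eexists.
have DJ : D' *m MT il = MT il *m D'.
  apply/matrixP => x z; rewrite mxE (bigD1 ord0) //= big1 => [|w w0]; last first.
    by rewrite mxE (negbTE w0) andbF mul0r.
  rewrite [RHS]mxE [RHS](bigD1 ord_max) //= [X in _ = _ + X]big1 => [|w w0].
    rewrite !addr0 muE !mxE !eqxx /= andbT addr0 [_ == x]eq_sym.
    have -> : (m'.+1 == x :> nat) = false by rewrite gtn_eqF.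
    rewrite addr0; case: (x == _); case: (z == _);
      by rewrite ?mulr1n ?mulr0n ?mul0r ?mulr0 ?mul1r ?mulr1.
  by rewrite [D' _ _]mxE (negbTE w0) mulr0.
have : \tr (D *m D') = 0.
  rewrite D_comm mulmxBl raddfB /= -!mulmxA mxtrace_mulC -DJ -mulmxA.
  by rewrite mxtrace_mulC DJ subrr.
rewrite mul_delta_mx /mxtrace (bigD1 ord0) //= mxE !eqxx big1 ?addr0 => [/eqP|i].
  by rewrite oner_eq0.
by rewrite mxE => /negbTE ->.
Qed.

End BandFamily.

(** * Dual numbers *)

Section DualNumbers.
Variable k : fieldType.

Definition dual_numbers : Type := (k * k)%type.

HB.instance Definition _ := GRing.Lmodule.copy dual_numbers (k^o * k^o)%type.

Definition dual_mul (x y : dual_numbers) : dual_numbers :=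
  (x.1 * y.1, x.1 * y.2 + x.2 * y.1).

Fact dual_mulA : associative dual_mul.
Proof. by case=> x x' [y y'] [z z']; congr (_, _) => /=; ring. Qed.
Fact dual_mulC : commutative dual_mul.
Proof. by case=> x x' [y y']; congr (_, _) => /=; ring. Qed.
Fact dual_mul1 : left_id (1, 0) dual_mul.
Proof. by case=> x x'; congr (_, _) => /=; ring. Qed.
Fact dual_mulDl : left_distributive dual_mul +%R.
Proof. by case=> x x' [y y'] [z z']; congr (_, _) => /=; ring. Qed.
Fact dual_1neq0 : (1, 0) != 0 :> dual_numbers.
Proof. by rewrite xpair_eqE oner_eq0. Qed.

HB.instance Definition _ := GRing.Zmodule_isComNzRing.Build dual_numbers
  dual_mulA dual_mulC dual_mul1 dual_mulDl dual_1neq0.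

Fact dual_scaleAl (c : k) (x y : dual_numbers) : c *: (x * y) = c *: x * y.
Proof.
case: x y => x x' [y y']; congr (_, _); rewrite /= /GRing.scale /=; ring.
Qed.

HB.instance Definition _ :=
  GRing.Lmodule_isLalgebra.Build k dual_numbers dual_scaleAl.
HB.instance Definition _ := GRing.Lalgebra_isComAlgebra.Build k dual_numbers.

Definition dual_res (x : dual_numbers) : k^o := x.1.

Fact dual_res_is_linear : linear dual_res. Proof. by []. Qed.
Fact dual_res_is_multiplicative : monoid_morphism dual_res. Proof. by []. Qed.
HB.instance Definition _ :=
  GRing.isLinear.Build k dual_numbers k^o *:%R dual_res dual_res_is_linear.
HB.instance Definition _ :=
  GRing.isMonoidMorphism.Build dual_numbers k^o dual_res dual_res_is_multiplicative.

Lemma dual_mulE (x y : dual_numbers) :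
  x * y = (x.1 * y.1, x.1 * y.2 + x.2 * y.1).
Proof. by []. Qed.

Lemma dual_local x : dual_res x != 0 -> exists y, x * y = 1.
Proof.
case: x => a a'; rewrite /dual_res /= => a0.
exists (a^-1, - (a' / a ^+ 2)); rewrite dual_mulE /=; congr (_, _).
  by rewrite divff.
by field.
Qed.

Lemma dual_noetherian : noetherian dual_numbers.
Proof.
move=> I [I0 ID IM].
case: (pselect (exists2 x, I x & dual_res x != 0)) => [[x Ix x0]|no1].
  have I1 y : I y.
    by have [z xz] := dual_local x0; rewrite -[y]mulr1 -xz mulrCA mulrC; apply: IM.
  by exists 1%N, (fun=> 1) => y; split=> // _; exists (fun=> y); rewrite big_ord1 mulr1.
have I1 x : I x -> x.1 = 0.
  by move=> Ix; apply/eqP/negPn/negP => x0; apply: no1; exists x.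
case: (pselect (exists2 x, I x & x.2 != 0)) => [[x Ix x0]|no2].
  have x1 := I1 x Ix; have xE : x = (0, x.2) by rewrite -x1 -surjective_pairing.
  exists 1%N, (fun=> x) => y; split=> [Iy|[c ->]]; last first.
    by rewrite big_ord1; apply: IM.
  exists (fun=> (y.2 / x.2, 0)); rewrite big_ord1 dual_mulE /= mul0r addr0.
  by rewrite x1 mulr0 divfK // -(I1 y Iy) -surjective_pairing.
exists 0%N, (fun=> 0) => x; split=> [Ix|[c ->]]; last by rewrite big_ord0.
exists (fun=> 0); rewrite big_ord0 [x]surjective_pairing (I1 x Ix).
by congr (_, _); apply/eqP/negPn/negP => x0; apply: no2; exists x.
Qed.

Lemma dual_pow1 x : ideal_pow (fun x => dual_res x = 0) 1 x -> x.1 = 0.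
Proof.
case=> s hs ->; rewrite -[LHS]/(dual_res _) raddf_sum big_seq big1 // => p.
by case/hs=> h _; rewrite -[LHS]/(_ * _) -[p.1.1]/(dual_res p.1) h mul0r.
Qed.

Lemma dual_pow2 n x : ideal_pow (fun x => dual_res x = 0) n.+2 x -> x = 0.
Proof.
elim: n x => [|n IHn] x [s hs ->]; rewrite big_seq big1 // => p /hs[h1].
  by move/dual_pow1 => h2; rewrite dual_mulE h2 (h1 : p.1.1 = 0) !mul0r mulr0 addr0.
by move/IHn ->; rewrite mulr0.
Qed.

Lemma dual_complete : adically_complete (fun x => dual_res x = 0).
Proof.
split=> [x /(_ 2%N)/dual_pow2 //|u hu]; exists (u 2%N) => n.
case: n => [|[|n]]; [by [] | exact: hu |].
have -> : u n.+2 = u 2%N.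
  elim: n => // n IHn; have /dual_pow2/eqP := hu n.+2.
  by rewrite subr_eq0 IHn => /eqP.
by rewrite subrr; exists [::]; rewrite ?big_nil.
Qed.

Definition dual_chat : chat k := @Chat k dual_numbers dual_res dual_local
  dual_noetherian dual_complete.

Lemma dual_chatP : is_dual_numbers dual_chat.
Proof.
exists ((0, 1) : dual_numbers).
  by rewrite dual_mulE /= !mul0r mulr0 addr0.
have E (c : k * k) : c.1 *: (1 : dual_numbers) + c.2 *: ((0, 1) : dual_numbers) = c.
  by case: c => c d; congr (_, _); rewrite /= /GRing.scale /=; ring.
by move=> x; exists x; split=> [|c ->]; rewrite E.
Qed.

Section ToDual.
Variables (R : chat k) (ell : R -> k).
Hypotheses (ell_lin : forall c x y, ell (c *: x + y) = c * ell x + ell y)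
  (ell_der : forall x y, ell (x * y) = chat_res R x * ell y + ell x * chat_res R y).

Definition to_dual (x : R) : dual_numbers := (chat_res R x, ell x).

Fact to_dual_is_linear : linear to_dual.
Proof. by move=> c x y; rewrite /to_dual resD resZ ell_lin. Qed.

Fact to_dual_is_multiplicative : monoid_morphism to_dual.
Proof.
split=> [|x y]; last by rewrite /to_dual resM ell_der.
rewrite /to_dual res1; congr (_, _); have := ell_der 1 1.
rewrite mulr1 res1 mul1r mulr1 -[X in X = _]addr0.
by move/addrI => <-.
Qed.

HB.instance Definition _ :=
  GRing.isLinear.Build k R dual_numbers *:%R to_dual to_dual_is_linear.
HB.instance Definition _ :=
  GRing.isMonoidMorphism.Build R dual_numbers to_dual to_dual_is_multiplicative.

Lemma to_dual_hom : exists theta : chat_hom R dual_chat, theta =1 to_dual.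
Proof. exact: (@chat_hom_of_lrmorphism k R dual_chat to_dual). Qed.

End ToDual.
End DualNumbers.

(** * Lifts defined by matrices *)

Section MatrixLifts.
Variables (k : fieldType) (L : falgType k) (V : rmod L) (n : nat).
Variable v : n.-tuple V.
Hypothesis basis_v : basis_of fullv v.

Lemma exists_mx_lift (R : chat k) (rho : L -> 'M[R]_n) : mx_lift v rho ->
  exists (M : mod_lift V R) c, @presents k L V n v R M c rho.
Proof.
case=> r_lin r1 rM r_res.
have act_lin y : linear (fun x : 'rV[R]_n => x *m rho y).
  by move=> c x z; rewrite mulmxDl scalemxAl.
pose act y : {linear 'rV[R]_n -> 'rV[R]_n} :=
  HB.pack (fun x : 'rV[R]_n => x *m rho y)
    (GRing.isLinear.Build _ _ _ _ (fun x : 'rV[R]_n => x *m rho y) (act_lin y)).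
pose phi (x : 'rV[R]_n) := of_row v (res_mx x).
have act_free : free_of_finite_rank 'rV[R]_n.
  exists n, (fun i => delta_mx 0 i) => x; exists [ffun i => x 0 i]; split.
    by rewrite {1}[x]row_sum_delta; apply: eq_bigr => i _; rewrite ffunE.
  move=> c xE; apply/ffunP => i; rewrite ffunE xE summxE (bigD1 i) //= big1.
    by rewrite !mxE !eqxx mulr1 addr0.
  by move=> j ji; rewrite !mxE eq_sym (negbTE ji) andbF mulr0.
have phi_lin : semilinear_along (chat_res R : R -> k) phi.
  by move=> c x y; rewrite /phi res_mx_is_semilinear linearP.
have phi_iso : extension_of_scalars (chat_res R : R -> k) phi.
  split=> // P g g_lin.
  have gD : {morph g : x y / x + y}.
    by move=> x y; have := g_lin 1 x y; rewrite !scale1r res1 scale1r.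
  have g0 : g 0 = 0 by apply: (addIr (g 0)); rewrite -gD !add0r.
  have gE x : g x = \sum_i chat_res R (x 0 i) *: g (delta_mx 0 i).
    rewrite {1}[x]row_sum_delta (big_morph g gD g0); apply: eq_bigr => i _.
    by have := g_lin (x 0 i) (delta_mx 0 i) 0; rewrite g0 !addr0.
  have h_lin : linear (fun w => g (base_mx R (to_row v w))).
    move=> c x y; rewrite linearP base_mx_is_linear g_lin resZ res1 mulr1 //.
  exists (mk_linear h_lin); split=> [x|h' h'E w] /=.
    rewrite /phi of_rowK // gE [RHS]gE; apply: eq_bigr => i _; congr (_ *: _).
    by rewrite !mxE resZ res1 mulr1.
  by rewrite -h'E /phi res_base_mx to_rowK.
have actP c x y z : act (c *: x + y) z = (c *: (1 : R)) *: act x z + act y z.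
  by rewrite /= r_lin mulmxDr scalemxAr.
have act1 x : act 1 x = x by rewrite /= r1 mulmx1.
have actM x y z : act (x * y) z = act y (act x z) by rewrite /= rM mulmxA.
have phi_act y x : phi (act y x) = ract V y (phi x).
  by rewrite /phi /= res_mxM r_res mul_rep_mx to_rowK.
exists (ModLift actP act1 actM act_free phi_iso phi_act), id.
by split=> //; exists id.
Qed.

End MatrixLifts.

(** * Composition of deformation maps *)

Section Composition.
Variables (k : fieldType) (L : falgType k) (V : rmod L).

Lemma lift_map_deformation_map (R S : chat k) (psi : chat_hom R S)
    (M : mod_lift V R) (M' : mod_lift V S) (j : M -> M') :
  lift_map psi j -> deformation_map psi M M'.
Proof.
move=> hj; have basis_v := vbasisP (fullv : {vspace V}).
have [c [rho c_pres]] := lift_presentation basis_v M.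
have [c' [rho' c'_pres]] := lift_presentation basis_v M'.
have [g hg] := lift_map_mx basis_v c_pres c'_pres hj.
exact: (intertwiner_deformation_map c_pres c'_pres hg).
Qed.

Lemma deformation_map_comp (R S T : chat k) (psi : chat_hom R S)
    (chi : chat_hom S T) (theta : chat_hom R T)
    (M : mod_lift V R) (M' : mod_lift V S) (M'' : mod_lift V T) :
  (forall x, theta x = chi (psi x)) ->
  deformation_map psi M M' -> deformation_map chi M' M'' ->
  deformation_map theta M M''.
Proof.
move=> thetaE /deformation_map_lift_map[j [j_lin j_act j_phi]].
move=> /deformation_map_lift_map[j' [j'_lin j'_act j'_phi]].
apply: (@lift_map_deformation_map _ _ _ _ _ (j' \o j)).
split=> [r x y|y x|x] /=.
- by rewrite j_lin j'_lin thetaE.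
- by rewrite j_act j'_act.
by rewrite j'_phi j_phi.
Qed.

Lemma deformation_map_id (R : chat k) (theta : chat_hom R R) (M : mod_lift V R) :
  theta =1 id -> deformation_map theta M M.
Proof.
move=> thetaE; apply: (@lift_map_deformation_map _ _ _ _ _ id).
by split=> // r x y; rewrite thetaE.
Qed.

Lemma exists_hom_comp (R S T : chat k) (psi : chat_hom R S)
    (chi : chat_hom S T) : exists theta : chat_hom R T,
  forall x, theta x = chi (psi x).
Proof.
have [|theta thetaE] := @chat_hom_of_lrmorphism k R T (chi \o psi).
  by move=> x /=; rewrite !chat_fun_res.
by exists theta.
Qed.

End Composition.

(** * Versal rings and the power series ring *)

Section VersalRing.
Variables (k : fieldType) (L : falgType k) (V : rmod L).
Variable U0 : mod_lift V (ps_chat k).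
Hypothesis U0_univ : universal U0.
Variables (R : chat k) (U : mod_lift V R).
Hypothesis U_versal : versal U.

Local Notation t := (@ps_t k : ps_chat k).

Variable phi : chat_hom (ps_chat k) R.
Hypothesis phiU : deformation_map phi U0 U.

(** Homomorphisms to the dual numbers with the same value at the image of [t]
    give isomorphic deformations, hence are equal by versality. *)
Lemma hom_dual_unique (theta theta' : chat_hom R (dual_chat k)) :
  theta (phi t) = theta' (phi t) -> theta =1 theta'.
Proof.
move=> tt'; have basis_v := vbasisP (fullv : {vspace V}).
have [c0 [rho0 c0_pres]] := lift_presentation basis_v U0.
have [c [rho c_pres]] := lift_presentation basis_v U.
have [j hj] := deformation_map_lift_map phiU.
have [g [g_res g_comm]] := lift_map_mx basis_v c0_pres c_pres hj.
have theta_phi x : theta (phi x) = theta' (phi x).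
  have [h hE] := exists_hom_comp phi theta.
  have [h' h'E] := exists_hom_comp phi theta'.
  by rewrite -hE -h'E; apply: ps_hom_eq; rewrite hE h'E.
have [r_lin r1 rM r_res] := presents_mx_lift basis_v c_pres.
have rho_lift : mx_lift (vbasis (fullv : {vspace V}))
    (fun y => hom_mx theta (rho y)).
  split=> [e x y||x y|y].
  - by rewrite r_lin hom_mx_linear homZ hom1.
  - by rewrite r1 hom_mx1.
  - by rewrite rM hom_mxM.
  by rewrite res_hom_mx r_res.
have [N [cN N_pres]] := exists_mx_lift basis_v rho_lift.
have thetaN : deformation_map theta U N.
  apply: (intertwiner_deformation_map c_pres N_pres (g := 1%:M)).
  split=> [|y]; first by rewrite -(base_mx1 (dual_chat k)) res_base_mx.
  by rewrite mulmx1 mul1mx.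
apply: (U_versal.2 _ N theta theta') => //; first exact: dual_chatP.
have g'_res : res_mx (hom_mx theta' g) = 1%:M by rewrite res_hom_mx.
have [h [gh hg]] := res_mx_unit g'_res.
apply: (intertwiner_deformation_map c_pres N_pres (g := h *m hom_mx theta g)).
split=> [|y].
  rewrite res_mxM res_hom_mx g_res mulmx1 -[res_mx h]mul1mx -g'_res -res_mxM gh.
  by rewrite -(base_mx1 (dual_chat k)) res_base_mx.
rewrite -mulmxA -hom_mxM -g_comm hom_mxM.
have -> : hom_mx theta (hom_mx phi (rho0 y)) = hom_mx theta' (hom_mx phi (rho0 y)).
  by apply/matrixP => i l; rewrite !mxE theta_phi.
have -> : hom_mx theta' (rho y) *m (h *m hom_mx theta g)
    = h *m (hom_mx theta' g *m hom_mx theta' (rho y)) *m h *m hom_mx theta g.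
  by rewrite !mulmxA hg mul1mx.
by rewrite -hom_mxM -g_comm hom_mxM -!mulmxA [_ *m (h *m _)]mulmxA gh mul1mx.
Qed.

(** A linear form on the maximal ideal that vanishes on its square and on the
    image of [t] defines a homomorphism to the dual numbers. By
    [hom_dual_unique] it agrees with the one defined by the zero form, so there
    is no nonzero form of this kind. *)
Lemma maxideal_generated x : mpow 1 x ->
  exists c : k, mpow 2 (x - c *: phi t).
Proof.
pose J (y : R) := exists c : k, mpow 2 (y - c *: phi t).
have J2 y : mpow 2 y -> J y by exists 0; rewrite scale0r subr0.
have JL c u w : J u -> J w -> J (c *: u + w).
  case=> d hd [e he]; exists (c * d + e).
  rewrite scalerDl opprD addrACA -scalerA -scalerBr.
  by apply: mpowD => //; apply: mpowZ.
have J0 : J 0 by apply: J2; apply: mpow_zero.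
have JD u w : J u -> J w -> J (u + w).
  by move=> hu hw; rewrite -[u]scale1r; apply: JL.
have phi_t1 : mpow 1 (phi t) by apply: mpow_hom_t.
have max_ideal : is_ideal (@maxideal k R).
  split=> [|u w|u w]; rewrite /maxideal; first exact: raddf0.
    by rewrite resD => -> ->; rewrite addr0.
  by rewrite resM => ->; rewrite mulr0.
have [l [e eP]] := chat_noeth max_ideal.
have e1 i : mpow 1 (e i).
  apply/mpow1P/eP; exists (fun j => (j == i)%:R); rewrite (bigD1 i) //= eqxx mul1r.
  by rewrite big1 ?addr0 // => j /negbTE ->; rewrite mul0r.
have [B [C [indep gen]]] := @basis_modulo k R J 'I_l e J0 JL.
have J_sum (I : finType) (P : pred I) (F : I -> R) :
    (forall i, P i -> J (F i)) -> J (\sum_(i | P i) F i).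
  by move=> h; apply: (big_ind J).
have expand y : mpow 1 y -> exists z : 'I_l -> k, J (y - \sum_(i in B) z i *: e i).
  move/mpow1P/eP => [c ->].
  exists (fun b => \sum_i chat_res R (c i) * C i b).
  have -> : \sum_(b in B) (\sum_i chat_res R (c i) * C i b) *: e b =
      \sum_i chat_res R (c i) *: \sum_(b in B) C i b *: e b.
    under eq_bigr do rewrite scaler_suml.
    rewrite exchange_big; apply: eq_bigr => i _ /=; rewrite scaler_sumr.
    by apply: eq_bigr => b _; rewrite scalerA.
  rewrite -sumrB; apply: J_sum => i _.
  rewrite -(subrKA (chat_res R (c i) *: e i)) addrC -scalerBr.
  apply: JL => //; apply: J2.
  have -> : c i * e i - chat_res R (c i) *: e i =
      (c i - chat_res R (c i) *: 1) * e i by rewrite mulrBl mulr_algl.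
  by apply: (@mpowM _ _ 1 1) => //; apply: mpow_residue.
case: (set_0Vmem B) => [B0|[beta betaB]].
  move=> /expand[z]; rewrite B0 big_pred0 ?subr0 // => i; exact: in_set0.
have [z zE] := choice (fun y => expand _ (@mpow_residue k R y)).
(* The coordinate of [e beta] is a derivation, because products of two elements
   of the maximal ideal lie in [J]. *)
pose ell y := z y beta.
have ellE y (w : 'I_l -> k) :
    J (y - chat_res R y *: 1 - \sum_(i in B) w i *: e i) -> ell y = w beta.
  move=> hw; apply/eqP; rewrite -subr_eq0; apply/eqP.
  apply: (indep (fun i => z y i - w i)) betaB.
  have -> : \sum_(i in B) (z y i - w i) *: e i =
    -1 *: (y - chat_res R y *: 1 - \sum_(i in B) z y i *: e i)
      + (y - chat_res R y *: 1 - \sum_(i in B) w i *: e i).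
    rewrite scaleN1r opprB -addrA [- _ + (_ - _)]addrA addNr add0r -sumrB.
    by apply: eq_bigr => i _; rewrite scalerBl.
  exact: JL.
have ell_lin c u w : ell (c *: u + w) = c * ell u + ell w.
  apply: (ellE _ (fun i => c * z u i + z w i)).
  have -> : c *: u + w - chat_res R (c *: u + w) *: 1
        - \sum_(i in B) (c * z u i + z w i) *: e i =
      c *: (u - chat_res R u *: 1 - \sum_(i in B) z u i *: e i)
        + (w - chat_res R w *: 1 - \sum_(i in B) z w i *: e i).
    have -> : \sum_(i in B) (c * z u i + z w i) *: e i =
        c *: (\sum_(i in B) z u i *: e i) + \sum_(i in B) z w i *: e i.
      rewrite scaler_sumr -big_split; apply: eq_bigr => i _ /=.
      by rewrite scalerDl scalerA.
    rewrite resD resZ !scalerBr scalerDl !scalerA !opprD.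
    by rewrite [RHS]addrACA; congr (_ + _); rewrite addrACA.
  exact: JL.
have ell_der u w : ell (u * w) = chat_res R u * ell w + ell u * chat_res R w.
  apply: (ellE _ (fun i => chat_res R u * z w i + z u i * chat_res R w)).
  pose a := chat_res R u; pose d := chat_res R w.
  pose Zu := \sum_(i in B) z u i *: e i; pose Zw := \sum_(i in B) z w i *: e i.
  have -> : u * w - chat_res R (u * w) *: 1
      - \sum_(i in B) (chat_res R u * z w i + z u i * chat_res R w) *: e i =
      a *: (w - d *: 1 - Zw) + (d *: (u - a *: 1 - Zu)
        + (u - a *: 1) * (w - d *: 1)).
    have -> : \sum_(i in B) (chat_res R u * z w i + z u i * chat_res R w) *: e i
        = a *: Zw + d *: Zu.
      rewrite !scaler_sumr -big_split; apply: eq_bigr => i _ /=.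
      by rewrite scalerDl !scalerA [d * _]mulrC.
    have adE : (a * d)%:A = a%:A * d%:A :> R by rewrite mulr_algl scalerA.
    rewrite resM -/a -/d adE -(mulr_algl a (w - _ - _)) -(mulr_algl a Zw).
    rewrite -(mulr_algl d (u - _ - _)) -(mulr_algl d Zu).
    by move: Zu Zw (a%:A) (d%:A) => Zu Zw A D; ring.
  apply: (JL); first exact: zE.
  apply: JL; first exact: zE.
  by apply: J2; apply: (@mpowM _ _ 1 1); apply: mpow_residue.
have [theta thetaE] := to_dual_hom ell_lin ell_der.
have zero_lin c u w : (fun=> 0 : k) (c *: u + w : R) = c * 0 + 0.
  by rewrite mulr0 addr0.
have zero_der u w : (fun=> 0 : k) (u * w : R) = chat_res R u * 0 + 0 * chat_res R w.
  by rewrite mulr0 mul0r addr0.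
have [theta0 theta0E] := to_dual_hom zero_lin zero_der.
have ell_t : ell (phi t) = 0.
  apply: (ellE _ (fun=> 0)); rewrite big1 => [|i _]; last by rewrite scale0r.
  have /mpow1P -> := phi_t1; rewrite scale0r !subr0.
  by exists 1; rewrite scale1r subrr; apply: mpow_zero.
have ell_e : ell (e beta) = 1.
  rewrite (ellE _ (fun i => (i == beta)%:R)) ?eqxx //.
  have /mpow1P -> := e1 beta; rewrite scale0r subr0 (bigD1 beta) //= eqxx scale1r.
  rewrite big1 ?addr0 ?subrr // => i /andP[_ /negbTE ->].
  by rewrite scale0r.
have eq_theta : theta =1 theta0.
  by apply: hom_dual_unique; rewrite thetaE theta0E /to_dual ell_t.
have := eq_theta (e beta); rewrite thetaE theta0E /to_dual ell_e.
by case=> /eqP; rewrite oner_eq0.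
Qed.

(** Multiply out the approximations of the two factors given by
    [maxideal_generated] and by the induction hypothesis. *)
Lemma mpow_generated n x : mpow n x ->
  exists c : k, mpow n.+1 (x - c *: phi t ^+ n).
Proof.
elim: n x => [|n IHn] x.
  by exists (chat_res R x); rewrite expr0; apply: mpow_residue.
move=> [s hs ->]; elim: s hs => [|p s IHs] hs.
  by exists 0; rewrite big_nil scale0r subr0; apply: mpow_zero.
have [|c hc] := IHs; first by move=> q qs; apply: hs; rewrite inE qs orbT.
have [|/mpow1P p1 p2] := hs p; first exact: mem_head.
have [a ha] := maxideal_generated p1; have [d hd] := IHn _ p2.
exists (a * d + c); rewrite big_cons scalerDl opprD addrACA; apply: mpowD => //.
have -> : p.1 * p.2 - (a * d) *: phi t ^+ n.+1 =
    (p.1 - a *: phi t) * p.2 + a *: (phi t * (p.2 - d *: phi t ^+ n)).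
  rewrite mulrBl mulrBr scalerBr exprS -scalerAl addrA subrK.
  by rewrite -scalerAr scalerA.
apply: mpowD; first by rewrite -[n.+2]/(2 + n)%N; apply: mpowM.
by apply: mpowZ; rewrite -[n.+2]/(1 + n.+1)%N; apply: mpowM => //; apply: mpow_hom_t.
Qed.

(** The coefficients of a preimage are found one after the other by
    [mpow_generated]. *)
Lemma phi_onto x : exists f, phi f = x.
Proof.
have step (p : nat * R) : exists c : k, mpow p.1 p.2 ->
    mpow p.1.+1 (p.2 - c *: phi t ^+ p.1).
  case: (pselect (mpow p.1 p.2)) => [/mpow_generated[c hc]|no].
    by exists c.
  by exists 0 => /no.
have [c cP] := choice step.
pose u := fix u n := if n is n'.+1 then u n' - c (n', u n') *: phi t ^+ n' else x.
have u_pow n : mpow n (u n).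
  by elim: n => [|n IHn]; [apply: mpow0 | apply: (cP (n, u n))].
pose f : ps_chat k := fun n => c (n, u n).
have uE n : u n = x - ps_partial (phi t) f n.
  elim: n => [|n IHn]; first by rewrite /ps_partial big_ord0 subr0.
  by rewrite /= {1}IHn /ps_partial big_ord_recr /= opprD addrA.
exists f; apply/eqP; rewrite -subr_eq0; apply/eqP/mpow_separated => n.
rewrite -(subrKA (ps_partial (phi t) f n)); apply: mpowD; first exact: ps_homP.
by rewrite -opprB -uE; apply: mpowN.
Qed.

(** The lift [U0] comes from [U] along some [psi], and universality of [U0]
    forces [psi \o phi] to be the identity. *)
Lemma phi_left_inverse : exists psi : chat_hom R (ps_chat k),
  forall f, psi (phi f) = f.
Proof.
have [psi psiU] := U_versal.1 _ U0; exists psi => f.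
have [theta thetaE] := exists_hom_comp phi psi.
have [id' id'E] := @chat_hom_of_lrmorphism k (ps_chat k) (ps_chat k) idfun
  (fun=> erefl).
have [chi [_ chi_uniq]] := U0_univ U0.
rewrite -thetaE (chi_uniq theta); last exact: deformation_map_comp thetaE phiU psiU.
by rewrite -(chi_uniq id') ?id'E //; apply: deformation_map_id.
Qed.

End VersalRing.

Lemma versal_of_universal (k : fieldType) (L : falgType k) (V : rmod L)
    (R : chat k) (U : mod_lift V R) : universal U -> versal U.
Proof.
move=> univ; split=> [S M|S M psi psi' _ h h'].
  by have [psi [h _]] := univ S M; exists psi.
have [chi [_ uniq]] := univ S M.
by move=> x; rewrite (uniq psi) // (uniq psi').
Qed.

Lemma versal_universal_powser (k : fieldType) (L : falgType k) (V : rmod L)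
    (U0 : mod_lift V (ps_chat k)) : universal U0 ->
  forall (R : chat k) (U : mod_lift V R), versal U ->
    universal U /\ alg_iso R (powser k).
Proof.
move=> U0_univ R U U_versal.
have [phi [phiU _]] := U0_univ R U.
have onto := phi_onto U_versal phiU.
have [psi phiK] := phi_left_inverse U0_univ U_versal phiU.
have psiK x : phi (psi x) = x by have [f <-] := onto x; rewrite phiK.
split; last by exists psi; exists phi.
move=> S M; have [chi chiM] := U_versal.1 S M; exists chi; split=> // chi' chi'M x.
have [f <-] := onto x.
have [h hE] := exists_hom_comp phi chi; have [h' h'E] := exists_hom_comp phi chi'.
have [om [_ uniq]] := U0_univ S M.
rewrite -hE -h'E (uniq h); last exact: deformation_map_comp hE phiU chiM.
by rewrite (uniq h') //; apply: deformation_map_comp h'E phiU chi'M.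
Qed.

(** * The versal deformation ring of a band module *)

(** By the product rule for the coefficient of [t]. *)
Lemma derivation_mx_tangent (k : fieldType) (L : falgType k) (V : rmod L)
    (n : nat) (v : n.-tuple V) (rho : L -> 'M[powser k]_n) :
  @mx_lift k L V n v (ps_chat k) rho -> derivation_mx v (tangent rho).
Proof.
case=> r_lin _ rM r_res.
have res0 y i j : rho y i j 0%N = rep_mx v y i j by rewrite -r_res mxE.
split=> [c x y|x y]; apply/matrixP => i j; rewrite !mxE.
  rewrite r_lin !mxE ps_coefD; congr (_ + _).
  by rewrite -[LHS]/((c%:A * rho x i j : powser k) 1%N) mulr_algl.
rewrite rM mxE ps_coef_sum -big_split; apply: eq_bigr => l _ /=.
by rewrite ps_coefM big_ord_recl big_ord1 /= addrC !res0 ![tangent _ _ _ _]mxE.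
Qed.

Lemma band_module_universal_lift (k : fieldType) (L : falgType k) (Q : quiver)
    (pi : bound_quiver_algebra L Q) (V : rmod L) :
  symmetric_algebra L -> band_module pi V -> in_mouth_of_homogeneous_tube V ->
  stable_End_iso_k V ->
  exists U : mod_lift V (ps_chat k), universal U.
Proof.
move=> /symmetric_dual_bases[N [a [b0 [s hs]]]].
case=> r [b [lambda [[|m] [band_b _ // _ [Phi [Phi_bij Phi_vert Phi_arr]]]]]].
case=> T [_ _ ar_T _ _] iso_VT stable_V.
have [v basis_v [vE rowE]] := exists_band_basis Phi_bij.
pose rho := family_rep pi b lambda m.
have rho_lift : @mx_lift k L V _ v (ps_chat k) rho.
  exact: (family_rep_lift band_b Phi_vert Phi_arr basis_v vE rowE).
have not_inner : ~ inner_mx v (tangent rho).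
  exact: (tangent_not_inner band_b Phi_arr vE rowE).
have der_tan D : derivation_mx v D ->
    exists c, inner_mx v (fun y => D y - c *: tangent rho y).
  move=> der_D; apply: (derivation_mx_modulo_inner hs basis_v iso_VT (ar_T 0%N)
    stable_V der_D (derivation_mx_tangent rho_lift) not_inner).
have end_tr (X : 'M[k]__) : _ := @endomorphism_scalar_plus_trace k L _ a b0 s hs
  V _ v basis_v stable_V X.
have [U [c U_pres]] := exists_mx_lift basis_v rho_lift.
exists U => S M.
have [c' [rho' M_pres]] := lift_presentation basis_v M.
have rho'_lift := presents_mx_lift basis_v M_pres.
have [psi [g hg]] := family_versal rho_lift der_tan rho'_lift.
exists psi; split; first exact: (intertwiner_deformation_map U_pres M_pres hg).
move=> psi' /deformation_map_lift_map[j hj].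
have [g' hg'] := lift_map_mx basis_v U_pres M_pres hj.
exact: (family_universal hs rho_lift not_inner end_tr rho'_lift hg' hg).
Qed.

Theorem corollary1p3 (k : closedFieldType) (L : falgType k) (Q : quiver)
  (pi : bound_quiver_algebra L Q) (V : rmod L) :
  special_biserial pi ->
  symmetric_algebra L ->
  band_module pi V ->
  in_mouth_of_homogeneous_tube V ->
  stable_End_iso_k V ->
  (exists (R : chat k) (U : mod_lift V R), versal U) /\
  (forall (R : chat k) (U : mod_lift V R), versal U ->
     universal U /\ alg_iso R (powser k)).
Proof.
move=> _ sym band mouth stab.
have [U univ] := band_module_universal_lift sym band mouth stab.
split; first by exists (ps_chat k), U; apply: versal_of_universal.
exact: versal_universal_powser univ.
Qed.
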